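(* Let $P$ be a finite graph (loops and multiple edges allowed) with first Betti number $b\ge 1$, viewed as a metric graph in which every edge has length $1$ (a combinatorial graph). Let $\|\cdot\|_{st}$ be the stable norm on $H_1(P,\mathbb{R})$, let $\operatorname{Vol}$ be the Haar measure on $H_1(P,\mathbb{R})$ normalised so that the lattice $H_1(P,\mathbb{Z})$ has covolume $1$, and let $V=\operatorname{Vol}(B_{st})$ be the volume of the unit ball of the stable norm. Define the stable zeta function $$\zeta_{st}(z)=\sum_{\theta\in H_1(P,\mathbb{Z})\setminus\{0\}}\frac{1}{\|\theta\|_{st}^{z}}.$$ Then: 1) the series converges for all $z$ with $\operatorname{Re}(z)>b$ and diverges if $\operatorname{Re}(z)<b$; 2) $\zeta_{st}(z)$ extends analytically to the whole complex plane as a meromorphic function with simple poles at $z=1,2,\dots,b$, whose residue at $z=b$ is $bV$; 3) there exist $m\in\mathbb{N}$ and rational numbers $p_{lk}$ ($0\le l\le b-1$, $1\le k\le m$) such that $$\zeta_{st}(z)=bV\,\zeta(z-b+1)+\sum_{l=0}^{b-1}m^{\,l-z}\Big(\sum_{k=1}^{m}p_{lk}\,\zeta\big(z-l;\tfrac{k}{m}\big)\Big),$$ where $\zeta$ is the Riemann zeta function and $\zeta(s;q)$ is the Hurwitz zeta function.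
   Context: For a closed curve in $P$, its length is the sum of the lengths of the edges it traverses (with multiplicity). For $\theta\in H_1(P,\mathbb{Z})$, $l_\theta$ denotes the minimal length of a closed curve in $P$ representing $\theta$. The stable norm is defined on $H_1(P,\mathbb{Z})$ by $\|\theta\|_{st}=\lim_{n\to\infty}l_{n\theta}/n$, and extended by homogeneity and continuity to a norm on $H_1(P,\mathbb{R})$. The Hurwitz zeta function is $\zeta(s;q)=\sum_{n=0}^{\infty}(q+n)^{-s}$ (meromorphically continued to $\mathbb{C}$), for $\operatorname{Re}(q)>0$. Convergence of a series $\sum_{\theta}l_\theta^{-z}$ over a countable index set means: for every $t>0$ the partial sum over $\{\theta: l_\theta\le t\}$ is finite, and these partial sums have a limit as $t\to\infty$.
   Formalization: ''Simple poles at z=1,...,b'' is proved as: at most simple poles there, with residue bV at z=b; poles below b can be absent (two loops at one vertex give 4ζ(z-1), with no pole at z=1). P is taken connected, so that every class is represented by a closed curve. *)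

(* Defs.v *)
From HB Require Import structures.
From mathcomp Require Import all_boot all_order all_algebra.
From mathcomp Require Import all_classical all_reals all_analysis.
From mathcomp.real_closed Require Import complex.
Set Implicit Arguments. Unset Strict Implicit. Unset Printing Implicit Defensive.
Import Order.TTheory GRing.Theory Num.Theory.
Import numFieldNormedType.Exports.
Local Open Scope ring_scope.
Local Open Scope classical_set_scope.

HB.instance Definition _ (R : rcfType) :=
  PseudoPointedMetric.copy R[i] (R[i] : numClosedFieldType).

(* a^w = exp(w log a) for a real base a > 0 and complex exponent w. *)
Definition cpow {R : realType} (a : R) (w : R[i]) : R[i] :=
  Complex (expR (complex.Re w * ln a) * cos (complex.Im w * ln a))
          (expR (complex.Re w * ln a) * sin (complex.Im w * ln a)).

Definition cdifferentiable {R : realType} (f : R[i] -> R[i]) (z : R[i]) : Prop :=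
  exists l : R[i], (fun h : R[i] => (f (z + h) - f z) / h) @ (0 : R[i])^' --> l.

Definition hurwitz_partial {R : realType} (q : R) (s : R[i]) (N : nat) : R[i] :=
  \sum_(0 <= n < N) cpow (q + n%:R) (- s).

(* The meromorphic continuation of the Hurwitz zeta function zeta(s;q) (q>0):
   the function holomorphic on C \ {1} that agrees with the series on Re s > 1
   (unique by the identity theorem). *)
Definition hurwitz_zeta {R : realType} (q : R) : R[i] -> R[i] :=
  get (fun H : R[i] -> R[i] =>
         (forall s : R[i], s != 1 -> cdifferentiable H s) /\
         (forall s : R[i], 1 < complex.Re s -> hurwitz_partial q s @ \oo --> H s)).

Definition riemann_zeta {R : realType} : R[i] -> R[i] := hurwitz_zeta 1.

(* A graph: vertex set V, edge set E, each edge e oriented from src e *)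
(* to tgt e (the orientation only fixes a sign convention for chains). *)
Section Graph.
Variables (V E : finType) (src tgt : E -> V).

Definition adjacent (u v : V) : bool :=
  [exists e, ((src e == u) && (tgt e == v)) || ((src e == v) && (tgt e == u))].

Definition graph_connected : Prop := forall u v : V, connect adjacent u v.

(* integral 1-cycles = H_1(P,Z) (P is 1-dimensional: no boundaries) *)
Definition icycle (th : {ffun E -> int}) : Prop :=
  forall v : V, \sum_(e | tgt e == v) th e = \sum_(e | src e == v) th e.

Definition rcycle {R : realType} (th : E -> R) : Prop :=
  forall v : V, \sum_(e | tgt e == v) th e = \sum_(e | src e == v) th e.

Definition ostart (x : E * bool) : V := if x.2 then src x.1 else tgt x.1.
Definition oend (x : E * bool) : V := if x.2 then tgt x.1 else src x.1.

(* closed edge-paths (closed curves in P up to reparametrisation);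
   the empty walk is the constant curve *)
Definition closed_walk (w : seq (E * bool)) : bool :=
  cycle (fun x y => oend x == ostart y) w.

Definition walk_class (w : seq (E * bool)) : {ffun E -> int} :=
  [ffun e => \sum_(x <- w) (if x.1 == e then (if x.2 then 1 else -1) else 0)].

(* l_theta : minimal length of a closed curve representing theta;
   every edge has length 1, so the length of a walk is its size *)
Definition lmin {R : realType} (th : {ffun E -> int}) : R :=
  inf [set x : R | exists w, closed_walk w /\ walk_class w = th /\ x = (size w)%:R].

Definition iscale (n : nat) (th : {ffun E -> int}) : {ffun E -> int} :=
  [ffun e => th e * n%:Z].

Definition stnorm {R : realType} (th : {ffun E -> int}) : R :=
  limn (fun n => lmin (iscale n th) / n%:R).

Definition stnormR_spec {R : realType} (N : (E -> R) -> R) : Prop :=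
  (forall th, icycle th -> N (fun e => (th e)%:~R) = stnorm th) /\
  (forall (th : E -> R) (t : R), rcycle th -> 0 <= t ->
      N (fun e => t * th e) = t * N th) /\
  (forall th : E -> R, rcycle th -> forall eps : R, 0 < eps ->
     exists2 del : R, 0 < del & forall th' : E -> R, rcycle th' ->
       (forall e, `|th' e - th e| < del) -> `|N th' - N th| < eps).

Definition stnormR {R : realType} : (E -> R) -> R := get (@stnormR_spec R).

Definition Zbasis (b : nat) (gamma : 'I_b -> {ffun E -> int}) : Prop :=
  (forall i, icycle (gamma i)) /\
  (forall th, icycle th ->
     exists c : 'I_b -> int, th = [ffun e => \sum_(i < b) c i * gamma i e]) /\
  (forall c : 'I_b -> int,
     (forall e, \sum_(i < b) c i * gamma i e = 0) -> forall i, c i = 0).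

(* Iterated Lebesgue integral over R^n (coordinates 0..n-1 of t : nat -> R);
   for a Borel set this is its n-dimensional Lebesgue measure (Tonelli). *)
Fixpoint iter_lebesgue {R : realType} (n : nat) (F : (nat -> R) -> \bar R) : \bar R :=
  match n with
  | 0 => F (fun _ => 0)
  | n'.+1 => (\int[@lebesgue_measure R]_x
                iter_lebesgue n' (fun t => F (fun i => if i == n' then x else t i)))%E
  end.

(* Vol(B_st) for the Haar measure on H_1(P,R) normalised so that H_1(P,Z)
   has covolume 1: Lebesgue measure of the unit ball in the coordinates
   given by a Z-basis gamma. *)
Definition stball_volume {R : realType} (b : nat) (gamma : 'I_b -> {ffun E -> int}) : \bar R :=
  iter_lebesgue b (fun t : nat -> R =>
    if stnormR (fun e => \sum_(i < b) t i * (gamma i e)%:~R) <= 1 then 1%E else 0%E).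

Definition zeta_index {R : realType} (t : R) : set {ffun E -> int} :=
  [set th | icycle th /\ th != 0 /\ stnorm th <= t].

Definition zeta_st_partial {R : realType} (z : R[i]) (t : R) : R[i] :=
  \sum_(th \in zeta_index t) cpow (stnorm th) (- z).

Definition zeta_st_converges {R : realType} (z : R[i]) : Prop :=
  (forall t : R, 0 < t -> finite_set (zeta_index t)) /\
  exists L : R[i], zeta_st_partial z t @[t --> +oo] --> L.

End Graph.

(* Main.v *)
(* For a connected graph the stable norm is the l1 norm: a cycle theta decomposes
   into simple closed walks conformal to it, and joining them along a fixed covering walk
   costs a bounded length.  Hence zeta_st(z) = sum_n c(n) n^(-z), where c(n) counts
   the integral cycles of l1 norm n.  The generating function of c is a coefficient of a
   product of series u/(1-u); eliminating the vertices one at a time with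
   u/(1-u) v/(1-v) = uv/(1-uv) (1 + u/(1-u) + v/(1-v)) shows that c is a quasi-polynomial
   for n > 0.  Comparing lattice points with volumes bounds its degree by b - 1 and
   gives the average of its top coefficient as b Vol.  Splitting the series by
   residue classes turns it into Hurwitz zeta functions, whose continuation comes from
   the Euler-Maclaurin formula; since [hurwitz_zeta] is obtained by choice, only the values
   for s != 1 that uniqueness of continuation determines are used. *)

Require Import Defs.
From HB Require Import structures.
From mathcomp Require Import all_boot all_order all_algebra.
From mathcomp Require Import all_classical all_reals all_analysis.
From mathcomp.real_closed Require Import complex.
From mathcomp Require Import ring lra zify.
Set Implicit Arguments. Unset Strict Implicit. Unset Printing Implicit Defensive.
Import Order.TTheory GRing.Theory Num.Theory.
Import numFieldNormedType.Exports.
Local Open Scope ring_scope.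
Local Open Scope classical_set_scope.

(** Since [hurwitz_zeta] is a choice constrained only off 1, every use of it rests on an identity
    theorem for functions holomorphic off 1. That theorem is derived from Goursat on rectangles
    alone, without power series: one pulls back along the exponential and multiplies rotated copies
    of the function. The continuation is built for [(s - 1) zeta(s; q)], which is entire, so that
    the pole at 1 becomes a value.

    Volumes control the growth of balls, not of spheres, so the degree bound is obtained for the
    ball counts. Their leading coefficient is the same in every residue class, which also shows that
    the volume is rational. The top coefficient of [c] itself may oscillate; its mean goes to the
    Riemann zeta term, and the oscillating rest cancels in the residue at [b].

    Divergence at a nonreal [z] follows neither from positivity of the terms nor from the
    continuation, which is regular at such points. It is shown by violating the Cauchy criterion on
    suitable blocks. *)

Notation cabs := Normc.normc.

(** * Modulus and convergence in [R[i]] *)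

Section ComplexModulus.
Variable R : realType.
Implicit Types (z w : R[i]) (a : R).

Lemma cabsE z : `|z| = (cabs z)%:C%C.
Proof. by case: z. Qed.

Lemma cabs_ge0 z : 0 <= cabs z.
Proof. by case: z => a b; exact: sqrtr_ge0. Qed.

Lemma cabs0 : cabs (0 : R[i]) = 0. Proof. exact: Normc.normc0. Qed.

Lemma cabs1 : cabs (1 : R[i]) = 1. Proof. exact: Normc.normc1. Qed.

Lemma cabsM z w : cabs (z * w) = cabs z * cabs w.
Proof. exact: Normc.normcM. Qed.

Lemma cabsV z : cabs z^-1 = (cabs z)^-1.
Proof. exact: Normc.normcV. Qed.

Lemma cabsD z w : cabs (z + w) <= cabs z + cabs w.
Proof. exact: le_normcD. Qed.

Lemma cabsN z : cabs (- z) = cabs z.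
Proof. exact: normcN. Qed.

Lemma cabsB z w : cabs (z - w) = cabs (w - z).
Proof. by rewrite -cabsN opprB. Qed.

Lemma cabs_eq0 z : (cabs z == 0) = (z == 0).
Proof.
apply/eqP/eqP => [|->]; last exact: cabs0.
exact: Normc.eq0_normc.
Qed.

Lemma cabs_gt0 z : (0 < cabs z) = (z != 0).
Proof. by rewrite lt0r cabs_ge0 andbT cabs_eq0. Qed.

Lemma cabs_real a : cabs a%:C%C = `|a|.
Proof. by rewrite /= expr0n /= addr0 sqrtr_sqr. Qed.

Lemma cabsX z n : cabs (z ^+ n) = cabs z ^+ n.
Proof. by elim: n => [|n IH]; rewrite ?cabs1 // !exprS cabsM IH. Qed.

Lemma le_Re_cabs z : `|complex.Re z| <= cabs z.
Proof.
case: z => a b /=; rewrite -[leLHS]sqrtr_sqr ler_wsqrtr //.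
by rewrite lerDl sqr_ge0.
Qed.

Lemma le_Im_cabs z : `|complex.Im z| <= cabs z.
Proof.
case: z => a b /=; rewrite -[leLHS]sqrtr_sqr ler_wsqrtr //.
by rewrite lerDr sqr_ge0.
Qed.

Lemma cabs_le z : cabs z <= `|complex.Re z| + `|complex.Im z|.
Proof.
case: z => a b.
have -> : Complex a b = a%:C%C + Complex 0 b.
  by apply/eqP; rewrite eq_complex /= addr0 add0r !eqxx.
apply: (le_trans (cabsD _ _)); rewrite cabs_real /=.
by rewrite expr0n /= add0r sqrtr_sqr addr0 add0r.
Qed.

Lemma cabs_sum (I : Type) (r : seq I) (P : pred I) (F : I -> R[i]) :
  cabs (\sum_(i <- r | P i) F i) <= \sum_(i <- r | P i) cabs (F i).
Proof.
elim/big_ind2: _ => [|x1 x2 y1 y2 h1 h2|//]; first by rewrite cabs0.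
by apply: (le_trans (cabsD _ _)); exact: lerD.
Qed.

Lemma cabs_distD z w v : cabs (z - v) <= cabs (z - w) + cabs (w - v).
Proof. by apply: le_trans (cabsD _ _); rewrite addrA subrK. Qed.

(** Balls of [R[i]] have radii in [R[i]] itself; positivity there forces a zero imaginary part, so
    real radii suffice. *)
Lemma ccvgP (T : Type) (F : set_system T) {FF : Filter F} (f : T -> R[i]) (l : R[i]) :
  f @ F --> l <-> forall e : R, 0 < e -> \forall x \near F, cabs (f x - l) < e.
Proof.
split.
- move/cvg_ballP => H e e0.
  have e0' : 0 < e%:C%C :> R[i] by rewrite ltcR.
  have := H _ e0'.
  apply: filterS => x.
  by rewrite /ball /= /ball_ /= distrC cabsE ltcR.
- move=> H; apply/cvg_ballP => e e0.
  case: e e0 => e e'; rewrite ltcE /= => /andP[/eqP e'0 e0].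
  have := H _ e0.
  apply: filterS => x.
  by rewrite /ball /= /ball_ /= distrC cabsE e'0 ltcR.
Qed.

Lemma dnbhsCP (z : R[i]) (P : R[i] -> Prop) :
  (\forall y \near z^', P y) <->
  exists2 d : R, 0 < d & forall y, y != z -> cabs (y - z) < d -> P y.
Proof.
rewrite near_withinE; split.
- move=> /nbhs_ballP [[e e']]; rewrite /= ltcE /= => /andP[/eqP e'0 e0] H.
  exists e => // y yz yd; apply: H => //.
  by rewrite /ball /= /ball_ /= distrC cabsE e'0 ltcR.
- case=> e e0 H; apply/nbhs_ballP; exists e%:C%C; first by rewrite /= ltcR.
  move=> y + yz; rewrite /ball /= /ball_ /= distrC cabsE ltcR => ?.
  exact: H.
Qed.

End ComplexModulus.

(** * Complex derivatives and their calculus *)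

Section ComplexDerivative.
Variable R : realType.
Implicit Types (f g : R[i] -> R[i]) (z l k : R[i]).

(** Division-free form of the derivative: it also speaks of [h = 0], so the chain rule needs no case
    distinction on vanishing increments. *)
Definition has_cderiv f z l := forall e : R, 0 < e -> exists2 d : R, 0 < d &
  forall h, cabs h < d -> cabs (f (z + h) - f z - l * h) <= e * cabs h.

Lemma cdifferentiableP f z : cdifferentiable f z <-> exists l, has_cderiv f z l.
Proof.
split=> -[l Hl]; exists l.
- move=> e e0; move/ccvgP : Hl => /(_ e e0) /dnbhsCP [d d0 Hd].
  exists d => // h hd; have [->|h0] := eqVneq h 0.
    by rewrite addr0 mulr0 subr0 subrr cabs0 mulr0.
  have := Hd h h0; rewrite subr0 => /(_ hd) /ltW H.
  have -> : f (z + h) - f z - l * h = ((f (z + h) - f z) / h - l) * h by field.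
  by rewrite cabsM ler_wpM2r ?cabs_ge0.
- apply/ccvgP => e e0.
  have e20 : 0 < e / 2 by rewrite divr_gt0.
  have [d d0 Hd] := Hl _ e20; apply/dnbhsCP; exists d => // h h0.
  rewrite subr0 => /Hd H.
  have -> : (f (z + h) - f z) / h - l = (f (z + h) - f z - l * h) / h by field.
  rewrite cabsM cabsV ltr_pdivrMr ?cabs_gt0 //; apply: le_lt_trans H _.
  by rewrite ltr_pM2r ?cabs_gt0 // gtr_pMr // invf_lt1 // ltr1n.
Qed.

Lemma has_cderiv_eq f g z l (d : R) : 0 < d ->
  (forall w, cabs (w - z) < d -> f w = g w) -> has_cderiv f z l -> has_cderiv g z l.
Proof.
move=> d0 fg Hf e e0; have [c c0 Hc] := Hf _ e0.
exists (Num.min c d); first by rewrite lt_min c0.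
move=> h; rewrite lt_min => /andP[hc hd].
rewrite -!fg ?subrr ?cabs0 //; first exact: Hc.
by rewrite addrC addKr.
Qed.

Lemma has_cderiv_cst k z : has_cderiv (fun=> k) z 0.
Proof.
move=> e e0; exists 1 => // h _.
by rewrite mul0r subr0 subrr cabs0 mulr_ge0 ?cabs_ge0 // ltW.
Qed.

Lemma has_cderiv_id z : has_cderiv (fun w => w) z 1.
Proof.
move=> e e0; exists 1 => // h _.
have -> : z + h - z - 1 * h = 0 by ring.
by rewrite cabs0 mulr_ge0 ?cabs_ge0 // ltW.
Qed.

Lemma has_cderivD f g z l k : has_cderiv f z l -> has_cderiv g z k ->
  has_cderiv (fun w => f w + g w) z (l + k).
Proof.
move=> Hf Hg e e0; have e20 : 0 < e / 2 by rewrite divr_gt0.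
have [c c0 Hc] := Hf _ e20; have [d d0 Hd] := Hg _ e20.
exists (Num.min c d); first by rewrite lt_min c0.
move=> h; rewrite lt_min => /andP[/Hc hc /Hd hd].
have -> : f (z + h) + g (z + h) - (f z + g z) - (l + k) * h =
  (f (z + h) - f z - l * h) + (g (z + h) - g z - k * h) by ring.
apply: (le_trans (cabsD _ _)).
by rewrite [e]splitr mulrDl lerD.
Qed.

Lemma has_cderiv_lip f z l : has_cderiv f z l -> exists2 d : R, 0 < d &
  forall h, cabs h < d -> cabs (f (z + h) - f z) <= (cabs l + 1) * cabs h.
Proof.
move=> Hf; have [d d0 Hd] := Hf 1 ltr01; exists d => // h /Hd H.
have -> : f (z + h) - f z = (f (z + h) - f z - l * h) + l * h by ring.
apply: (le_trans (cabsD _ _)); rewrite cabsM mulrDl addrC lerD2l.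
by apply: le_trans H _.
Qed.

Definition ccontinuous_at f z := forall e : R, 0 < e -> exists2 d : R, 0 < d &
  forall w, cabs (w - z) < d -> cabs (f w - f z) < e.

Lemma has_cderiv_continuous f z l : has_cderiv f z l -> ccontinuous_at f z.
Proof.
move=> /has_cderiv_lip [d d0 H] e e0.
have l0 : 0 < cabs l + 1 by rewrite ltr_wpDl ?cabs_ge0.
exists (Num.min d (e / (cabs l + 1))); first by rewrite lt_min d0 divr_gt0.
move=> w; rewrite lt_min => /andP[wd we].
have := H _ wd; rewrite subrKC => /le_lt_trans; apply.
by move: we; rewrite ltr_pdivlMr // mulrC.
Qed.

Lemma has_cderiv_comp f g z l k : has_cderiv f z l -> has_cderiv g (f z) k ->
  has_cderiv (fun w => g (f w)) z (k * l).
Proof.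
move=> Hf Hg e e0.
have l0 : 0 < cabs l + 1 by rewrite ltr_wpDl ?cabs_ge0.
have k0 : 0 < cabs k + 1 by rewrite ltr_wpDl ?cabs_ge0.
have [c1 c10 Hc1] := has_cderiv_lip Hf.
have [c c0 Hc] := Hf (e / 2 / (cabs k + 1)) (divr_gt0 (divr_gt0 e0 (ltr0Sn _ 1)) k0).
have [d d0 Hd] := Hg (e / 2 / (cabs l + 1)) (divr_gt0 (divr_gt0 e0 (ltr0Sn _ 1)) l0).
exists (Num.min (Num.min c1 c) (d / (cabs l + 1))).
  by rewrite !lt_min c10 c0 divr_gt0.
move=> h; rewrite !lt_min => /andP[/andP[/Hc1 h1 /Hc h2]].
rewrite ltr_pdivlMr // => h3.
set u := f (z + h) - f z in h1 *.
have hu : cabs u < d by apply: le_lt_trans h1 _; rewrite mulrC.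
have := Hd _ hu; have -> : f z + u = f (z + h) by rewrite /u; ring.
move=> h4.
have -> : g (f (z + h)) - g (f z) - k * l * h =
  (g (f (z + h)) - g (f z) - k * u) + k * (f (z + h) - f z - l * h) by rewrite /u; ring.
apply: (le_trans (cabsD _ _)); rewrite [e]splitr mulrDl lerD //.
  apply: (le_trans h4); rewrite -mulrA ler_wpM2l ?divr_ge0 ?(ltW e0) //.
  by rewrite mulrC ler_pdivrMr // mulrC.
rewrite cabsM; apply: (@le_trans _ _ ((cabs k + 1) * (e / 2 / (cabs k + 1) * cabs h))).
  by apply: ler_pM; rewrite ?cabs_ge0 ?lerDl.
by rewrite mulrA [(_ + 1) * _]mulrC divfK // gt_eqF.
Qed.

Lemma has_cderivM f g z l k : has_cderiv f z l -> has_cderiv g z k ->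
  has_cderiv (fun w => f w * g w) z (l * g z + f z * k).
Proof.
move=> Hf Hg e e0.
pose M := cabs (g z) + cabs (f z) + 1 + (cabs l + 1).
have M0 : 0 < M by rewrite /M; have := cabs_ge0 (g z); have := cabs_ge0 (f z);
  have := cabs_ge0 l; lra.
have eM : 0 < e / M / 2 by rewrite !divr_gt0.
have [c c0 Hc] := Hf _ eM; have [d d0 Hd] := Hg _ eM.
have [c1 c10 Hc1] := has_cderiv_lip Hf.
have [d1 d10 Hd1] := has_cderiv_continuous Hg eM.
exists (Num.min (Num.min c d) (Num.min c1 d1)); first by rewrite !lt_min c0 d0 c10 d10.
move=> h; rewrite !lt_min => /andP[/andP[/Hc h1 /Hd h2] /andP[/Hc1 h3 h4]].
have {}h4 : cabs (g (z + h) - g z) < e / M / 2.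
  by apply: Hd1; rewrite addrC addKr.
have -> : f (z + h) * g (z + h) - f z * g z - (l * g z + f z * k) * h =
  (f (z + h) - f z - l * h) * g z + (f z) * (g (z + h) - g z - k * h)
  + (f (z + h) - f z) * (g (z + h) - g z) by ring.
apply: (le_trans (cabsD _ _)).
apply: (@le_trans _ _ ((e / M / 2 * cabs h) * cabs (g z) +
   cabs (f z) * (e / M / 2 * cabs h) + ((cabs l + 1) * cabs h) * (e / M / 2))).
  apply: lerD; first apply: (le_trans (cabsD _ _)).
    by rewrite !cabsM lerD // ?ler_wpM2r ?ler_wpM2l ?cabs_ge0.
  by rewrite cabsM ler_pM ?cabs_ge0 // ltW.
have -> : e / M / 2 * cabs h * cabs (g z) + cabs (f z) * (e / M / 2 * cabs h) +
   (cabs l + 1) * cabs h * (e / M / 2) =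
   (e / M / 2 * cabs h) * (cabs (g z) + cabs (f z) + (cabs l + 1)) by ring.
have -> : e * cabs h = (e / M / 2 * cabs h) * (2 * M).
  by field; rewrite gt_eqF.
apply: ler_wpM2l; first by rewrite mulr_ge0 ?cabs_ge0 // ltW.
rewrite /M; have := cabs_ge0 (g z); have := cabs_ge0 (f z);
  have := cabs_ge0 l; lra.
Qed.

Lemma has_cderivN f z l : has_cderiv f z l -> has_cderiv (fun w => - f w) z (- l).
Proof.
move=> Hf e e0; have [d d0 Hd] := Hf _ e0; exists d => // h /Hd.
by rewrite -cabsN; congr (cabs _ <= _); ring.
Qed.

Lemma has_cderivV z : z != 0 -> has_cderiv (fun w => w^-1) z (- (z ^+ 2)^-1).
Proof.
move=> z0 e e0; have az0 : 0 < cabs z by rewrite cabs_gt0.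
(* The first bound keeps [cabs (z + h) >= cabs z / 2]; the second then makes the remainder
   [h^2 / (z^2 (z + h))] at most [e * cabs h]. *)
pose d := Num.min (cabs z / 2) (e * cabs z ^+ 3 / 2).
exists d; first by rewrite /d lt_min !divr_gt0 // mulr_gt0 // exprn_gt0.
move=> h; rewrite lt_min => /andP[h1 h2].
have zh : cabs z / 2 <= cabs (z + h).
  have : cabs z <= cabs (z + h) + cabs h.
    by rewrite -[cabs h]cabsN; apply: le_trans (cabsD _ _); rewrite addrK.
  by move=> ?; lra.
have zh0 : z + h != 0 by rewrite -cabs_gt0; lra.
have -> : (z + h)^-1 - z^-1 - - (z ^+ 2)^-1 * h = h ^+ 2 / (z ^+ 2 * (z + h)).
  by field; rewrite ?z0 ?zh0.
rewrite cabsM cabsV cabsX cabsM cabsX expr2 -mulrA [leLHS]mulrC ler_wpM2r ?cabs_ge0 //.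
rewrite ler_pdivrMr; last by rewrite mulr_gt0 ?exprn_gt0 //; lra.
apply: (@le_trans _ _ (e * (cabs z ^+ 2 * (cabs z / 2)))).
  by apply/ltW; move: h2; congr (_ < _); rewrite !exprS; ring.
by rewrite ler_wpM2l ?(ltW e0) // ler_wpM2l ?sqr_ge0.
Qed.

Lemma cdiff_cst k z : cdifferentiable (fun=> k) z.
Proof. by apply/cdifferentiableP; exists 0; exact: has_cderiv_cst. Qed.

Lemma cdiff_id z : cdifferentiable (fun w : R[i] => w) z.
Proof. by apply/cdifferentiableP; exists 1; exact: has_cderiv_id. Qed.

Lemma cdiffD f g z : cdifferentiable f z -> cdifferentiable g z ->
  cdifferentiable (fun w => f w + g w) z.
Proof.
move=> /cdifferentiableP [l fl] /cdifferentiableP [k gk].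
by apply/cdifferentiableP; exists (l + k); exact: has_cderivD.
Qed.

Lemma cdiffN f z : cdifferentiable f z -> cdifferentiable (fun w => - f w) z.
Proof.
move=> /cdifferentiableP [l fl].
by apply/cdifferentiableP; exists (- l); exact: has_cderivN.
Qed.

Lemma cdiffM f g z : cdifferentiable f z -> cdifferentiable g z ->
  cdifferentiable (fun w => f w * g w) z.
Proof.
move=> /cdifferentiableP [l fl] /cdifferentiableP [k gk].
by apply/cdifferentiableP; exists (l * g z + f z * k); exact: has_cderivM.
Qed.

Lemma cdiffV z : z != 0 -> cdifferentiable (fun w : R[i] => w^-1) z.
Proof.
by move=> z0; apply/cdifferentiableP; exists (- (z ^+ 2)^-1); exact: has_cderivV.
Qed.

Lemma cdiff_comp f g z : cdifferentiable f z -> cdifferentiable g (f z) ->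
  cdifferentiable (fun w => g (f w)) z.
Proof.
move=> /cdifferentiableP [l fl] /cdifferentiableP [k gk].
by apply/cdifferentiableP; exists (k * l); exact: has_cderiv_comp.
Qed.

Lemma cdiff_sum (I : Type) (r : seq I) (F : I -> R[i] -> R[i]) z :
  (forall i, cdifferentiable (F i) z) ->
  cdifferentiable (fun w => \sum_(i <- r) F i w) z.
Proof.
move=> HF; elim: r => [|i r IH].
  by under eq_fun do rewrite big_nil; exact: cdiff_cst.
by under eq_fun do rewrite big_cons; exact: cdiffD.
Qed.

Lemma cdiff_prod (I : Type) (r : seq I) (F : I -> R[i] -> R[i]) z :
  (forall i, cdifferentiable (F i) z) ->
  cdifferentiable (fun w => \prod_(i <- r) F i w) z.
Proof.
move=> HF; elim: r => [|i r IH].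
  by under eq_fun do rewrite big_nil; exact: cdiff_cst.
by under eq_fun do rewrite big_cons; exact: cdiffM.
Qed.

Lemma cdiff_eq f g z (d : R) : 0 < d ->
  (forall w, cabs (w - z) < d -> f w = g w) ->
  cdifferentiable f z -> cdifferentiable g z.
Proof.
move=> d0 fg /cdifferentiableP [l fl]; apply/cdifferentiableP; exists l.
exact: has_cderiv_eq d0 fg fl.
Qed.

Lemma cdiff_continuous f z : cdifferentiable f z -> ccontinuous_at f z.
Proof. by move=> /cdifferentiableP [l]; exact: has_cderiv_continuous. Qed.

End ComplexDerivative.

(** * The complex exponential and complex powers of positive reals *)

Section ComplexExponential.
Variable R : realType.
Implicit Types (z w : R[i]) (a b x y : R).

Definition cexp z : R[i] :=
  Complex (expR (complex.Re z) * cos (complex.Im z))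
          (expR (complex.Re z) * sin (complex.Im z)).

Lemma is_derive_eps (f : R -> R) x l : is_derive x 1 f l ->
  forall e : R, 0 < e -> exists2 d : R, 0 < d &
    forall h, `|h| < d -> `|f (x + h) - f x - l * h| <= e * `|h|.
Proof.
move=> [df fl] e e0.
have : h^-1 *: ((f \o shift x) (h *: 1) - f x) @[h --> 0^'] --> l.
  by rewrite -fl; exact: df.
move=> /cvgrPdist_lt /(_ e e0); rewrite near_withinE => /nbhs_ballP [d d0 H].
exists d => // h hd; have [->|h0] := eqVneq h 0.
  by rewrite addr0 mulr0 subr0 subrr normr0 mulr0.
have := H h; rewrite /ball /= sub0r normrN => /(_ hd h0) /ltW.
rewrite /GRing.scale /= mulr1 [h + x]addrC => {}H.
have -> : f (x + h) - f x - l * h = - (l - h^-1 * (f (x + h) - f x)) * h by field.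
by rewrite normrM normrN ler_wpM2r.
Qed.

Lemma cexpD z w : cexp (z + w) = cexp z * cexp w.
Proof.
case: z w => [a b] [c d]; apply/eqP; rewrite eq_complex /= expRD cosD sinD.
by apply/andP; split; apply/eqP; ring.
Qed.

Lemma cexp0 : cexp 0 = 1.
Proof.
by apply/eqP; rewrite eq_complex /= expR0 cos0 sin0 mulr1 mulr0 !eqxx.
Qed.

Lemma cabs_cexp z : cabs (cexp z) = expR (complex.Re z).
Proof.
rewrite /cexp /= !exprMn -mulrDr cos2Dsin2 mulr1 sqrtr_sqr ger0_norm // expR_ge0.
Qed.

Lemma has_cderiv_cexp0 : has_cderiv cexp 0 1.
Proof.
(* The four error terms at the end are [3 k m], [k m], [3 k m] and [2 k m] with [m = cabs h], which
   add up to [9 k m]; [k <= 1] gives the auxiliary bounds [2 m] and 3. *)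
move=> e e0; pose k := Num.min 1 (e / 9).
have k0 : 0 < k by rewrite lt_min ltr01 divr_gt0.
have [k1 ke] : k <= 1 /\ 9 * k <= e.
  split; first by rewrite ge_min lexx.
  by rewrite mulrC -ler_pdivlMr // ge_min lexx orbT.
clearbody k.
have [d1 d10 H1] := is_derive_eps (is_derive_expR (0 : R)) k0.
have [d2 d20 H2] := is_derive_eps (is_derive_cos (0 : R)) k0.
have [d3 d30 H3] := is_derive_eps (is_derive_sin (0 : R)) k0.
exists (Num.min (Num.min d1 d2) (Num.min d3 k)); first by rewrite 2!lt_min d10 d20 lt_min d30 k0.
move=> h; rewrite !lt_min => /andP[/andP[h1 h2] /andP[h3 hk]].
rewrite add0r cexp0 mul1r; apply: (le_trans (cabs_le _)).
have := le_Re_cabs h; have := le_Im_cabs h.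
move: (cabs h) h1 h2 h3 hk => m h1 h2 h3 hk; case: h => x y /= ym xm.
have {}H1 := H1 x (le_lt_trans xm h1).
have {}H2 := H2 y (le_lt_trans ym h2).
have {}H3 := H3 y (le_lt_trans ym h3).
move: H1 H2 H3; rewrite !add0r expR0 cos0 sin0 !mul1r subr0 oppr0 mul0r subr0 => H1 H2 H3.
have m0 : 0 <= m by exact: le_trans xm.
have nx := normr_ge0 x; have ny := normr_ge0 y.
have E1 : `|expR x - 1| <= 2 * m.
  have -> : expR x - 1 = (expR x - 1 - x) + x by ring.
  have := ler_wpM2r nx k1; rewrite mul1r => ?.
  apply: le_trans (ler_normD _ _) _; lra.
have E2 : expR x <= 3.
  by have := ler_norm (expR x - 1); nra.
have E0 := expR_ge0 x.
have -> : expR x * cos y - 1 - x = expR x * (cos y - 1) + (expR x - 1 - x) by ring.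
have -> : expR x * sin y + 0 - y = expR x * (sin y - y) + (expR x - 1) * y by ring.
apply: (@le_trans _ _ ((3 * (k * m) + k * m) + (3 * (k * m) + 2 * m * k))).
  apply: lerD; apply: le_trans (ler_normD _ _) _; rewrite !normrM (ger0_norm E0).
    by apply: lerD; [apply: ler_pM => //|]; nra.
  by apply: lerD; apply: ler_pM => //; nra.
by nra.
Qed.

Lemma has_cderiv_cexp z : has_cderiv cexp z (cexp z).
Proof.
move=> e e0; have c0 : 0 < expR (complex.Re z) by exact: expR_gt0.
have [d d0 H] := has_cderiv_cexp0 (divr_gt0 e0 c0).
exists d => // h /H; rewrite add0r cexp0 mul1r => {}H.
have -> : cexp (z + h) - cexp z - cexp z * h = cexp z * (cexp h - 1 - h).
  by rewrite cexpD; ring.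
by rewrite cabsM cabs_cexp mulrC -ler_pdivlMr // mulrAC.
Qed.

Lemma cpowE a w : cpow a w = cexp (w * (ln a)%:C%C).
Proof.
by case: w => c d; rewrite /cpow /cexp /= !mulr0 subr0 add0r.
Qed.

Lemma cpowD a w z : cpow a (w + z) = cpow a w * cpow a z.
Proof. by rewrite !cpowE mulrDl cexpD. Qed.

Lemma cpowMl a b w : 0 < a -> 0 < b -> cpow (a * b) w = cpow a w * cpow b w.
Proof. by move=> a0 b0; rewrite !cpowE lnM ?posrE // rmorphD mulrDr cexpD. Qed.

Lemma cpow0 a : cpow a 0 = 1.
Proof. by rewrite cpowE mul0r cexp0. Qed.

Lemma cpowr1 a : 0 < a -> cpow a 1 = a%:C%C.
Proof.
move=> a0; rewrite /cpow /= mul1r mul0r cos0 sin0 mulr1 mulr0.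
by rewrite lnK ?posrE.
Qed.

Lemma cpow_nat a n : 0 < a -> cpow a n%:R = a%:C%C ^+ n.
Proof.
move=> a0; elim: n => [|n IH]; first by rewrite cpow0.
by rewrite -addn1 natrD cpowD IH cpowr1 // exprD.
Qed.

Lemma cabs_cpow a w : cabs (cpow a w) = expR (complex.Re w * ln a).
Proof.
rewrite cpowE cabs_cexp.
by case: w => c d /=; rewrite mulr0 subr0.
Qed.

Lemma has_cderiv_cpow a w : has_cderiv (cpow a) w (cpow a w * (ln a)%:C%C).
Proof.
have /has_cderiv_comp := has_cderivM (has_cderiv_id w) (has_cderiv_cst (ln a)%:C%C w).
move/(_ _ _ (has_cderiv_cexp _)); rewrite mul1r mulr0 addr0 -cpowE.
have -> // : (fun w0 => cexp (w0 * (ln a)%:C%C)) = cpow a.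
by apply/funext => v; rewrite cpowE.
Qed.

Lemma cdiff_cpow a w : cdifferentiable (cpow a) w.
Proof. by apply/cdifferentiableP; eexists; exact: has_cderiv_cpow. Qed.

End ComplexExponential.

(** * Integrals of continuous functions over segments *)

Section ContinuousIntegral.
Variable R : realType.
Implicit Types (f g : R -> R) (a b c M : R).

Definition cint f a b := (\int[@lebesgue_measure R]_(x in `[a, b]) f x)%R.

Lemma continuous_integrable_itv f a b : continuous f ->
  (@lebesgue_measure R).-integrable `[a, b] (EFin \o f).
Proof.
move=> cf; apply: continuous_compact_integrable; first exact: segment_compact.
by apply: continuous_subspaceT.
Qed.

Lemma cintD f g a b : continuous f -> continuous g ->
  cint (fun x => f x + g x) a b = cint f a b + cint g a b.
Proof. by move=> cf cg; apply: RintegralD => //; exact: continuous_integrable_itv. Qed.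

Lemma cint_cst c a b : a <= b -> cint (fun=> c) a b = c * (b - a).
Proof.
move=> ab; rewrite /cint Rintegral_cst //= lebesgue_measure_itv /= lte_fin.
by case: ltP => //= ba; have -> : a = b; [apply/eqP; rewrite eq_le ab ba | rewrite subrr].
Qed.

Lemma cint_dist f a b c M : a <= b -> continuous f ->
  (forall x, a <= x <= b -> `|f x - c| <= M) ->
  `|cint f a b - c * (b - a)| <= M * (b - a).
Proof.
move=> ab cf H.
have ic k : (@lebesgue_measure R).-integrable `[a, b] (EFin \o (fun=> k)).
  by apply: continuous_integrable_itv => x; exact: cvg_cst.
have H1 : (forall x, `[a, b]%classic x -> c - M <= f x) -> cint (fun=> c - M) a b <= cint f a b.
  by move=> h; apply: le_Rintegral => //; exact: continuous_integrable_itv.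
have H2 : (forall x, `[a, b]%classic x -> f x <= c + M) -> cint f a b <= cint (fun=> c + M) a b.
  by move=> h; apply: le_Rintegral => //; exact: continuous_integrable_itv.
rewrite !cint_cst // in H1 H2.
rewrite ler_norml; apply/andP; split.
  have /H1 : forall x, `[a, b]%classic x -> c - M <= f x.
    by move=> x /=; rewrite in_itv /= => /H; rewrite ler_norml; lra.
  by rewrite mulrBl; lra.
have /H2 : forall x, `[a, b]%classic x -> f x <= c + M.
  by move=> x /=; rewrite in_itv /= => /H; rewrite ler_norml; lra.
by rewrite mulrDl; lra.
Qed.

Lemma cint_split f a b c : a <= c -> c <= b -> continuous f ->
  cint f a b = cint f a c + cint f c b.
Proof.
move=> ac cb cf; have := @Rintegral_itvB R f (BLeft a) (BRight b) c.
move=> /(_ (continuous_integrable_itv a b cf)); rewrite !bnd_simp.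
move=> /(_ ac cb); rewrite Rintegral_itv_obnd_cbnd; first by rewrite /cint; lra.
have := continuous_integrable_itv a b cf; apply: integrableS => //.
by apply: subset_itvr; rewrite bnd_simp.
Qed.

End ContinuousIntegral.

(** * Goursat's theorem on rectangles *)

Section Goursat.
Variable R : realType.
Variable G : R[i] -> R[i].
Hypothesis dG : forall z, cdifferentiable G z.

Let u (x y : R) := complex.Re (G (Complex x y)).
Let v (x y : R) := complex.Im (G (Complex x y)).

Lemma continuous_slices (x0 y0 : R) :
  [/\ continuous (u^~ y0), continuous (u x0),
      continuous (v^~ y0) & continuous (v x0)].
Proof.
have H (p : R -> R[i]) (part : R[i] -> R) :
  (forall z, `|part z| <= cabs z) -> (forall z w, part (z - w) = part z - part w) ->
  (forall x y, cabs (p x - p y) = `|x - y|) ->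
  continuous (fun x => part (G (p x))).
  move=> H1 H2 H3 x; apply/cvgrPdist_lt => e e0.
  have [d d0 Hd] := cdiff_continuous (dG (p x)) e0.
  near=> y; rewrite -H2; apply: (le_lt_trans (H1 (G (p x) - G (p y)))); rewrite cabsB; apply: Hd.
  by rewrite H3; near: y; apply/nbhs_ballP; exists d => // y; rewrite /ball /= distrC.
split.
- refine (H (fun x => Complex x y0) (@complex.Re R) (@le_Re_cabs R) _ _); first by move=> [? ?] [? ?].
  by move=> x y /=; rewrite subrr expr0n addr0 sqrtr_sqr.
- refine (H (fun x => Complex x0 x) (@complex.Re R) (@le_Re_cabs R) _ _); first by move=> [? ?] [? ?].
  by move=> x y /=; rewrite subrr expr0n add0r sqrtr_sqr.
- refine (H (fun x => Complex x y0) (@complex.Im R) (@le_Im_cabs R) _ _); first by move=> [? ?] [? ?].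
  by move=> x y /=; rewrite subrr expr0n addr0 sqrtr_sqr.
- refine (H (fun x => Complex x0 x) (@complex.Im R) (@le_Im_cabs R) _ _); first by move=> [? ?] [? ?].
  by move=> x y /=; rewrite subrr expr0n add0r sqrtr_sqr.
Unshelve. all: by end_near.
Qed.

Lemma continuous_slice_diff (x1 x2 y1 y2 : R) :
  continuous (fun x => u x y1 - u x y2) /\ continuous (fun y => v x1 y - v x2 y).
Proof.
have [c1 _ _ _] := continuous_slices 0 y1; have [c2 _ _ _] := continuous_slices 0 y2.
have [_ _ _ c3] := continuous_slices x1 0; have [_ _ _ c4] := continuous_slices x2 0.
by split=> x; [exact: cvgB (c1 x) (c2 x) | exact: cvgB (c3 x) (c4 x)].
Qed.

(* The real part of the contour integral of G along the boundary of the
   rectangle [x1, x2] x [y1, y2]. *)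
Definition rect_circ (x1 x2 y1 y2 : R) :=
  cint (fun x => u x y1 - u x y2) x1 x2 + cint (fun y => v x1 y - v x2 y) y1 y2.

Lemma rect_circ_splitx x1 m x2 y1 y2 : x1 <= m -> m <= x2 ->
  rect_circ x1 x2 y1 y2 = rect_circ x1 m y1 y2 + rect_circ m x2 y1 y2.
Proof.
move=> h1 h2; rewrite /rect_circ.
have [c1 c2] := continuous_slice_diff x1 m y1 y2.
have [c3 c4] := continuous_slice_diff m x2 y1 y2.
rewrite (cint_split h1 h2 c1).
have -> : cint (fun y => v x1 y - v x2 y) y1 y2 =
  cint (fun y => v x1 y - v m y) y1 y2 + cint (fun y => v m y - v x2 y) y1 y2.
  by rewrite -cintD //; congr cint; apply/funext => y; ring.
ring.
Qed.

Lemma rect_circ_splity x1 x2 y1 m y2 : y1 <= m -> m <= y2 ->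
  rect_circ x1 x2 y1 y2 = rect_circ x1 x2 y1 m + rect_circ x1 x2 m y2.
Proof.
move=> h1 h2; rewrite /rect_circ.
have [c1 c2] := continuous_slice_diff x1 x2 y1 m.
have [c3 c4] := continuous_slice_diff x1 x2 m y2.
rewrite (cint_split h1 h2 c2).
have -> : cint (fun x => u x y1 - u x y2) x1 x2 =
  cint (fun x => u x y1 - u x m) x1 x2 + cint (fun x => u x m - u x y2) x1 x2.
  by rewrite -cintD //; congr cint; apply/funext => y; ring.
ring.
Qed.

(** The affine part of [G] at the point has zero circulation: its two contributions are [Im l] times
    the area, with opposite signs. Only the remainder counts, and it is at most [e / 2] times the
    half-perimeter on each side. *)
Lemma rect_circ_small (p q e : R) : 0 < e -> exists2 d : R, 0 < d &
  forall x1 x2 y1 y2, x1 <= p <= x2 -> y1 <= q <= y2 ->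
    (x2 - x1) + (y2 - y1) < d ->
    `|rect_circ x1 x2 y1 y2| <= e * ((x2 - x1) + (y2 - y1)) ^+ 2.
Proof.
move=> e0; have /cdifferentiableP [l Hl] := dG (Complex p q).
have [d d0 Hd] := Hl (e / 2) (divr_gt0 e0 (ltr0Sn _ 1)).
exists d => // x1 x2 y1 y2 /andP[px1 px2] /andP[qy1 qy2] small.
set D := x2 - x1 + (y2 - y1) in small *.
have D0 : 0 <= D by rewrite /D; lra.
have key x y : x1 <= x <= x2 -> y1 <= y <= y2 ->
  `|u x y - (u p q + complex.Re l * (x - p) - complex.Im l * (y - q))| <= e / 2 * D /\
  `|v x y - (v p q + complex.Im l * (x - p) + complex.Re l * (y - q))| <= e / 2 * D.
  move=> /andP[xx1 xx2] /andP[yy1 yy2]; pose h := Complex (x - p) (y - q).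
  have hD : cabs h <= D.
    apply: (le_trans (cabs_le _)); rewrite /= /D; apply: lerD;
      by rewrite ler_norml; apply/andP; split; lra.
  have {Hd} := Hd h (le_lt_trans hD small).
  have -> : Complex p q + h = Complex x y.
    by apply/eqP; rewrite eq_complex /=; apply/andP; split; apply/eqP; ring.
  set r := _ - _ => Hd.
  have {Hd} rD : cabs r <= e / 2 * D.
    by apply: le_trans Hd _; rewrite ler_wpM2l // divr_ge0 // ltW.
  have := le_Re_cabs r; have := le_Im_cabs r; move: rD.
  rewrite /r {r} /u /v /h; case: (G (Complex x y)) (G (Complex p q)) l {Hl} => [a b] [a' b'] [l1 l2] /=.
  move=> r1 r2 r3; split.
    by apply: le_trans (le_trans r3 r1); rewrite le_eqVlt; apply/orP; left; apply/eqP;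
      congr (`| _ |); ring.
  by apply: le_trans (le_trans r2 r1); rewrite le_eqVlt; apply/orP; left; apply/eqP;
      congr (`| _ |); ring.
have [c1 c2] := continuous_slice_diff x1 x2 y1 y2.
have x12 : x1 <= x2 by lra.
have y12 : y1 <= y2 by lra.
have H1 := @cint_dist R _ x1 x2 (complex.Im l * (y2 - y1)) (e * D) x12 c1.
have H2 := @cint_dist R _ y1 y2 (complex.Im l * (x1 - x2)) (e * D) y12 c2.
have {}H1 := H1 _; have {}H2 := H2 _.
have {H1} /H1 h1 : forall x, x1 <= x <= x2 ->
  `|u x y1 - u x y2 - complex.Im l * (y2 - y1)| <= e * D.
  move=> x xx; have [|+ _] := key x y1 xx; first by rewrite lexx y12.
  have [|+ _] := key x y2 xx; first by rewrite lexx y12.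
  rewrite !ler_norml => /andP[k1 k2] /andP[k3 k4]; apply/andP; split; lra.
have {H2} /H2 h2 : forall y, y1 <= y <= y2 ->
  `|v x1 y - v x2 y - complex.Im l * (x1 - x2)| <= e * D.
  move=> y yy; have [|_ +] := key x1 y _ yy; first by rewrite lexx x12.
  have [|_ +] := key x2 y _ yy; first by rewrite lexx x12.
  rewrite !ler_norml => /andP[k1 k2] /andP[k3 k4]; apply/andP; split; lra.
have -> : rect_circ x1 x2 y1 y2 =
  (cint (fun x => u x y1 - u x y2) x1 x2 - complex.Im l * (y2 - y1) * (x2 - x1)) +
  (cint (fun y => v x1 y - v x2 y) y1 y2 - complex.Im l * (x1 - x2) * (y2 - y1)).
  by rewrite /rect_circ; ring.
apply: le_trans (ler_normD _ _) _; apply: le_trans (lerD h1 h2) _.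
by rewrite -mulrDr -/D expr2 mulrA.
Qed.

Section Subdivision.
Variables (x0 y0 A B : R).
Hypotheses (A0 : 0 <= A) (B0 : 0 <= B).

Let J n (p : R * R) :=
  `|rect_circ p.1 (p.1 + A / 2 ^+ n) p.2 (p.2 + B / 2 ^+ n)|.

Lemma rect_circ_quarter n (p : R * R) : exists q : R * R,
  [/\ p.1 <= q.1, q.1 + A / 2 ^+ n.+1 <= p.1 + A / 2 ^+ n,
      p.2 <= q.2, q.2 + B / 2 ^+ n.+1 <= p.2 + B / 2 ^+ n &
      J n p <= 4 * J n.+1 q].
Proof.
case: p => x y; rewrite /J /=; set a := A / 2 ^+ n.+1; set b := B / 2 ^+ n.+1.
have -> : A / 2 ^+ n = a + a by rewrite /a exprS; field; rewrite expf_neq0.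
have -> : B / 2 ^+ n = b + b by rewrite /b exprS; field; rewrite expf_neq0.
have a0 : 0 <= a by rewrite divr_ge0 // exprn_ge0.
have b0 : 0 <= b by rewrite divr_ge0 // exprn_ge0.
rewrite !addrA (@rect_circ_splitx x (x + a)) ?lerDl //.
rewrite (@rect_circ_splity x (x + a) y (y + b)) ?lerDl //.
rewrite (@rect_circ_splity (x + a) (x + a + a) y (y + b)) ?lerDl //.
set j1 := rect_circ x _ y _; set j2 := rect_circ x _ _ (y + b + b).
set j3 := rect_circ (x + a) _ y _; set j4 := rect_circ (x + a) _ _ (y + b + b).
have tri : `|j1 + j2 + (j3 + j4)| <= `|j1| + `|j2| + (`|j3| + `|j4|).
  by apply: (le_trans (ler_normD _ _)); apply: lerD; exact: ler_normD.
have [k1|k1] := leP `|j1 + j2 + (j3 + j4)| (4 * `|j1|).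
  by exists (x, y); split=> //=; lra.
have [k2|k2] := leP `|j1 + j2 + (j3 + j4)| (4 * `|j2|).
  by exists (x, y + b); split=> //=; lra.
have [k3|k3] := leP `|j1 + j2 + (j3 + j4)| (4 * `|j3|).
  by exists (x + a, y); split=> //=; lra.
by exists (x + a, y + b); split=> //=; lra.
Qed.

(** Each quartering loses at most a factor 4 in the circulation, while the squared half-perimeter in
    [rect_circ_small], applied at the common point of the nested rectangles, also shrinks by 4. The
    two cancel, and [e] is arbitrary. *)
Lemma goursat : rect_circ x0 (x0 + A) y0 (y0 + B) = 0.
Proof.
have [nx Hnx] := choice (fun np : nat * (R * R) => rect_circ_quarter np.1 np.2).
pose s := fix s n := if n is n'.+1 then nx (n', s n') else (x0, y0).
have s1 n : (s n).1 <= (s n.+1).1 by have [] := Hnx (n, s n).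
have s2 n : (s n.+1).1 + A / 2 ^+ n.+1 <= (s n).1 + A / 2 ^+ n by have [] := Hnx (n, s n).
have s3 n : (s n).2 <= (s n.+1).2 by have [] := Hnx (n, s n).
have s4 n : (s n.+1).2 + B / 2 ^+ n.+1 <= (s n).2 + B / 2 ^+ n by have [] := Hnx (n, s n).
have sJ n : J 0 (s 0%N) <= 4 ^+ n * J n (s n).
  elim: n => [|n IH]; first by rewrite expr0 mul1r.
  apply: (le_trans IH); rewrite exprSr -mulrA ler_wpM2l ?exprn_ge0 //.
  by have [] := Hnx (n, s n).
(* Nested intervals: the left ends increase and stay below every right end, so their supremum lies
   in all of them. *)
have point (a : nat -> R) (L : R) : 0 <= L -> (forall n, a n <= a n.+1) ->
  (forall n, a n.+1 + L / 2 ^+ n.+1 <= a n + L / 2 ^+ n) ->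
  exists p, forall n, a n <= p <= a n + L / 2 ^+ n.
  move=> L0 h1 h2.
  have m1 i k : a i <= a (i + k)%N.
    by elim: k => [|k IH]; rewrite ?addn0 // addnS (le_trans IH).
  have m2 i k : a (i + k)%N + L / 2 ^+ (i + k) <= a i + L / 2 ^+ i.
    by elim: k => [|k IH]; rewrite ?addn0 // addnS; apply: le_trans (h2 _) IH.
  have L1 n : 0 <= L / 2 ^+ n by rewrite divr_ge0 // exprn_ge0.
  have m3 i j : a i <= a j + L / 2 ^+ j.
    have [ij|ji] := leqP i j.
      by have := m1 i (j - i)%N; rewrite subnKC // => h; have := L1 j; lra.
    have := m2 j (i - j)%N; rewrite subnKC ?(ltnW ji) // => h.
    by have := L1 i; lra.
  exists (sup (range a)) => n; apply/andP; split.
    by apply: ub_le_sup; [exists (a 0%N + L / 2 ^+ 0) => _ [i _ <-] | exists n].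
  by apply: ge_sup; [exists (a 0%N), 0%N | move=> _ [i _ <-]].
have [p Hp] := point (fun n => (s n).1) A A0 s1 s2.
have [q Hq] := point (fun n => (s n).2) B B0 s3 s4.
apply/eqP; rewrite -normr_le0; apply/ler_addgt0Pr => e e0; rewrite add0r.
have -> : `|rect_circ x0 (x0 + A) y0 (y0 + B)| = J 0 (s 0%N).
  by rewrite /J /= expr0 !divr1.
(* The added 1 keeps [K] positive when the rectangle is a point. *)
pose K := (A + B) ^+ 2 + 1.
have K0 : 0 < K by rewrite ltr_wpDl // sqr_ge0.
have [d d0 Hd] := rect_circ_small p q (divr_gt0 e0 K0).
have [n Hn] : exists n, (A + B) / 2 ^+ n < d.
  have AB0 : 0 <= A + B by rewrite addr_ge0.
  exists (Num.truncn ((A + B) / d)).+1.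
  rewrite ltr_pdivrMr ?exprn_gt0 // mulrC -ltr_pdivrMr //.
  apply: (lt_trans (truncnS_gt _)).
  by rewrite -natrX ltr_nat ltn_expl.
have sub (x L : R) : x + L - x = L by ring.
have {Hd} := Hd (s n).1 ((s n).1 + A / 2 ^+ n) (s n).2 ((s n).2 + B / 2 ^+ n)
  (Hp n) (Hq n).
rewrite !sub -mulrDl => /(_ Hn) HJ.
apply: (le_trans (sJ n)); rewrite mulrC -ler_pdivlMr ?exprn_gt0 //.
apply: (le_trans HJ).
have -> : e / K * ((A + B) / 2 ^+ n) ^+ 2 = e * ((A + B) ^+ 2 / K) / 4 ^+ n.
  rewrite expr_div_n -exprM mulnC exprM; have -> : (2 : R) ^+ 2 = 4 by ring.
  ring.
rewrite ler_wpM2r ?invr_ge0 ?exprn_ge0 // -[leRHS]mulr1 ler_wpM2l ?(ltW e0) //.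
by rewrite ler_pdivrMr // mul1r lerDl.
Qed.

End Subdivision.
End Goursat.

(** * Circle means in exponential coordinates, and finite nets of directions *)

Section Uniqueness.
Variable R : realType.
Implicit Types (f g : R[i] -> R[i]) (z c : R[i]).

Lemma cdiff_mull (k : R[i]) f z :
  cdifferentiable f z -> cdifferentiable (fun w => k * f w) z.
Proof. by move=> df; apply: cdiffM => //; exact: cdiff_cst. Qed.

Lemma cdiff_cexp z : cdifferentiable (@cexp R) z.
Proof. by apply/cdifferentiableP; eexists; exact: has_cderiv_cexp. Qed.

(** Goursat on a rectangle of height [2 pi]: periodicity cancels the horizontal sides, and the right
    side is pushed into the region where [G] vanishes, so the left side integrates to 0 by
    itself. *)
Lemma periodic_mean_eq0 (G : R[i] -> R[i]) (X x : R) :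
  (forall z, cdifferentiable G z) ->
  (forall t, G (Complex t (pi *+ 2)) = G (Complex t 0)) ->
  (forall z, X < complex.Re z -> G z = 0) ->
  cint (fun y => complex.Im (G (Complex x y))) 0 (pi *+ 2) = 0.
Proof.
move=> dG perG G0; have pi0 : 0 <= pi *+ 2 :> R by rewrite mulrn_wge0 // pi_ge0.
pose A := Num.max 0 (X + 1 - x).
have A0 : 0 <= A by rewrite le_max lexx.
have xA : X < x + A.
  by rewrite -ltrBlDl lt_max; apply/orP; right; lra.
have := goursat dG x 0 A0 pi0; rewrite /rect_circ add0r.
have -> : cint (fun t => complex.Re (G (Complex t 0)) - complex.Re (G (Complex t (pi *+ 2))))
   x (x + A) = 0.
  under [X in cint X]eq_fun do rewrite perG subrr.
  by rewrite cint_cst ?mul0r // lerDl.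
rewrite add0r => H; rewrite -[RHS]H; congr cint; apply/funext => y.
by rewrite (G0 (Complex (x + A) y)) // subr0.
Qed.

(* In the coordinate [z = exp zeta] an entire function vanishing outside a disc
   becomes periodic and vanishes for large [Re zeta], so its means over circles
   vanish; as the radius tends to 0 they tend to its value at 0. *)
Lemma entire_compact_support_eq0 g (rho : R) : 0 < rho ->
  (forall z, cdifferentiable g z) -> (forall z, rho < cabs z -> g z = 0) -> g 0 = 0.
Proof.
move=> rho0 dg gout; apply/eqP/negP => /negP g0.
have pi0 : 0 < pi *+ 2 :> R by rewrite pmulrn_lgt0 // pi_gt0.
(* Multiplication by [k] turns [g 0] into [i |g 0|^2], so the imaginary part, which is what
   [periodic_mean_eq0] controls, detects it. *)
pose k : R[i] := Complex (complex.Im (g 0)) (complex.Re (g 0)).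
pose C := complex.Im (k * g 0).
have C0 : 0 < C.
  rewrite /C /k; case: (g 0) g0 => a b; rewrite eq_complex /= negb_and => h.
  by case/orP: h => h; [have := sqr_ge0 b; have : 0 < a ^+ 2 by rewrite exprn_even_gt0
    |have := sqr_ge0 a; have : 0 < b ^+ 2 by rewrite exprn_even_gt0]; rewrite !expr2; lra.
have [d d0 Hd] := cdiff_continuous (cdiff_mull k (dg 0)) (divr_gt0 C0 (ltr0Sn _ 1)).
pose G z := k * g (cexp z).
have dG z : cdifferentiable G z.
  by apply: cdiff_mull; apply: cdiff_comp; [exact: cdiff_cexp | exact: dg].
have perG t : G (Complex t (pi *+ 2)) = G (Complex t 0).
  by rewrite /G /cexp /= cos2pi sin2pi cos0 sin0.
have outG z : ln rho < complex.Re z -> G z = 0.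
  by move=> h; rewrite /G gout ?mulr0 // cabs_cexp -(lnK rho0) ltr_expR.
have d20 : 0 < d / 2 by rewrite divr_gt0.
have [_ _ _ cG] := continuous_slices dG (ln (d / 2)) 0.
have : `|0 - C * (pi *+ 2 - 0)| <= C / 2 * (pi *+ 2 - 0).
  rewrite -[X in `|X - _|](periodic_mean_eq0 (ln (d / 2)) dG perG outG).
  apply: cint_dist => //; first exact: ltW.
  move=> y _; have H : cabs (k * g (cexp (Complex (ln (d / 2)) y)) - k * g 0) < C / 2.
    apply: Hd; rewrite subr0 cabs_cexp /= lnK ?posrE //.
    by rewrite ltr_pdivrMr // ltr_pMr // ltr1n.
  apply: le_trans (ltW H); rewrite /G /C.
  apply: le_trans (le_Im_cabs _).
  by case: (k * g 0) (k * g _) => [? ?] [? ?].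
rewrite subr0 sub0r normrN.
rewrite normrM !ger0_norm ?(ltW C0) ?(ltW pi0) // => H.
by have := mulr_gt0 C0 pi0; lra.
Qed.

(** Rotations by multiples of a small angle bring any direction close to the positive real axis,
    where the real part nearly equals the modulus. *)
Lemma unit_net (eta : R) : 0 < eta -> exists K : nat, exists a : nat -> R[i],
  (forall j, cabs (a j) = 1) /\
  forall z, exists2 j, (j < K)%N & cabs z * (1 - eta) <= complex.Re (a j * z).
Proof.
move=> eta0.
have [d d0 Hd] : exists2 d : R, 0 < d & forall s : R, `|s| < d -> 1 - eta <= cos s.
  have [d d0 H] := is_derive_eps (is_derive_cos (0 : R)) eta0.
  exists (Num.min d 1); first by rewrite lt_min d0 ltr01.
  move=> s; rewrite lt_min => /andP[/H + s1].
  rewrite add0r cos0 sin0 oppr0 mul0r subr0 ler_norml => /andP[h1 h2].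
  by have := normr_ge0 s; nra.
pose k := (Num.truncn ((pi : R) / d)).+1.
pose t (j : nat) : R := j%:R * (pi / k%:R).
(* The arccosine only yields angles in [[0, pi]]: even indices rotate clockwise and serve
   [Im z >= 0], odd ones rotate the other way and serve the lower half-plane. *)
pose a (j : nat) : R[i] := cexp (Complex 0 ((if odd j then 1 else -1) * t j./2)).
exists (2 * k.+1)%N, a; split=> [j|z]; first by rewrite cabs_cexp expR0.
have [->|z0] := eqVneq z 0.
  by exists 0%N => //; rewrite cabs0 mul0r mulr0.
have k0 : 0 < k%:R :> R by rewrite ltr0n.
have pk0 : 0 < pi / k%:R :> R by rewrite divr_gt0 // pi_gt0.
have pkd : pi / k%:R < d.
  by rewrite ltr_pdivrMr // mulrC -ltr_pdivrMr //; exact: truncnS_gt.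
have m0 : 0 < cabs z by rewrite cabs_gt0.
case: z z0 m0 => x y z0; set m := cabs _ => m0.
have m2 : x ^+ 2 + y ^+ 2 = m ^+ 2 by rewrite /m /= sqr_sqrtr // addr_ge0 // sqr_ge0.
have xm : -1 <= x / m <= 1.
  have : `|x / m| <= 1.
    rewrite normrM normfV (gtr0_norm m0) ler_pdivrMr // mul1r.
    exact: (le_Re_cabs (Complex x y)).
  by rewrite ler_norml.
pose th := acos (x / m).
have thE : cos th = x / m by rewrite acosK // in_itv.
have th0 : 0 <= th <= pi by rewrite acos_ge0 // acos_lepi.
have sinE : m * sin th = `|y|.
  rewrite sin_acos //; have -> : 1 - (x / m) ^+ 2 = (y / m) ^+ 2.
    by rewrite !expr_div_n; apply: (mulIf (lt0r_neq0 (exprn_gt0 2 m0)));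
      rewrite mulrBl !divfK ?mul1r ?lt0r_neq0 ?exprn_gt0 // -m2; ring.
  by rewrite sqrtr_sqr normrM normfV (gtr0_norm m0) mulrCA divff ?mulr1 // gt_eqF.
pose j0 := Num.truncn (th / (pi / k%:R)).
have [/andP[j1 j2]] : j0%:R <= th / (pi / k%:R) < j0.+1%:R /\ true.
  by split=> //; apply: truncn_itv; rewrite divr_ge0 // ?(ltW pk0) //; case/andP: th0.
move=> _; rewrite ler_pdivlMr // in j1; rewrite ltr_pdivrMr // in j2.
have jk : (j0 <= k)%N.
  have : j0%:R * (pi / k%:R) <= k%:R * (pi / k%:R) :> R.
    apply: (le_trans j1); case/andP: th0 => _; rewrite mulrCA divff ?mulr1 //.
    by rewrite gt_eqF.
  by rewrite ler_pM2r // ler_nat.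
have cosd : 1 - eta <= cos (th - t j0).
  apply: Hd; rewrite ger0_norm ?subr_ge0 //; apply: le_lt_trans pkd.
  by move: j2; rewrite /t -natr1 mulrDl mul1r; lra.
have [y0|y0] := leP 0 y.
- exists (j0.*2)%N; first by rewrite mul2n ltn_double ltnS.
  rewrite /a odd_double doubleK /cexp /= expR0 !mul1r mulN1r cosN sinN.
  have -> : x = m * cos th by rewrite thE mulrCA divff ?mulr1 ?gt_eqF.
  have -> : y = m * sin th by rewrite sinE ger0_norm.
  apply: (@le_trans _ _ (m * cos (th - t j0))); first by rewrite ler_wpM2l // ltW.
  by rewrite cosB; rewrite le_eqVlt; apply/orP; left; apply/eqP; ring.
- exists (j0.*2.+1)%N; first by rewrite mul2n doubleS !ltnS leq_double.
  rewrite /a /= odd_double /= uphalf_double /cexp /= expR0 !mul1r.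
  have -> : x = m * cos th by rewrite thE mulrCA divff ?mulr1 ?gt_eqF.
  have -> : y = - (m * sin th) by rewrite sinE ltr0_norm // opprK.
  apply: (@le_trans _ _ (m * cos (th - t j0))); first by rewrite ler_wpM2l // ltW.
  by rewrite cosB; rewrite le_eqVlt; apply/orP; left; apply/eqP; ring.
Qed.
End Uniqueness.

(** * Uniqueness of continuation from a half-plane *)

Section HalfPlaneUniqueness.
Variable R : realType.
Variable f : R[i] -> R[i].
Hypothesis df : forall s, s != 1 -> cdifferentiable f s.
Hypothesis f0 : forall s, 1 < complex.Re s -> f s = 0.

(* The product of f over sufficiently many rotations about c vanishes on an
   annulus around c, because each circle meets the half-plane where f = 0. *)
Lemma half_plane_uniqueness_nonreal (c : R[i]) : complex.Im c != 0 -> f c = 0.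
Proof.
move=> Ic0; have [Rc|Rc] := leP (complex.Re c) 1; last exact: f0.
(* [r0] is the distance from [c] to the half-plane and [d] the distance to the possible singularity
   1. As [Im c] is nonzero, [r0 < d], which leaves room for the radii [r' < r1 < r2] in between. *)
pose r0 := 1 - complex.Re c; pose d := cabs (c - 1).
have r00 : 0 <= r0 by rewrite subr_ge0.
have r0d : r0 < d.
  have E : d ^+ 2 = r0 ^+ 2 + complex.Im c ^+ 2.
    rewrite /d /r0; case: (c) => x y /=; rewrite sqr_sqrtr ?addr_ge0 ?sqr_ge0 //; ring.
  have y2 : 0 < complex.Im c ^+ 2 by rewrite exprn_even_gt0.
  have d0 : 0 <= d by exact: cabs_ge0.
  by rewrite -(ltr_pXn2r (n := 2)) ?nnegrE // E ltrDl.
pose r' := (3 * r0 + d) / 4; pose r1 := (r0 + d) / 2; pose r2 := (r0 + 3 * d) / 4.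
have [r0' [r'1 [r12 r2d]]] : r0 < r' /\ r' < r1 /\ r1 < r2 /\ r2 < d.
  by rewrite /r' /r1 /r2; do !split; lra.
have r10 : 0 < r1 by lra.
have r'0 : 0 < r' by lra.
(* With this [eta], a point of modulus more than [r1] has a rotation of real part more than
   [r' > r0], hence a factor of [P] evaluated inside the half-plane. *)
pose eta := 1 - r' / r1.
have eta0 : 0 < eta by rewrite subr_gt0 ltr_pdivrMr // mul1r.
have [K [a [a1 Ha]]] := unit_net eta0.
pose P z := \prod_(0 <= j < K) f (c + a j * z).
have P0 z : r1 < cabs z -> P z = 0.
  move=> z1; have [j jK Hj] := Ha z.
  apply/eqP; rewrite /P prodf_seq_eq0; apply/hasP; exists j.
    by rewrite mem_index_iota.
  apply/eqP/f0; have -> : complex.Re (c + a j * z) = complex.Re c + complex.Re (a j * z).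
    by case: (c) (a j * z) => [? ?] [? ?].
  have : r' < cabs z * (1 - eta).
    by rewrite /eta subKr mulrA ltr_pdivlMr // mulrC ltr_pM2r.
  by rewrite /r0 in r0'; lra.
have dP z : cabs z < d -> cdifferentiable P z.
  move=> zd; apply: cdiff_prod => j; apply: (@cdiff_comp _ (fun w => c + a j * w)).
    by apply: cdiffD; [exact: cdiff_cst | apply: cdiff_mull; exact: cdiff_id].
  apply: df; apply/eqP => E.
  have : c - 1 = - (a j * z) by rewrite -E; ring.
  by move/(congr1 (fun x => cabs x)); rewrite cabsN cabsM a1 mul1r -/d; lra.
(* [P] vanishes for moduli between [r1] and [r2], so cutting it off at [r2] yields an entire
   function. Its value at 0 is a power of [f c]. *)
pose g z := if cabs z < r2 then P z else 0.
have dg z : cdifferentiable g z.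
  have [zr|zr] := ltP (cabs z) r2.
    apply: (@cdiff_eq _ P _ z (r2 - cabs z)); rewrite ?subr_gt0 //; last first.
      by apply: dP; lra.
    move=> w wz; have := cabsD (w - z) z; rewrite subrK => ?.
    by rewrite /g; have -> : cabs w < r2 by lra.
  apply: (@cdiff_eq _ (fun=> 0) _ z (cabs z - r1)); last exact: cdiff_cst.
    by rewrite subr_gt0; lra.
  move=> w wz; have := cabsD (z - w) w; rewrite subrK cabsB => ?.
  by rewrite /g; case: ifP => // _; rewrite P0 //; lra.
have gout z : r1 < cabs z -> g z = 0.
  by move=> h; rewrite /g; case: ifP => // _; exact: P0.
have := entire_compact_support_eq0 r10 dg gout.
rewrite /g cabs0 ifT; last by lra.
move/eqP; rewrite /P prodf_seq_eq0 => /hasP [j _].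
by rewrite /= mulr0 addr0 => /eqP.
Qed.

(** For real [s] the half-plane and the singularity are at the same distance and the annulus
    disappears; such points are limits of nonreal ones. *)
Lemma half_plane_uniqueness (s : R[i]) : s != 1 -> f s = 0.
Proof.
move=> s1; have [Is0|] := eqVneq (complex.Im s) 0; last exact: half_plane_uniqueness_nonreal.
apply/eqP; rewrite -cabs_eq0 -normr_le0 ger0_norm ?cabs_ge0 //.
apply/ler_addgt0Pr => e e0; rewrite add0r.
have [d d0 Hd] := cdiff_continuous (df s1) e0.
pose w := s + Complex 0 (d / 2).
have d20 : 0 < d / 2 by rewrite divr_gt0.
have Iw : complex.Im w != 0.
  by move: Is0; rewrite /w; case: (s) => x y /= ->; rewrite add0r gt_eqF.
have := Hd w; rewrite (half_plane_uniqueness_nonreal Iw) sub0r cabsN => H.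
apply/ltW/H; rewrite /w addrC addKr /= expr0n add0r sqrtr_sqr ger0_norm ?ltW //.
by rewrite ltr_pdivrMr // ltr_pMr // ltr1n.
Qed.

End HalfPlaneUniqueness.

(** * Dominated series and their termwise differentiation *)

Section DominatedSeries.
Variable R : realType.
Implicit Types (T : nat -> R) (a : nat -> R[i]).

Definition vanishing T := forall e : R, 0 < e -> exists N, forall n, (N <= n)%N -> T n < e.

(** The majorant telescopes, so every [S m - T m] is at most every [S n + T n]; the supremum of the
    former is within [T N] of each [S N]. *)
Lemma real_series_dominated (a T : nat -> R) :
  (forall n, 0 <= T n) -> (forall n, `|a n| <= T n - T n.+1) ->
  exists L, forall N, `|L - \sum_(0 <= n < N) a n| <= T N.
Proof.
move=> T0 aT; pose S N := \sum_(0 <= n < N) a n.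
have Sr N : S N.+1 = S N + a N by rewrite /S big_nat_recr.
have dT n k : T (n + k)%N <= T n.
  elim: k => [|k IH]; rewrite ?addn0 // addnS.
  by have := aT (n + k)%N; have := normr_ge0 (a (n + k)%N); lra.
have key n k : `|S (n + k)%N - S n| <= T n - T (n + k)%N.
  elim: k => [|k IH]; first by rewrite addn0 !subrr normr0.
  rewrite addnS Sr; have -> : S (n + k)%N + a (n + k)%N - S n =
    (S (n + k)%N - S n) + a (n + k)%N by ring.
  by apply: (le_trans (ler_normD _ _)); have := aT (n + k)%N; lra.
have ub m n : S m - T m <= S n + T n.
  have [mn|nm] := leqP m n.
    have := key m (n - m)%N; rewrite subnKC // ler_norml => /andP[+ _].
    by have := T0 n; lra.
  have := key n (m - n)%N; rewrite subnKC ?(ltnW nm) // ler_norml => /andP[_].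
  by have := T0 m; lra.
exists (sup (range (fun m => S m - T m))) => N.
have h1 : S N - T N <= sup (range (fun m => S m - T m)).
  by apply: ub_le_sup; [exists (S 0%N + T 0%N) => _ [i _ <-]; exact: ub | exists N].
have h2 : sup (range (fun m => S m - T m)) <= S N + T N.
  by apply: ge_sup; [exists (S 0%N - T 0%N), 0%N | move=> _ [i _ <-]; exact: ub].
by rewrite -/(S N) ler_norml; apply/andP; split; lra.
Qed.

Lemma Re_sum (I : Type) (r : seq I) (F : I -> R[i]) :
  complex.Re (\sum_(i <- r) F i) = \sum_(i <- r) complex.Re (F i).
Proof. by elim/big_rec2: _ => // i y1 [x y] _ <-; case: (F i). Qed.

Lemma Im_sum (I : Type) (r : seq I) (F : I -> R[i]) :
  complex.Im (\sum_(i <- r) F i) = \sum_(i <- r) complex.Im (F i).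
Proof. by elim/big_rec2: _ => // i y1 [x y] _ <-; case: (F i). Qed.

Lemma complex_series_dominated a T :
  (forall n, 0 <= T n) -> (forall n, cabs (a n) <= T n - T n.+1) ->
  exists L, forall N, cabs (L - \sum_(0 <= n < N) a n) <= 2 * T N.
Proof.
move=> T0 aT.
have [x Hx] : exists L, forall N, `|L - \sum_(0 <= n < N) complex.Re (a n)| <= T N.
  by apply: real_series_dominated => // n; apply: le_trans (aT n); exact: le_Re_cabs.
have [y Hy] : exists L, forall N, `|L - \sum_(0 <= n < N) complex.Im (a n)| <= T N.
  by apply: real_series_dominated => // n; apply: le_trans (aT n); exact: le_Im_cabs.
exists (Complex x y) => N; apply: le_trans (cabs_le _) _.
have := Hx N; have := Hy N; rewrite -Re_sum -Im_sum.
by case: (\sum_(0 <= n < N) a n) => p q /=; lra.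
Qed.

Lemma cderiv_lip_le (f : R[i] -> R[i]) z l (M d : R) : 0 < d ->
  has_cderiv f z l ->
  (forall h, cabs h < d -> cabs (f (z + h) - f z) <= cabs h * M) -> cabs l <= M.
Proof.
move=> d0 fl H; apply/ler_addgt0Pr => e e0.
have [c c0 Hc] := fl _ e0.
pose m := Num.min c d / 2.
have m0 : 0 < m by rewrite divr_gt0 // lt_min c0.
have mm : m < Num.min c d by rewrite /m ltr_pdivrMr // ltr_pMr ?lt_min ?c0 // ltr1n.
have hm : cabs m%:C%C = m by rewrite cabs_real gtr0_norm.
move: mm; rewrite lt_min => /andP[mc md].
have := H m%:C%C; have := Hc m%:C%C; rewrite hm => /(_ mc) h1 /(_ md) h2.
rewrite -(ler_pM2l m0) -{1}hm -cabsM mulrC.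
have -> : l * m%:C%C = (f (z + m%:C%C) - f z) + - (f (z + m%:C%C) - f z - l * m%:C%C) by ring.
by apply: (le_trans (cabsD _ _)); rewrite cabsN; lra.
Qed.

(** Lipschitz bounds at the single point [z], with telescoping constants, do the work of uniform
    convergence: they bound the terms of the derivative series and also the tail of the difference
    quotient. *)
Lemma cdiff_series (a : nat -> R[i] -> R[i]) (S : R[i] -> R[i]) z (T : nat -> R) (d : R) :
  0 < d -> (forall n, 0 <= T n) -> vanishing T ->
  (forall n, cdifferentiable (a n) z) ->
  (forall n h, cabs h < d -> cabs (a n (z + h) - a n z) <= cabs h * (T n - T n.+1)) ->
  (forall h, cabs h < d -> forall e : R, 0 < e -> exists N, forall n, (N <= n)%N ->
     cabs (S (z + h) - \sum_(0 <= i < n) a i (z + h)) < e) ->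
  cdifferentiable S z.
Proof.
move=> d0 T0 vT da lip lim; apply/cdifferentiableP.
have [a' Ha'] : exists a' : nat -> R[i], forall n, has_cderiv (a n) z (a' n).
  have /choice [a' Ha'] : forall n, exists l, has_cderiv (a n) z l.
    by move=> n; apply/cdifferentiableP.
  by exists a'.
have [L HL] := complex_series_dominated T0
  (fun n => cderiv_lip_le d0 (Ha' n) (fun h => lip n h)).
exists L => e e0.
have e8 : 0 < e / 8 by rewrite divr_gt0.
have [N HN] := vT _ e8; have {}HN := HN N (leqnn N).
have fin : has_cderiv (fun w => \sum_(0 <= i < N) a i w) z (\sum_(0 <= i < N) a' i).
  elim: (N) => [|k IH].
    have -> : (fun w => \sum_(0 <= i < 0) a i w) = fun=> 0.
      by apply/funext => w; rewrite big_nil.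
    by rewrite big_nil; exact: has_cderiv_cst.
  have -> : (fun w => \sum_(0 <= i < k.+1) a i w) =
            (fun w => \sum_(0 <= i < k) a i w + a k w).
    by apply/funext => w; rewrite big_nat_recr.
  by rewrite big_nat_recr //=; exact: has_cderivD.
have [c c0 Hc] := fin _ e8.
exists (Num.min c d); first by rewrite lt_min c0.
move=> h; rewrite lt_min => /andP[/Hc h1 hd].
have [->|h0] := eqVneq h 0; first by rewrite addr0 mulr0 subr0 subrr cabs0 mulr0.
have m0 : 0 < cabs h by rewrite cabs_gt0.
have em : 0 < e / 8 * cabs h by rewrite mulr_gt0.
have [N1 H1] := lim h hd _ em.
have d00 : cabs (0 : R[i]) < d by rewrite cabs0.
have [N2 H2] := lim 0 d00 _ em.
have tail k : cabs ((\sum_(0 <= i < N + k) a i (z + h) - \sum_(0 <= i < N + k) a i z) -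
   (\sum_(0 <= i < N) a i (z + h) - \sum_(0 <= i < N) a i z)) <= cabs h * (T N - T (N + k)%N).
  elim: k => [|k IH]; first by rewrite addn0 !subrr cabs0 mulr0.
  rewrite addnS !big_nat_recr //=.
  have -> : cabs h * (T N - T (N + k).+1) =
    cabs h * (T N - T (N + k)%N) + cabs h * (T (N + k)%N - T (N + k).+1) by ring.
  apply: le_trans (lerD IH (lip (N + k)%N h hd)); apply: le_trans (cabsD _ _).
  by rewrite le_eqVlt; apply/orP; left; apply/eqP; congr (cabs _); ring.
(* The cut [N] serves all [h], whereas [k] depends on [h]; this is harmless because [tail] holds for
   every [k]. *)
pose k := (N1 + N2)%N.
have {}H1 := H1 (N + k)%N; have {}H2 := H2 (N + k)%N.
have {}H1 : cabs (S (z + h) - \sum_(0 <= i < N + k) a i (z + h)) < e / 8 * cabs h.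
  by apply: H1; rewrite /k addnCA leq_addr.
have {}H2 := H2 (leq_trans (leq_addl N1 N2) (leq_addl N k)).
have {}tail := tail k; have TN := T0 (N + k)%N.
move: H1 H2 tail h1 (HL N); rewrite !addr0.
set A := \sum_(0 <= i < N + k) a i (z + h); set B := \sum_(0 <= i < N + k) a i z.
set A' := \sum_(0 <= i < N) a i (z + h); set B' := \sum_(0 <= i < N) a i z.
set L' := \sum_(0 <= i < N) a' i => H1 H2 tail h1 HLN.
have -> : S (z + h) - S z - L * h = (S (z + h) - A) + - (S z - B) +
  ((A - B) - (A' - B')) + (A' - B' - L' * h) + - ((L - L') * h) by ring.
have t1 : cabs h * (T N - T (N + k)%N) <= cabs h * (e / 8).
  by rewrite ler_wpM2l // ?ltW //; lra.
have t2 : cabs ((L - L') * h) <= 2 * (e / 8) * cabs h.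
  rewrite cabsM ler_wpM2r ?cabs_ge0 //; lra.
apply: (le_trans (cabsD _ _)); rewrite cabsN.
apply: (@le_trans _ _ (e / 8 * cabs h + e / 8 * cabs h + cabs h * (e / 8) +
   e / 8 * cabs h + 2 * (e / 8) * cabs h)); last by lra.
apply: lerD => //; apply: le_trans (cabsD _ _) _; apply: lerD => //.
apply: le_trans (cabsD _ _) _; apply: lerD; last by lra.
apply: le_trans (cabsD _ _) _; rewrite cabsN; apply: lerD; exact: ltW.
Qed.

End DominatedSeries.

(** * A Taylor bound on a unit interval *)

Section Taylor.
Variable R : realType.

Lemma is_derive_taylor_poly (c : nat -> R) n (t : R) :
  is_derive t 1 (fun t => \sum_(i < n.+1) c i * t ^+ i / i`!%:R)
    (\sum_(i < n) c i.+1 * t ^+ i / i`!%:R).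
Proof.
elim: n => [|n IH].
  rewrite big_ord0.
  have -> : (fun t0 => \sum_(i < 1) c i * t0 ^+ i / i`!%:R) = cst (c 0%N).
    by apply/funext => x; rewrite big_ord1 expr0 fact0 divr1 mulr1.
  exact: is_derive_cst.
have -> : (fun t0 => \sum_(i < n.+2) c i * t0 ^+ i / i`!%:R) =
  (fun t0 => \sum_(i < n.+1) c i * t0 ^+ i / i`!%:R) +
  (fun t0 : R => (c n.+1 / n.+1`!%:R) *: (t0 ^+ n.+1)).
  by apply/funext => x; rewrite big_ord_recr /= /GRing.scale /= fctE mulrAC.
rewrite big_ord_recr /=; apply: is_deriveD.
have h : is_derive t 1 (fun x : R => x ^+ n.+1) (n.+1%:R * t ^+ n *: (1 : R)).
  have -> : (fun x : R => x ^+ n.+1) = (@id R) ^+ n.+1 by apply/funext => x; rewrite fctE.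
  exact: is_deriveX.
apply: (is_derive_eq (is_deriveZ (c n.+1 / n.+1`!%:R) h)).
rewrite /GRing.scale /= mulr1 factS natrM.
by field; rewrite nat1r !pnatr_eq0 -lt0n fact_gt0.
Qed.

(** The derivative of the remainder is the remainder of the derivative, so the mean value theorem
    gives an induction on [k]. On a unit interval the bound [M], without a factorial, is good
    enough. *)
Lemma taylor_bound k (u : nat -> R -> R) (a M : R) :
  (forall j x, a <= x <= a + 1 -> is_derive x 1 (u j) (u j.+1 x)) ->
  (forall x, a <= x <= a + 1 -> `|u k x| <= M) ->
  forall t, 0 <= t <= 1 -> `|u 0%N (a + t) - \sum_(i < k) u i a * t ^+ i / i`!%:R| <= M.
Proof.
elim: k u => [|k IH] u du uM t /andP[t0 t1].
  by rewrite big_ord0 subr0; apply: uM; rewrite lerDl t0 lerD2l t1.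
have {}IH := IH (fun j => u j.+1) (fun j => du j.+1) uM.
pose g t := u 0%N (a + t) - \sum_(i < k.+1) u i a * t ^+ i / i`!%:R.
pose g' t := u 1%N (a + t) - \sum_(i < k) u i.+1 a * t ^+ i / i`!%:R.
have dg (x : R) : 0 <= x <= 1 -> is_derive x 1 g (g' x).
  move=> /andP[x0 x1]; apply: is_deriveB; last first.
    exact: (is_derive_taylor_poly (fun i => u i a)).
  have ax : a <= a + x <= a + 1 by rewrite lerDl x0 lerD2l.
  have h : is_derive x 1 (fun x => a + x) 1.
    by apply: (is_derive_eq (is_deriveD (is_derive_cst a x 1) (is_derive_id x 1))); rewrite add0r.
  by have := @is_derive1_comp R (u 0%N) (fun x => a + x) x _ 1 (du 0%N _ ax) h; rewrite mulr1.
have cg : {within `[0, t], continuous g}.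
  apply: derivable_within_continuous => x; rewrite in_itv /= => /andP[x0 xt].
  by have [] := dg x ltac:(rewrite x0 (le_trans xt t1)).
have dg' (x : R) : x \in `]0, t[%R -> is_derive x 1 g (g' x).
  by rewrite in_itv /= => /andP[x0 xt]; apply: dg; rewrite (ltW x0) (le_trans (ltW xt) t1).
have [c] := MVT_segment t0 dg' cg.
rewrite in_itv /= => /andP[c0 ct].
have -> : g 0 = 0.
  rewrite /g addr0 big_ord_recl /= expr0 fact0 mulr1 divr1 big1 ?addr0 ?subrr // => i _.
  by rewrite expr0n /= mulr0 mul0r.
rewrite !subr0 -/(g t) => ->; rewrite normrM (ger0_norm t0).
have : `|g' c| <= M by apply: IH; rewrite c0 (le_trans ct t1).
by move=> h; rewrite -[M]mulr1; apply: ler_pM.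
Qed.

End Taylor.

(** * One step of the Euler-Maclaurin formula *)

Section EulerMaclaurin.
Variable R : realType.
Implicit Types (F : nat -> R -> R[i]) (x : R).

Definition derivative_tower F := forall j x, 0 < x ->
  is_derive x 1 (fun y => complex.Re (F j y)) (complex.Re (F j.+1 x)) /\
  is_derive x 1 (fun y => complex.Im (F j y)) (complex.Im (F j.+1 x)).

Lemma Re_mulreal (z : R[i]) (r : R) : complex.Re (z * r%:C%C) = complex.Re z * r.
Proof. by case: z => a b /=; rewrite mulr0 subr0. Qed.

Lemma Im_mulreal (z : R[i]) (r : R) : complex.Im (z * r%:C%C) = complex.Im z * r.
Proof. by case: z => a b /=; rewrite mulr0 add0r. Qed.

Lemma ReB (z w : R[i]) : complex.Re (z - w) = complex.Re z - complex.Re w.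
Proof. by case: z w => [? ?] [? ?]. Qed.

Lemma ImB (z w : R[i]) : complex.Im (z - w) = complex.Im z - complex.Im w.
Proof. by case: z w => [? ?] [? ?]. Qed.

Lemma complex_taylor_bound k F x (M : R) : derivative_tower F -> 0 < x ->
  (forall y, x <= y <= x + 1 -> cabs (F k y) <= M) ->
  cabs (F 0%N (x + 1) - \sum_(0 <= i < k) F i x * (i`!%:R^-1)%:C%C) <= 2 * M.
Proof.
move=> dF x0 FM.
have xy y : x <= y <= x + 1 -> 0 < y by case/andP => xy _; exact: lt_le_trans xy.
have h1 : `|complex.Re (F 0%N (x + 1)) - \sum_(i < k) complex.Re (F i x) * 1 ^+ i / i`!%:R| <= M.
  apply: (@taylor_bound _ k (fun j y => complex.Re (F j y)) x M).
  - by move=> j y /xy y0; have [] := dF j y y0.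
  - by move=> y /FM; apply: le_trans; exact: le_Re_cabs.
  - by rewrite ler01 lexx.
have h2 : `|complex.Im (F 0%N (x + 1)) - \sum_(i < k) complex.Im (F i x) * 1 ^+ i / i`!%:R| <= M.
  apply: (@taylor_bound _ k (fun j y => complex.Im (F j y)) x M).
  - by move=> j y /xy y0; have [] := dF j y y0.
  - by move=> y /FM; apply: le_trans; exact: le_Im_cabs.
  - by rewrite ler01 lexx.
apply: le_trans (cabs_le _) _; rewrite ReB ImB Re_sum Im_sum.
under eq_bigr do rewrite Re_mulreal.
under [X in _ + `|_ - X|]eq_bigr do rewrite Im_mulreal.
rewrite !big_mkord.
under eq_bigr => i _ do rewrite -[complex.Re _]mulr1 -[X in _ * X / _](expr1n _ i).
under [X in _ + `|_ - X|]eq_bigr => i _ do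
  rewrite -[complex.Im _]mulr1 -[X in _ * X / _](expr1n _ i).
by rewrite mulr_natl mulr2n lerD.
Qed.

Fixpoint em_coefs n : seq R :=
  if n is n'.+1 then
    let s := em_coefs n' in
    rcons s (- \sum_(j < n) nth 0 s j / (n.+1 - j)`!%:R)
  else [:: 1].

(* The scalars B_j / j! up to the sign of B_1: the coefficients of the
   power series inverse to (exp t - 1) / t. *)
Definition em_coef j : R := nth 0 (em_coefs j) j.

Lemma size_em_coefs n : size (em_coefs n) = n.+1.
Proof. by elim: n => //= n IH; rewrite size_rcons IH. Qed.

Lemma em_coefs_nth n j : (j <= n)%N -> nth 0 (em_coefs n) j = em_coef j.
Proof.
elim: n => [|n IH]; first by rewrite leqn0 => /eqP ->.
rewrite leq_eqVlt => /predU1P[-> //|jn].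
by rewrite /= nth_rcons size_em_coefs jn IH.
Qed.

Lemma em_coef_rec l : (0 < l)%N ->
  \sum_(0 <= j < l.+1) em_coef j / (l.+1 - j)`!%:R = 0.
Proof.
case: l => // l _; rewrite big_nat_recr //= subSnn (_ : 1`! = 1%N) // divr1.
rewrite {2}/em_coef /= nth_rcons size_em_coefs ltnn eqxx big_mkord.
apply/eqP; rewrite subr_eq0; apply/eqP; apply: eq_bigr => j _.
by rewrite em_coefs_nth // -ltnS.
Qed.

Lemma em_coef0 : em_coef 0 = 1. Proof. by []. Qed.

(** Euler-Maclaurin on [[x, x + 1]] for the function [F 1], with antiderivative [F 0]. Formally, the
    series of [em_coef] in the derivation [D], times [exp D - 1], is [D], so only terms of order
    above [K] survive. *)
Definition em_increment K F x : R[i] :=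
  - F 1%N x + \sum_(0 <= j < K.+1) (em_coef j)%:C%C * (F j (x + 1) - F j x).

(** Coefficient of [t^l] in [exp t * t / (exp t - 1) = t / (exp t - 1) + t]. *)
Lemma em_coef_sum l : \sum_(0 <= j < l.+1) em_coef j / (l - j)`!%:R =
  em_coef l + (l == 1%N)%:R.
Proof.
rewrite big_nat_recr //= subnn fact0 divr1 addrC; congr (_ + _).
case: l => [|[|l]]; first by rewrite big_nil.
  by rewrite big_nat1 subn0 divr1.
by rewrite em_coef_rec.
Qed.

(** By [em_coef_sum], the Taylor polynomials of the [F j (x + 1)] add up to exactly the terms
    [em_coef j * F j x] and [F 1 x]. What is left is a combination of Taylor remainders, all
    expressed through [F K.+2]. *)
Lemma em_incrementE K F x : em_increment K.+1 F x =
  \sum_(0 <= j < K.+2) (em_coef j)%:C%C *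
    (F j (x + 1) - \sum_(0 <= i < K.+2 - j) F (j + i)%N x * (i`!%:R^-1)%:C%C).
Proof.
rewrite /em_increment; set n := K.+2.
pose A j l : R[i] := if (j <= l)%N then F l x * ((em_coef j / (l - j)`!%:R)%:C%C) else 0.
have E1 j : (j < n)%N ->
  (em_coef j)%:C%C * \sum_(0 <= i < n - j) F (j + i)%N x * (i`!%:R^-1)%:C%C =
  \sum_(0 <= l < n) A j l.
  move=> jn; rewrite [RHS](big_cat_nat (n := j)) //= ?(ltnW jn) //.
  rewrite [X in _ = X + _]big_nat_cond [X in _ = X + _]big1 ?add0r; last first.
    by move=> l; rewrite andbT => /andP[_ lj]; rewrite /A leqNgt lj.
  rewrite -{4}[j]add0n big_addn mulr_sumr; apply: eq_bigr => i _.
  by rewrite /A leq_addl addnK addnC rmorphM /= mulrCA.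
have E2 l : (l < n)%N ->
  \sum_(0 <= j < n) A j l = F l x * (em_coef l + (l == 1%N)%:R)%:C%C.
  move=> ln; rewrite -em_coef_sum rmorph_sum /= mulr_sumr.
  rewrite [LHS](big_cat_nat (n := l.+1)) //=.
  rewrite [X in _ + X]big_nat_cond [X in _ + X]big1 ?addr0; last first.
    by move=> j; rewrite andbT => /andP[lj _]; rewrite /A leqNgt lj.
  by apply: eq_big_nat => j /andP[_ jl]; rewrite /A -ltnS jl.
under [RHS]eq_big_nat => j /andP[_ jn] do rewrite mulrBr E1 //.
rewrite sumrB exchange_big /=.
under [X in _ = _ - X]eq_big_nat => l /andP[_ ln] do rewrite E2 // rmorphD mulrDr /=.
rewrite big_split /=.
have -> : \sum_(0 <= l < n) F l x * ((l == 1%N)%:R)%:C%C = F 1%N x.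
  rewrite /n big_nat_recl // big_nat_recl //= [X in _ + (_ + X)]big1 ?addr0.
    by rewrite mulr0 add0r mulr1.
  by move=> i _; rewrite mulr0.
under eq_bigr do rewrite mulrBr.
rewrite sumrB opprD addrC addrA; congr (_ - _ - _).
by apply: eq_bigr => i _; rewrite mulrC.
Qed.

Definition em_const K : R := \sum_(0 <= j < K.+2) `|em_coef j|.

Lemma em_increment_bound K F x (M : R) : derivative_tower F -> 0 < x ->
  (forall y, x <= y <= x + 1 -> cabs (F K.+2 y) <= M) ->
  cabs (em_increment K.+1 F x) <= 2 * em_const K * M.
Proof.
move=> dF x0 FM; rewrite em_incrementE.
apply: le_trans (cabs_sum _ _ _) _.
have -> : 2 * em_const K * M = \sum_(0 <= j < K.+2) `|em_coef j| * (2 * M).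
  by rewrite -mulr_suml -/(em_const K); ring.
rewrite big_nat [leRHS]big_nat; apply: ler_sum => j /andP[_ jK].
rewrite cabsM cabs_real ler_wpM2l //.
have dFj : derivative_tower (fun i => F (j + i)%N).
  by move=> i y y0; rewrite addnS; exact: dF.
have := @complex_taylor_bound (K.+2 - j) _ x M dFj x0.
rewrite addn0; apply => y /FM.
by rewrite subnKC // ltnW.
Qed.

Lemma em_incrementB K (F F' : nat -> R -> R[i]) x :
  em_increment K (fun j y => F j y - F' j y) x = em_increment K F x - em_increment K F' x.
Proof.
rewrite /em_increment.
have E j : (em_coef j)%:C%C * (F j (x + 1) - F' j (x + 1) - (F j x - F' j x)) =
  (em_coef j)%:C%C * (F j (x + 1) - F j x) - (em_coef j)%:C%C * (F' j (x + 1) - F' j x).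
  by ring.
under eq_bigr => j _ do rewrite E.
by rewrite sumrB; ring.
Qed.

Lemma derivative_towerB F F' : derivative_tower F -> derivative_tower F' ->
  derivative_tower (fun j y => F j y - F' j y).
Proof.
move=> dF dF' j x x0; have [a b] := dF j x x0; have [a' b'] := dF' j x x0.
split.
  rewrite ReB; under eq_fun do rewrite ReB; exact: is_deriveB.
rewrite ImB; under eq_fun do rewrite ImB; exact: is_deriveB.
Qed.

End EulerMaclaurin.

(** * Derivatives of complex powers and their dependence on the exponent *)

Section PowerTower.
Variable R : realType.
Implicit Types (w v k : R[i]) (x y : R).

Lemma ReM (z w : R[i]) : complex.Re (z * w) =
  complex.Re z * complex.Re w - complex.Im z * complex.Im w.
Proof. by case: z w => [? ?] [? ?]. Qed.

Lemma ImM (z w : R[i]) : complex.Im (z * w) =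
  complex.Re z * complex.Im w + complex.Im z * complex.Re w.
Proof. by case: z w => [? ?] [? ?]. Qed.

Lemma cpowN1 x : 0 < x -> cpow x (-1) = (x^-1)%:C%C.
Proof.
move=> x0; have := cpowD x (-1) 1; rewrite addNr cpow0 cpowr1 // => E.
have x1 : x%:C%C != 0 :> R[i] by rewrite eq_complex /= eqxx andbT gt_eqF.
by apply: (mulIf x1); rewrite -E -rmorphM mulVf ?rmorph1 // gt_eqF.
Qed.

Lemma cpowB1 x w : 0 < x -> cpow x (w - 1) = cpow x w * (x^-1)%:C%C.
Proof. by move=> x0; rewrite cpowD cpowN1. Qed.

Lemma is_derive_linear_ln a x : 0 < x -> is_derive x 1 (fun y => a * ln y) (a / x).
Proof.
move=> x0; exact: (is_deriveZ a (is_derive1_ln x0)).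
Qed.

Lemma is_derive_cpow v x : 0 < x ->
  is_derive x 1 (fun y => complex.Re (cpow y v)) (complex.Re (v * cpow x (v - 1))) /\
  is_derive x 1 (fun y => complex.Im (cpow y v)) (complex.Im (v * cpow x (v - 1))).
Proof.
move=> x0; case: v => a b.
have dE := @is_derive1_comp R expR (fun y => a * ln y) x _ _ (is_derive_expR _) (is_derive_linear_ln a x0).
have dC := @is_derive1_comp R cos (fun y => b * ln y) x _ _ (is_derive_cos _) (is_derive_linear_ln b x0).
have dS := @is_derive1_comp R sin (fun y => b * ln y) x _ _ (is_derive_sin _) (is_derive_linear_ln b x0).
rewrite cpowB1 // ReM ImM Re_mulreal Im_mulreal /=; split.
- apply: (is_derive_eq (is_deriveM dE dC)); rewrite /GRing.scale /=; ring.
- apply: (is_derive_eq (is_deriveM dE dS)); rewrite /GRing.scale /=; ring.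
Qed.

Lemma is_derive_mul_cpow k v x : 0 < x ->
  is_derive x 1 (fun y => complex.Re (k * cpow y v)) (complex.Re (k * (v * cpow x (v - 1)))) /\
  is_derive x 1 (fun y => complex.Im (k * cpow y v)) (complex.Im (k * (v * cpow x (v - 1)))).
Proof.
move=> x0; have [d1 d2] := is_derive_cpow v x0; split.
- rewrite ReM; under eq_fun do rewrite ReM.
  exact: (is_deriveB (is_deriveZ (complex.Re k) d1) (is_deriveZ (complex.Im k) d2)).
- rewrite ImM; under eq_fun do rewrite ImM.
  exact: (is_deriveD (is_deriveZ (complex.Re k) d2) (is_deriveZ (complex.Im k) d1)).
Qed.

Definition falling j w : R[i] := \prod_(0 <= i < j) (w - i%:R).

(** The [j]-th derivative of [x^w]. In the application [w = 1 - s], so order 1 is [(1 - s) x^(-s)];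
    starting from [x^w] instead of [x^w / w] avoids any division at [s = 1]. *)
Definition pow_tower w j x : R[i] := falling j w * cpow x (w - j%:R).

Lemma derivative_tower_pow w : derivative_tower (pow_tower w).
Proof.
move=> j x x0; have := is_derive_mul_cpow (falling j w) (w - j%:R) x0.
have -> : falling j w * ((w - j%:R) * cpow x (w - j%:R - 1)) = pow_tower w j.+1 x.
  by rewrite /pow_tower /falling big_nat_recr //= mulrA -natr1 opprD addrA.
by [].
Qed.

Lemma cdiff_falling j w : cdifferentiable (falling j) w.
Proof.
apply: cdiff_prod => i; apply: cdiffD; [exact: cdiff_id | exact: cdiff_cst].
Qed.

Lemma cdiff_pow_tower j x w : cdifferentiable (fun w => pow_tower w j x) w.
Proof.
apply: cdiffM; first exact: cdiff_falling.
apply: (@cdiff_comp _ (fun w => w - j%:R)); last exact: cdiff_cpow.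
by apply: cdiffD; [exact: cdiff_id | exact: cdiff_cst].
Qed.

(** Mean value theorem along [t -> exp (t z)], applied to the real and the imaginary part
    separately, hence the factor 2. *)
Lemma cexp_lip (z : R[i]) : cabs (cexp z - 1) <= 2 * cabs z * expR `|complex.Re z|.
Proof.
case: z => a b; set z := Complex a b.
have main (part : R[i] -> R) (p : R -> R) (p' : R -> R) :
  (forall t : R, 0 <= t <= 1 -> is_derive t 1 p (p' t)) ->
  (forall t : R, 0 <= t <= 1 -> `|p' t| <= cabs z * expR `|a|) ->
  `|p 1 - p 0| <= cabs z * expR `|a|.
  move=> dp bp.
  have cp : {within `[0, 1], continuous p}.
    apply: derivable_within_continuous => x; rewrite in_itv /= => x01.
    by have [] := dp x x01.
  have dp' (x : R) : x \in `]0, 1[%R -> is_derive x 1 p (p' x).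
    by rewrite in_itv /= => /andP[x0 x1]; apply: dp; rewrite !ltW.
  have [c] := MVT_segment ler01 dp' cp; rewrite in_itv /= => c01 ->.
  by rewrite subr0 mulr1; exact: bp.
have dl (c t : R) : is_derive t 1 (fun t => c * t) c.
  by apply: (is_derive_eq (is_deriveZ c (is_derive_id t 1))); rewrite /GRing.scale /= mulr1.
have dE t := @is_derive1_comp R expR (fun t => a * t) t _ _ (is_derive_expR _) (dl a t).
have dC t := @is_derive1_comp R cos (fun t => b * t) t _ _ (is_derive_cos _) (dl b t).
have dS t := @is_derive1_comp R sin (fun t => b * t) t _ _ (is_derive_sin _) (dl b t).
pose q t := z * cexp (Complex (a * t) (b * t)).
have qb t : 0 <= t <= 1 -> cabs (q t) <= cabs z * expR `|a|.
  move=> /andP[t0 t1]; rewrite cabsM cabs_cexp /= ler_wpM2l ?cabs_ge0 // ler_expR.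
  apply: le_trans (ler_norm _) _; rewrite normrM (ger0_norm t0) ler_piMr //.
have h1 : `|(expR (a * 1) * cos (b * 1)) - (expR (a * 0) * cos (b * 0))| <= cabs z * expR `|a|.
  apply: (main (@complex.Re R) (fun t => expR (a * t) * cos (b * t)) (fun t => complex.Re (q t))).
    move=> t _; apply: (is_derive_eq (is_deriveM (dE t) (dC t))).
    by rewrite /q /z /cexp ReM /= /GRing.scale /=; ring.
  by move=> t /qb; apply: le_trans; exact: le_Re_cabs.
have h2 : `|(expR (a * 1) * sin (b * 1)) - (expR (a * 0) * sin (b * 0))| <= cabs z * expR `|a|.
  apply: (main (@complex.Im R) (fun t => expR (a * t) * sin (b * t)) (fun t => complex.Im (q t))).
    move=> t _; apply: (is_derive_eq (is_deriveM (dE t) (dS t))).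
    by rewrite /q /z /cexp ImM /= /GRing.scale /=; ring.
  by move=> t /qb; apply: le_trans; exact: le_Im_cabs.
apply: le_trans (cabs_le _) _; move: h1 h2.
by rewrite !mulr1 !mulr0 expR0 cos0 sin0 mulr1 mulr0 /= -/z oppr0; lra.
Qed.

(* For y >= 1 and exponents far enough to the left, pow_tower is O(y^-2),
   locally uniformly and with a Lipschitz constant in w. *)
Lemma pow_tower_bound w j y : 1 <= y -> complex.Re w + 2 <= j%:R ->
  cabs (pow_tower w j y) <= cabs (falling j w) * (y ^+ 2)^-1.
Proof.
move=> y1 wj; have y0 : 0 < y by lra.
rewrite /pow_tower cabsM ler_wpM2l ?cabs_ge0 // cabs_cpow.
have -> : (y ^+ 2)^-1 = expR (- 2 * ln y).
  by rewrite -{1}(lnK y0) -expRM_natl mulNr expRN.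
rewrite ler_expR ler_wpM2r ?ln_ge0 // ReB.
have -> : complex.Re (j%:R : R[i]) = j%:R.
  by rewrite -(rmorph_nat (real_complex R)).
lra.
Qed.

Lemma pow_tower_lip w j : exists2 d : R, 0 < d & exists C : R, 0 <= C /\ forall h y,
  cabs h < d -> 1 <= y -> complex.Re w + 4 <= j%:R ->
  cabs (pow_tower (w + h) j y - pow_tower w j y) <= cabs h * (C * (y ^+ 2)^-1).
Proof.
have /cdifferentiableP [l /has_cderiv_lip [d d0 Hd]] := cdiff_falling j w.
exists (Num.min d 1); first by rewrite lt_min d0 ltr01.
pose B := cabs (falling j w); have B0 : 0 <= B by exact: cabs_ge0.
have L0 : 0 <= cabs l + 1 by rewrite addr_ge0 ?cabs_ge0.
exists ((cabs l + 1) + 2 * B); split; first by lra.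
move=> h y; rewrite lt_min => /andP[/Hd hl h1] y1 wj; have y0 : 0 < y by lra.
have Rj : complex.Re (j%:R : R[i]) = j%:R by rewrite -(rmorph_nat (real_complex R)).
have hh : `|complex.Re h| <= cabs h := le_Re_cabs h.
have ReD (z v : R[i]) : complex.Re (z + v) = complex.Re z + complex.Re v.
  by case: z v => [? ?] [? ?].
have ln0 : 0 <= ln y by rewrite ln_ge0.
have E2 : (y ^+ 2)^-1 = expR (- 2 * ln y).
  by rewrite -{1}(lnK y0) -expRM_natl mulNr expRN.
have e1 : cabs (cpow y (w + h - j%:R)) <= (y ^+ 2)^-1.
  rewrite E2 cabs_cpow ler_expR ler_wpM2r // ReB Rj ReD.
  by have := ler_norm (complex.Re h); lra.
have e2 : cabs (cpow y (w - j%:R)) <= (y ^+ 2)^-1 * (y ^+ 2)^-1.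
  by rewrite E2 cabs_cpow -expRD ler_expR -mulrDl ler_wpM2r // ReB Rj; lra.
have lny : ln y <= y.
  by rewrite -{2}(lnK y0); apply: le_trans (expR_ge1Dx _); lra.
have e3 : cabs (cpow y h - 1) <= 2 * (cabs h * y) * y.
  rewrite cpowE; apply: le_trans (cexp_lip _) _.
  rewrite cabsM cabs_real (ger0_norm ln0) Re_mulreal.
  apply: ler_pM; rewrite ?expR_ge0 ?mulr_ge0 ?cabs_ge0 //.
    by rewrite ler_wpM2l // ler_wpM2l ?cabs_ge0.
  rewrite normrM (ger0_norm ln0) -{2}(lnK y0) ler_expR ler_piMl //; lra.
have -> : pow_tower (w + h) j y - pow_tower w j y =
  (falling j (w + h) - falling j w) * cpow y (w + h - j%:R) +
  falling j w * (cpow y (w - j%:R) * (cpow y h - 1)).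
  rewrite /pow_tower.
  have -> : w + h - j%:R = (w - j%:R) + h by ring.
  by rewrite cpowD; ring.
apply: le_trans (cabsD _ _) _; rewrite !cabsM.
have y2 : y ^+ 2 != 0 by rewrite expf_neq0 // gt_eqF.
have -> : cabs h * ((cabs l + 1 + 2 * B) * (y ^+ 2)^-1) =
  ((cabs l + 1) * cabs h) * (y ^+ 2)^-1 + B * (((y ^+ 2)^-1 * (y ^+ 2)^-1) * (2 * (cabs h * y) * y)).
  by field; rewrite gt_eqF.
apply: lerD; first by apply: ler_pM; rewrite ?cabs_ge0.
by rewrite ler_wpM2l // ler_pM ?cabs_ge0.
Qed.

End PowerTower.

(** * Continuation of the Hurwitz zeta function *)

Section HurwitzContinuation.
Variable R : realType.
Variable q : R.
Hypothesis q0 : 0 < q.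
Implicit Types (w h s L : R[i]) (u v : nat -> R[i]).

Definition seqlim u L := forall e : R, 0 < e -> exists N, forall n, (N <= n)%N ->
  cabs (u n - L) < e.

Lemma seqlim_unique u L L' : seqlim u L -> seqlim u L' -> L = L'.
Proof.
move=> uL uL'; apply/eqP; rewrite -subr_eq0 -cabs_eq0 -normr_le0 ger0_norm ?cabs_ge0 //.
apply/ler_addgt0Pr => e e0; rewrite add0r.
have e2 : 0 < e / 2 by rewrite divr_gt0.
have [N HN] := uL _ e2; have [M HM] := uL' _ e2.
have := HN (N + M)%N (leq_addr _ _); have := HM (N + M)%N (leq_addl _ _).
have := cabs_distD L (u (N + M)%N) L'; rewrite [cabs (L - u _)]cabsB; lra.
Qed.

Lemma seqlimD u v L L' : seqlim u L -> seqlim v L' -> seqlim (fun n => u n + v n) (L + L').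
Proof.
move=> uL vL e e0; have e2 : 0 < e / 2 by rewrite divr_gt0.
have [N HN] := uL _ e2; have [M HM] := vL _ e2.
exists (N + M)%N => n nNM.
have := HN n (leq_trans (leq_addr _ _) nNM); have := HM n (leq_trans (leq_addl _ _) nNM).
have -> : u n + v n - (L + L') = (u n - L) + (v n - L') by ring.
by have := cabsD (u n - L) (v n - L'); lra.
Qed.

Lemma seqlimZ u L (k : R[i]) : seqlim u L -> seqlim (fun n => k * u n) (k * L).
Proof.
move=> uL e e0; have k0 : 0 < cabs k + 1 by rewrite ltr_wpDl ?cabs_ge0.
have [N HN] := uL _ (divr_gt0 e0 k0); exists N => n /HN; rewrite -mulrBr cabsM.
rewrite ltr_pdivlMr // => H; apply: le_lt_trans H.
by rewrite [leRHS]mulrC ler_wpM2r ?cabs_ge0 // lerDl.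
Qed.

Lemma seqlim_cst L : seqlim (fun=> L) L.
Proof. by move=> e e0; exists 0%N => n _; rewrite subrr cabs0. Qed.

Lemma seqlim_sum (I : Type) (r : seq I) (F : I -> nat -> R[i]) (G : I -> R[i]) :
  (forall i, seqlim (F i) (G i)) ->
  seqlim (fun n => \sum_(i <- r) F i n) (\sum_(i <- r) G i).
Proof.
move=> FG; elim: r => [|i r IH].
  by rewrite big_nil; under eq_fun do rewrite big_nil; exact: seqlim_cst.
by rewrite big_cons; under eq_fun do rewrite big_cons; exact: seqlimD.
Qed.

Lemma seqlimP u L : u @ \oo --> L <-> seqlim u L.
Proof.
split=> [/ccvgP H e /H [N _ HN]|H].
  by exists N => n nN; exact: HN.
by apply/ccvgP => e /H [N HN]; exists N => // n; exact: HN.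
Qed.

(** For [w = 1 - s] the first sum contributes [s - 1] times the partial zeta series, and the second
    is the Euler-Maclaurin correction at the end point, which makes the whole converge for any given
    [w] once [K] is large. *)
Definition em_partial K N w : R[i] :=
  - (\sum_(0 <= n < N) pow_tower w 1 (q + n%:R)) +
  \sum_(0 <= j < K.+1) (em_coef R j)%:C%C * pow_tower w j (q + N%:R).

Lemma em_partialS K N w : em_partial K N.+1 w =
  em_partial K N w + em_increment K (pow_tower w) (q + N%:R).
Proof.
rewrite /em_partial /em_increment big_nat_recr //=.
under [X in _ = _ + (_ + X)]eq_bigr do rewrite mulrBr.
have -> : q + N.+1%:R = q + N%:R + 1 by rewrite -natr1 addrA.
by rewrite sumrB; ring.
Qed.

(** The first point [q] may be less than 1, whereas the bounds on [pow_tower] concern arguments at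
    least 1; it is therefore kept apart in [em_partial K 1 w]. *)
Lemma em_partial_sum K M w : em_partial K M.+1 w =
  em_partial K 1 w + \sum_(0 <= n < M) em_increment K (pow_tower w) (q + n.+1%:R).
Proof.
elim: M => [|M IH]; first by rewrite big_nil addr0.
by rewrite em_partialS IH big_nat_recr //= -[in LHS]addrA.
Qed.

(** Telescoping majorant of the inverse squares: [T n - T n.+1 = 2 / ((n + 1) (n + 2))] is at least
    [(n + 1)^(-2)]. *)
Let T (n : nat) : R := 2 / n.+1%:R.

Lemma inv_sq_telescope_ge0 n : 0 <= T n.
Proof. by rewrite divr_ge0. Qed.

Lemma inv_sq_telescope n y : q + n.+1%:R <= y -> (y ^+ 2)^-1 <= T n - T n.+1.
Proof.
move=> qy; have n0 : 0 < n.+1%:R :> R by rewrite ltr0n.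
have ny : n.+1%:R <= y by apply: le_trans qy; rewrite lerDr ltW.
apply: (@le_trans _ _ ((n.+1%:R ^+ 2)^-1)).
  by rewrite lef_pV2 ?posrE ?exprn_gt0 ?(lt_le_trans n0) // lerXn2r ?nnegrE //; lra.
rewrite /T -[n.+2%:R]natr1; set m : R := n.+1%:R in n0 *.
have m1 : 1 <= m by rewrite ler1n.
have -> : 2 / m - 2 / (m + 1) = 2 / (m * (m + 1)) by field; rewrite !gt_eqF //; lra.
rewrite ler_pdivlMr; last by rewrite mulr_gt0 //; lra.
by rewrite mulrC ler_pdivrMr ?exprn_gt0 // expr2; nra.
Qed.

Lemma inv_sq_telescope_vanishing (C : R) : 0 <= C -> vanishing (fun n => C * T n).
Proof.
move=> C0 e e0; exists (Num.truncn (2 * C / e)).+1 => n Nn.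
rewrite /T mulrA ltr_pdivrMr // -ltr_pdivrMl //.
rewrite [_ * (C * 2)]mulrC [C * 2]mulrC; apply: (lt_le_trans (truncnS_gt _)).
by rewrite ler_nat; apply: leq_trans Nn _.
Qed.

Lemma tail_points n y : q + n.+1%:R <= y <= q + n.+1%:R + 1 -> 1 <= y.
Proof.
case/andP => h _; have n1 : 1 <= n.+1%:R :> R by rewrite ler1n.
by apply: (le_trans n1); apply: le_trans h; rewrite lerDr ltW.
Qed.

Lemma em_increment_small K w n : complex.Re w <= K%:R ->
  cabs (em_increment K.+1 (pow_tower w) (q + n.+1%:R)) <=
  2 * em_const R K * cabs (falling K.+2 w) * T n -
  2 * em_const R K * cabs (falling K.+2 w) * T n.+1.
Proof.
move=> wK; rewrite -mulrBr -(mulrA (2 * em_const R K)); apply: em_increment_bound.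
- exact: derivative_tower_pow.
- by rewrite addr_gt0.
- move=> y yq; apply: le_trans (pow_tower_bound _ _) _.
  + exact: tail_points yq.
  + by rewrite -[K.+2]addn2 natrD lerD2r.
  + by rewrite ler_wpM2l ?cabs_ge0 //; apply: inv_sq_telescope; case/andP: yq.
Qed.

Lemma em_const_ge0 K : 0 <= em_const R K.
Proof. by apply: sumr_ge0 => i _. Qed.

Lemma em_partial_cvg K w : complex.Re w <= K%:R ->
  exists L, seqlim (fun N => em_partial K.+1 N w) L.
Proof.
move=> wK; pose C := 2 * em_const R K * cabs (falling K.+2 w).
have C0 : 0 <= C by rewrite !mulr_ge0 ?em_const_ge0 ?cabs_ge0.
have [L HL] := complex_series_dominated
  (fun n => mulr_ge0 C0 (inv_sq_telescope_ge0 n)) (fun n => em_increment_small n wK).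
exists (em_partial K.+1 1 w + L) => e e0.
have [N HN] := inv_sq_telescope_vanishing C0 (divr_gt0 e0 (ltr0Sn _ 1)).
exists N.+1 => -[//|n] nN; rewrite em_partial_sum opprD addrACA subrr add0r cabsB.
by have := HL n; have := HN n nN; rewrite -/C; lra.
Qed.

Lemma pow_tower_tail_vanishing j w : complex.Re w + 2 <= j%:R ->
  seqlim (fun N => pow_tower w j (q + N%:R)) 0.
Proof.
move=> wj e e0; pose C := cabs (falling j w).
have C0 : 0 <= C by exact: cabs_ge0.
have [N HN] := inv_sq_telescope_vanishing C0 e0.
exists N.+1 => -[//|n] nN; rewrite subr0; apply: le_lt_trans (HN n nN).
apply: le_trans (pow_tower_bound _ wj) _; first by apply: (@tail_points n); rewrite lexx lerDl ler01.
rewrite ler_wpM2l //; apply: le_trans (inv_sq_telescope (lexx _)) _.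
by rewrite lerBlDr lerDl inv_sq_telescope_ge0.
Qed.

(** Asking for all large [K] makes the limit independent of the truncation order, so that one
    function [em_fun] is given near each [w] by a single fixed [K]. *)
Definition em_limit w L := exists K0, forall K, (K0 <= K)%N ->
  seqlim (fun N => em_partial K.+1 N w) L.

(** Raising the order adds one derivative at the end point [q + N], of an order high enough to tend
    to 0. *)
Lemma em_limit_stable K w L : complex.Re w <= K%:R ->
  seqlim (fun N => em_partial K.+1 N w) L -> forall k,
  seqlim (fun N => em_partial (K + k).+1 N w) L.
Proof.
move=> wK HL; elim=> [|k IH]; first by rewrite addn0.
rewrite addnS -[L]addr0 -(mulr0 ((em_coef R (K + k).+2)%:C%C)).
have -> : (fun N => em_partial (K + k).+2 N w) = (fun N => em_partial (K + k).+1 N w +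
  (em_coef R (K + k).+2)%:C%C * pow_tower w (K + k).+2 (q + N%:R)).
  by apply/funext => N; rewrite /em_partial [in LHS]big_nat_recr //= addrA.
apply: seqlimD => //; apply: seqlimZ; apply: pow_tower_tail_vanishing.
by rewrite -[(K + k).+2]addn2 natrD lerD2r (le_trans wK) // ler_nat leq_addr.
Qed.

(* The entire function (s - 1) zeta(s; q), in the variable w = 1 - s. *)
Definition em_fun w : R[i] := get (em_limit w).

Lemma em_funP K w : complex.Re w <= K%:R ->
  seqlim (fun N => em_partial K.+1 N w) (em_fun w).
Proof.
move=> wK; have [L HL] := em_partial_cvg wK.
have lL : em_limit w L.
  by exists K => K' KK'; rewrite -(subnKC KK'); exact: em_limit_stable.
have [K0 HK0] : em_limit w (em_fun w) by exact: getPex (ex_intro _ L lL).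
have h1 := HK0 (K + K0)%N (leq_addl _ _).
have h2 := em_limit_stable wK HL K0.
by rewrite (seqlim_unique h1 h2).
Qed.

Lemma Re_nat (n : nat) : complex.Re (n%:R : R[i]) = n%:R.
Proof. by rewrite -(rmorph_nat (real_complex R)). Qed.

Lemma cdiff_em_fun w : cdifferentiable em_fun w.
Proof.
(* Large enough that one [K] serves every [w + h] with [cabs h < 1] and leaves the margin 4 that
   [pow_tower_lip] wants at order [K.+2]. *)
pose K := (Num.truncn `|complex.Re w|).+4.
have wK : complex.Re w + 3 <= K%:R.
  have -> : K%:R = (Num.truncn `|complex.Re w|).+1%:R + 3 :> R by rewrite -natrD addn3.
  rewrite lerD2r; apply: le_trans (ler_norm _) _.
  exact/ltW/truncnS_gt.
have [d d0 [C [C0 HC]]] := pow_tower_lip w K.+2.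
have h4 : complex.Re w + 4 <= K.+2%:R by rewrite -[K.+2]addn2 natrD; lra.
pose B := 2 * em_const R K * C.
have B0 : 0 <= B by rewrite !mulr_ge0 ?em_const_ge0.
have near_w h : cabs h < 1 -> complex.Re (w + h) <= K%:R.
  move=> h1; have := le_Re_cabs h; have := ler_norm (complex.Re h).
  have -> : complex.Re (w + h) = complex.Re w + complex.Re h.
    by case: (w) (h) => [? ?] [? ?].
  lra.
have -> : em_fun = (fun z => em_partial K.+1 1 z + (em_fun z - em_partial K.+1 1 z)).
  by apply/funext => v; rewrite subrKC.
apply: cdiffD.
  apply: cdiffD.
    by apply: cdiffN; apply: cdiff_sum => n; exact: cdiff_pow_tower.
  by apply: cdiff_sum => n; apply: cdiff_mull; exact: cdiff_pow_tower.
apply: (@cdiff_series _ (fun n z => em_increment K.+1 (pow_tower z) (q + n.+1%:R)) _ w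
   (fun n => B * T n) (Num.min d 1)).
- by rewrite lt_min d0 ltr01.
- by move=> n; rewrite mulr_ge0 ?inv_sq_telescope_ge0.
- exact: inv_sq_telescope_vanishing.
- move=> n; apply: cdiffD; first by apply: cdiffN; exact: cdiff_pow_tower.
  apply: cdiff_sum => j; apply: cdiff_mull; apply: cdiffD; first exact: cdiff_pow_tower.
  by apply: cdiffN; exact: cdiff_pow_tower.
- move=> n h; rewrite lt_min => /andP[hd h1].
  rewrite -mulrBr -em_incrementB.
  have -> : cabs h * (B * (T n - T n.+1)) =
    2 * em_const R K * (cabs h * (C * (T n - T n.+1))) by rewrite /B; ring.
  apply: em_increment_bound.
  + by apply: derivative_towerB; exact: derivative_tower_pow.
  + by rewrite addr_gt0.
  + move=> y yq; apply: le_trans (HC h y hd (tail_points yq) h4) _.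
    rewrite ler_wpM2l ?cabs_ge0 // ler_wpM2l //.
    by apply: inv_sq_telescope; case/andP: yq.
- move=> h; rewrite lt_min => /andP[_ /near_w wh] e e0.
  have [N HN] := em_funP wh e0; exists N => n nN.
  have := HN n.+1 (leq_trans nN (leqnSn n)).
  by rewrite em_partial_sum cabsB opprD addrA.
Qed.

(** At [w = 0] the function [x^w] is constantly 1: all derivatives vanish and only the term of order
    0 remains. The value is the residue of zeta at 1. *)
Lemma em_fun0 : em_fun 0 = 1.
Proof.
have h : complex.Re (0 : R[i]) <= 0%:R by rewrite /= lexx.
apply: (seqlim_unique (em_funP h)).
have tower0 j x : pow_tower (0 : R[i]) j.+1 x = 0.
  by rewrite /pow_tower /falling big_nat_recl // subrr !mul0r.
have -> : (fun N => em_partial 1 N 0) = fun=> 1.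
  apply/funext => N; rewrite /em_partial big1 => [|i _]; last exact: tower0.
  rewrite oppr0 add0r big_nat_recl // big_nat1 tower0 mulr0 addr0 em_coef0 mul1r.
  by rewrite /pow_tower /falling big_nil subr0 cpow0 mulr1.
exact: seqlim_cst.
Qed.

Lemma em_fun_series s : 1 < complex.Re s ->
  seqlim (hurwitz_partial q s) (em_fun (1 - s) / (s - 1)).
Proof.
move=> s1; set w := 1 - s.
have rw : complex.Re w < 0.
  by rewrite /w ReB /=; lra.
have s10 : s - 1 != 0.
  by rewrite subr_eq0; apply: contraTneq s1 => ->; rewrite /= ltxx.
have tow j : seqlim (fun N => pow_tower w j (q + N%:R)) 0.
  pose sg := complex.Re w - j%:R.
  have sg0 : sg < 0.
    by rewrite /sg; have : 0 <= j%:R :> R by []; lra.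
  move=> e e0; have C0 : 0 < cabs (falling j w) + 1 by rewrite ltr_wpDl ?cabs_ge0.
  (* Solves [(cabs (falling j w) + 1) * n^sg < e] for [n], with [sg < 0]. *)
  exists (Num.truncn (expR (ln (e / (cabs (falling j w) + 1)) / sg))).+1 => n nN.
  rewrite subr0 /pow_tower cabsM cabs_cpow ReB Re_nat -/sg.
  have x0 : 0 < q + n%:R by rewrite ltr_wpDr.
  apply: (@le_lt_trans _ _ ((cabs (falling j w) + 1) * expR (sg * ln (q + n%:R)))).
    by rewrite ler_wpM2r ?expR_ge0 // lerDl.
  rewrite -ltr_pdivlMl // [ltRHS]mulrC -[ltRHS]lnK ?posrE ?divr_gt0 // ltr_expR.
  rewrite [ltLHS]mulrC -ltr_ndivrMr // -ltr_expR [ltRHS]lnK ?posrE //.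
  apply: (lt_le_trans (truncnS_gt _)).
  by apply: (@le_trans _ _ n%:R); rewrite ?ler_nat // lerDr ltW.
have rw0 : complex.Re w <= 0%:R by exact: ltW.
have := seqlimD (em_funP rw0) (seqlim_sum (index_iota 0 2)
  (fun j => seqlimZ (- (em_coef R j)%:C%C) (tow j))).
rewrite [X in seqlim _ (_ + X)]big1 ?addr0 => [|i _]; last by rewrite mulr0.
move/(seqlimZ (s - 1)^-1); rewrite mulrC.
congr seqlim; apply/funext => N; rewrite /em_partial.
under [X in _ + _ + X]eq_bigr do rewrite mulNr.
rewrite sumrN addrK /hurwitz_partial -sumrN mulr_sumr; apply: eq_bigr => n _.
rewrite /pow_tower /falling big_nat1 subr0.
have -> : w - 1%:R = - s by rewrite /w; ring.
by rewrite /w -mulNr opprB mulKf.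
Qed.

Lemma hurwitz_zeta_exists : exists H : R[i] -> R[i],
  (forall s : R[i], s != 1 -> cdifferentiable H s) /\
  (forall s : R[i], 1 < complex.Re s -> hurwitz_partial q s @ \oo --> H s).
Proof.
exists (fun s => em_fun (1 - s) / (s - 1)); split=> s s1.
  apply: cdiffM.
    apply: (@cdiff_comp _ (fun s => 1 - s)); last exact: cdiff_em_fun.
    by apply: cdiffD; [exact: cdiff_cst | apply: cdiffN; exact: cdiff_id].
  apply: (@cdiff_comp _ (fun s => s - 1)).
    by apply: cdiffD; [exact: cdiff_id | exact: cdiff_cst].
  by apply: cdiffV; rewrite subr_eq0.
by apply/seqlimP; exact: em_fun_series.
Qed.

Lemma cdiff_hurwitz_zeta s : s != 1 -> cdifferentiable (hurwitz_zeta q) s.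
Proof. by have [+ _] := getPex hurwitz_zeta_exists; apply. Qed.

Lemma hurwitz_zeta_series s : 1 < complex.Re s ->
  seqlim (hurwitz_partial q s) (hurwitz_zeta q s).
Proof.
by have [_ +] := getPex hurwitz_zeta_exists => H /H /seqlimP.
Qed.

Lemma hurwitz_zetaE s : s != 1 -> hurwitz_zeta q s = em_fun (1 - s) / (s - 1).
Proof.
move=> s1; apply/eqP; rewrite -subr_eq0; apply/eqP.
apply: (@half_plane_uniqueness _ (fun s => hurwitz_zeta q s - em_fun (1 - s) / (s - 1))) => //.
- move=> t t1; apply: cdiffD; first exact: cdiff_hurwitz_zeta.
  apply: cdiffN; apply: cdiffM.
    apply: (@cdiff_comp _ (fun s => 1 - s)); last exact: cdiff_em_fun.
    by apply: cdiffD; [exact: cdiff_cst | apply: cdiffN; exact: cdiff_id].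
  apply: (@cdiff_comp _ (fun s => s - 1)).
    by apply: cdiffD; [exact: cdiff_id | exact: cdiff_cst].
  by apply: cdiffV; rewrite subr_eq0.
- move=> t t1; apply/eqP; rewrite subr_eq0; apply/eqP.
  exact: seqlim_unique (hurwitz_zeta_series t1) (em_fun_series t1).
Qed.

Lemma hurwitz_zeta_residue : (fun s => (s - 1) * hurwitz_zeta q s) @ (1 : R[i])^' --> (1 : R[i]).
Proof.
apply/ccvgP => e e0; apply/dnbhsCP.
have [d d0 Hd] := cdiff_continuous (cdiff_em_fun 0) e0.
exists d => // y y1 yd; rewrite hurwitz_zetaE // mulrCA divff ?subr_eq0 // mulr1.
have h : cabs (1 - y - 0) < d by rewrite subr0 cabsB.
by have := Hd _ h; rewrite em_fun0.
Qed.

End HurwitzContinuation.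

(** * Closed walks of nearly minimal length in a homology class *)

Section GraphWalks.
Variables (V E : finType) (src tgt : E -> V).
Implicit Types (th : {ffun E -> int}) (w c : seq (E * bool)) (u v : V).

Local Notation ostart := (ostart src tgt).
Local Notation oend := (oend src tgt).

Definition l1norm th : nat := (\sum_e `|th e|)%N.

(** Explicit end points, unlike the cyclic condition of [closed_walk], allow walks to be cut and
    spliced. *)
Fixpoint walk u w v : bool :=
  if w is x :: w' then (ostart x == u) && walk (oend x) w' v else u == v.

Definition endpoint u w : V := last u (map oend w).

Lemma walk_endpoint u w v : walk u w v -> endpoint u w = v.
Proof. by elim: w u => [|x w IH] u /=; [move/eqP | case/andP => _ /IH]. Qed.

Lemma walk_cat u w1 w2 v :
  walk u (w1 ++ w2) v = walk u w1 (endpoint u w1) && walk (endpoint u w1) w2 v.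
Proof.
elim: w1 u => [|x w1 IH] u /=; first by rewrite eqxx.
by rewrite IH andbA.
Qed.

Lemma walk_split u w v m : walk u w v -> m \in u :: map oend w ->
  exists w1 w2, [/\ w = w1 ++ w2, walk u w1 m & walk m w2 v].
Proof.
elim: w u => [|x w IH] u /=.
  by move=> uv; rewrite inE => /eqP ->; exists [::], [::]; rewrite /= eqxx uv.
move=> /andP[xu wv]; rewrite inE => /predU1P[->|/(IH _ wv)].
  by exists [::], (x :: w); rewrite /= eqxx xu wv.
by move=> [w1 [w2 [-> h1 h2]]]; exists (x :: w1), w2; rewrite /= xu h1.
Qed.

Lemma walk_closed u w : walk u w u -> closed_walk src tgt w.
Proof.
case: w => // x w /= /andP[/eqP <-]; rewrite /closed_walk /=.
move: {1 3}x => z; elim: w z => [|y w IH] z /=; first by move=> ->.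
by case/andP => /eqP <- /IH ->; rewrite eqxx.
Qed.

Definition arc_class (x : E * bool) : {ffun E -> int} :=
  [ffun e => if x.1 == e then (if x.2 then 1 else -1) else 0].

Lemma walk_class_nil : walk_class [::] = 0 :> {ffun E -> int}.
Proof. by apply/ffunP => e; rewrite !ffunE big_nil. Qed.

Lemma walk_class_cons x w : walk_class (x :: w) = arc_class x + walk_class w.
Proof. by apply/ffunP => e; rewrite !ffunE big_cons. Qed.

Lemma walk_class_cat w1 w2 : walk_class (w1 ++ w2) = walk_class w1 + walk_class w2.
Proof. by apply/ffunP => e; rewrite !ffunE big_cat. Qed.

Definition bound th v : int := \sum_(e | tgt e == v) th e - \sum_(e | src e == v) th e.

Lemma icycleP th : icycle src tgt th <-> forall v, bound th v = 0.
Proof.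
split=> H v; first by rewrite /bound H subrr.
by apply/eqP; rewrite -subr_eq0; apply/eqP; exact: H.
Qed.

Lemma boundD th th' v : bound (th + th') v = bound th v + bound th' v.
Proof.
rewrite /bound; under eq_bigr do rewrite ffunE.
under [X in _ - X]eq_bigr do rewrite ffunE.
by rewrite !big_split /= opprD addrACA.
Qed.

Lemma boundN th v : bound (- th) v = - bound th v.
Proof.
rewrite /bound; under eq_bigr do rewrite ffunE.
under [X in _ - X]eq_bigr do rewrite ffunE.
by rewrite !sumrN opprB opprK addrC.
Qed.

Lemma sum_arc_class (f : E -> V) x v :
  \sum_(e | f e == v) arc_class x e = (f x.1 == v)%:R * (if x.2 then 1 else -1).
Proof.
have [fx|fx] := boolP (f x.1 == v); rewrite ?mul1r ?mul0r.
  rewrite (bigD1 x.1) //= ffunE eqxx big1 ?addr0 // => e /andP[_ ex].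
  by rewrite ffunE eq_sym (negbTE ex).
rewrite big1 // => e fe; rewrite ffunE; case: eqP => // xe.
by rewrite -xe (negbTE fx) in fe.
Qed.

Lemma bound_arc x v : bound (arc_class x) v = (oend x == v)%:R - (ostart x == v)%:R.
Proof.
rewrite /bound !sum_arc_class /oend /ostart; case: x => e [] /=; ring.
Qed.

Lemma bound_walk u w v m : walk u w v -> bound (walk_class w) m = (v == m)%:R - (u == m)%:R.
Proof.
elim: w u => [|x w IH] u /=.
  move=> /eqP ->; rewrite subrr walk_class_nil /bound !big1 ?subrr // => e _;
  by rewrite ffunE.
by case/andP => /eqP <- /IH E1; rewrite walk_class_cons boundD E1 bound_arc; ring.
Qed.

Lemma icycleD th th' : icycle src tgt th -> icycle src tgt th' -> icycle src tgt (th + th').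
Proof. by move=> /icycleP h /icycleP h'; apply/icycleP => v; rewrite boundD h h' addr0. Qed.

Lemma icycleN th : icycle src tgt th -> icycle src tgt (- th).
Proof. by move=> /icycleP h; apply/icycleP => v; rewrite boundN h oppr0. Qed.

Lemma icycle_walk u w : walk u w u -> icycle src tgt (walk_class w).
Proof. by move=> h; apply/icycleP => v; rewrite (bound_walk _ h) subrr. Qed.

Lemma l1normD th th' : (l1norm (th + th')%R <= l1norm th + l1norm th')%N.
Proof.
rewrite /l1norm -big_split /=; apply: leq_sum => e _; rewrite ffunE.
by rewrite -lez_nat PoszD !abszE ler_normD.
Qed.

Lemma l1normN th : l1norm (- th) = l1norm th.
Proof. by apply: eq_bigr => e _; rewrite ffunE abszN. Qed.

Lemma l1norm_eq0 th : (l1norm th == 0)%N = (th == 0).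
Proof.
rewrite sum_nat_eq0; apply/forallP/eqP => [H|-> e]; last by rewrite ffunE.
by apply/ffunP => e; have := H e; rewrite /= absz_eq0 ffunE => /eqP.
Qed.

Lemma l1norm_walk w : (l1norm (walk_class w) <= size w)%N.
Proof.
elim: w => [|x w IH]; first by rewrite walk_class_nil leqn0 l1norm_eq0.
rewrite walk_class_cons; apply: leq_trans (l1normD _ _) _.
rewrite /= -add1n leq_add // /l1norm (bigD1 x.1) //= big1.
  by rewrite addn0 ffunE eqxx; case: (x.2).
by move=> e ex; rewrite ffunE eq_sym (negbTE ex).
Qed.

(** The arc follows the flow [th], so that removing it lowers the [l1] norm by 1. *)
Definition conformal th (x : E * bool) : bool := if x.2 then 0 < th x.1 else th x.1 < 0.

(** If no conformal arc left the end of [x], the incoming sum there would have nonnegative terms and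
    the outgoing sum nonpositive ones. Conservation would make all of them vanish, against [x]
    itself. *)
Lemma conformal_next th x : icycle src tgt th -> conformal th x ->
  exists y, conformal th y && (ostart y == oend x).
Proof.
move=> cyc cx; apply/existsP; apply: contraT; rewrite negb_exists => /forallP H.
set v := oend x in H.
have out e : src e == v -> th e <= 0.
  by move=> ev; have := H (e, true); rewrite /conformal /ostart /= ev andbT -leNgt.
have inn e : tgt e == v -> 0 <= th e.
  by move=> ev; have := H (e, false); rewrite /conformal /ostart /= ev andbT -leNgt.
have S1 : 0 <= \sum_(e | tgt e == v) th e by apply: sumr_ge0 => e; exact: inn.
have S2 : \sum_(e | src e == v) th e <= 0 by apply: sumr_le0 => e; exact: out.
have S1' : \sum_(e | tgt e == v) th e = 0.
  by apply/eqP; rewrite eq_le S1 andbT cyc.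
have S2' : \sum_(e | src e == v) - th e = 0 by rewrite sumrN -cyc S1' oppr0.
move: cx; rewrite /conformal; case: x @v {H} out inn S1 S2 S1' S2' => e [] v out inn _ _ S1 S2 /=.
  have /eqP := S1; rewrite psumr_eq0 // => /allP /(_ e).
  by rewrite mem_index_enum /v eqxx /= => /(_ isT) /eqP ->; rewrite ltxx.
have /eqP := S2; rewrite psumr_eq0 => [/allP /(_ e)|e' /out]; last by rewrite oppr_ge0.
by rewrite mem_index_enum /v eqxx /= oppr_eq0 => /(_ isT) /eqP ->; rewrite ltxx.
Qed.

Lemma l1norm_sub_conformal c th : uniq (map fst c) -> all (conformal th) c ->
  (l1norm (th - walk_class c)%R + size c = l1norm th)%N.
Proof.
elim: c th => [|x c IH] th /=; first by rewrite walk_class_nil subr0 addn0.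
move=> /andP[xc uc] /andP[cx cc].
have cc' : all (conformal (th - arc_class x)) c.
  apply/allP => y yc; have := allP cc y yc; rewrite /conformal !ffunE.
  have -> : (x.1 == y.1) = false.
    by apply: contraNF xc => /eqP ->; apply: map_f.
  by rewrite subr0.
have := IH _ uc cc'; rewrite walk_class_cons opprD addrA addnS => ->.
rewrite /l1norm (bigD1 x.1) //= [in RHS](bigD1 x.1) //= -addSn; congr (_ + _)%N.
  by rewrite !ffunE eqxx; move: cx; rewrite /conformal; move: (th x.1) => a; case: (x.2) => ?; lia.
by apply: eq_bigr => e ex; rewrite !ffunE eq_sym (negbTE ex) subr0.
Qed.

(** Following successors given by [conformal_next] must loop in the finite set of arcs. The loop has
    distinct arcs, hence distinct edges, since only one orientation of an edge is conformal. *)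
Lemma conformal_cycle th : icycle src tgt th -> th != 0 ->
  exists u c, [/\ walk u c u, c != [::], uniq (map fst c) & all (conformal th) c].
Proof.
move=> cyc th0.
have [x0 cx0] : exists x, conformal th x.
  have [e he] : exists e, th e != 0.
    apply/existsP; apply: contraNT th0; rewrite negb_exists => /forallP H.
    by apply/eqP/ffunP => e; rewrite ffunE; apply/eqP; rewrite -[_ == _]negbK.
  by have := he; rewrite neq_lt => /orP[h|h]; [exists (e, false)|exists (e, true)].
pose f x := odflt x [pick y | conformal th y && (ostart y == oend x)].
have fP x : conformal th x -> conformal th (f x) /\ ostart (f x) = oend x.
  move=> cx; rewrite /f; case: pickP => [y /andP[? /eqP]//|H].
  by have [y] := conformal_next cyc cx; rewrite H.
have cI n x : conformal th x -> conformal th (iter n f x).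
  by move=> cx; elim: n => //= n IH; have [] := fP _ IH.
have W k x : conformal th x -> walk (ostart x) (traject f x k) (ostart (iter k f x)).
  elim: k x => [|k IH] x cx; first by rewrite /= eqxx.
  have [cfx sfx] := fP x cx.
  by rewrite trajectS iterSr /= eqxx -sfx; exact: IH.
have := looping_order f x0; rewrite /looping => /trajectP [i io Ei].
set y := iter i f x0; pose k := (order f x0 - i)%N.
have k0 : (0 < k)%N by rewrite subn_gt0.
have Ek : iter k f y = y by rewrite /y -iterD subnK ?(ltnW io).
have cy : conformal th y by exact: cI.
exists (ostart y), (traject f y k); split.
- by rewrite -{3}Ek; exact: W.
- by rewrite -size_eq0 size_traject -lt0n.
- have u0 : uniq (traject f y k).
    have := orbit_uniq f x0; rewrite /orbit.
    by rewrite -(subnKC (ltnW io)) trajectD cat_uniq => /and3P[].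
  rewrite map_inj_in_uniq // => -[e a] [e' a'] /trajectP [n1 _ ->] /trajectP [n2 _ ->] E12.
  move: (cI n1 y cy) (cI n2 y cy) E12; rewrite /conformal.
  case: (iter n1 f y) (iter n2 f y) => [p1 p2] [p1' p2'] /= + + pp; rewrite -pp.
  by case: p2 p2' => [] [] h1 h2 //; have := lt_trans h1 h2; rewrite ltxx.
- by apply/allP => z /trajectP [n _ ->]; exact: cI.
Qed.

(** A conformal cycle is spliced in at a vertex that the walk already visits; the length it adds is
    exactly the norm it removes from [th]. *)
Lemma absorb_cycle n th u w : (l1norm th <= n)%N -> icycle src tgt th -> walk u w u ->
  (forall v, v \in u :: map oend w) ->
  exists w', [/\ walk u w' u, walk_class w' = walk_class w + th &
    size w' = (size w + l1norm th)%N].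
Proof.
elim: n th w => [|n IH] th w hn cyc wu vis.
  move: hn; rewrite leqn0 => h0; have := h0; rewrite l1norm_eq0 => /eqP th0.
  by exists w; rewrite (eqP h0) th0 addr0 addn0.
have [->|th0] := eqVneq th 0.
  exists w; have /eqP -> : (l1norm (0%R : {ffun E -> int}) == 0)%N by rewrite l1norm_eq0.
  by rewrite addr0 addn0.
have [m [c [wc c0 uc cc]]] := conformal_cycle cyc th0.
have E1 := l1norm_sub_conformal uc cc.
have [w1 [w2 [Ew h1 h2]]] := walk_split wu (vis m).
have wu' : walk u (w1 ++ c ++ w2) u.
  by rewrite !walk_cat (walk_endpoint h1) h1 (walk_endpoint wc) wc h2.
have [||v|w' [h3 h4 h5]] := IH (th - walk_class c) (w1 ++ c ++ w2) _ _ wu' _.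
- by rewrite -ltnS (leq_trans _ hn) // -E1 -addn1 leq_add2l lt0n size_eq0.
- by apply: icycleD => //; apply: icycleN; exact: icycle_walk wc.
- have := vis v; rewrite Ew !map_cat !inE !mem_cat.
  by case/or3P => ->; rewrite ?orbT.
exists w'; split=> //.
  rewrite h4 Ew !walk_class_cat.
  by apply/ffunP => e; rewrite !ffunE; ring.
by rewrite h5 Ew !size_cat; lia.
Qed.

Hypothesis conn : graph_connected src tgt.

Lemma connecting_walk u v : exists w, walk u w v.
Proof.
have /connectP [p pp ->] := conn u v.
elim: p u pp => [|x p IH] u /=; first by exists [::]; rewrite /= eqxx.
move=> /andP[/existsP [e he] /IH [w hw]].
case/orP: he => /andP[/eqP h1 /eqP h2].
  by exists ((e, true) :: w); rewrite /= /ostart /oend /= h1 h2 eqxx.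
by exists ((e, false) :: w); rewrite /= /ostart /oend /= h1 h2 eqxx.
Qed.

Lemma covering_walk u : exists2 w, walk u w u & forall v, v \in u :: map oend w.
Proof.
suff [w hw H] : exists2 w, walk u w u & forall v, v \in enum V -> v \in u :: map oend w.
  by exists w => // v; apply: H; rewrite mem_enum.
elim: (enum V) => [|x vs [w hw H]]; first by exists [::]; rewrite /= ?eqxx.
have [p hp] := connecting_walk u x; have [p' hp'] := connecting_walk x u.
exists (p ++ p' ++ w).
  by rewrite !walk_cat (walk_endpoint hp) hp (walk_endpoint hp') hp' hw.
move=> v; rewrite inE => /predU1P[->|/H].
  rewrite -(walk_endpoint hp) /endpoint.
  have := mem_last u (map oend p); rewrite !inE map_cat mem_cat.
  by case/orP => ->; rewrite ?orbT.
by rewrite !inE !map_cat !mem_cat => /orP[] ->; rewrite ?orbT.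
Qed.

Lemma short_closed_walk : exists C : nat, forall th, icycle src tgt th ->
  exists w, [/\ closed_walk src tgt w, walk_class w = th & (size w <= l1norm th + C)%N].
Proof.
have [u _|V0] := pickP (fun _ : V => true); last first.
  exists 0%N => th _; exists [::]; split => //.
  by apply/ffunP => e; have := V0 (src e).
have [w hw vis] := covering_walk u.
(* One [size w] is the covering walk itself, the other bounds the norm of its class, which has to be
   subtracted from [th]. *)
exists (size w + size w)%N => th cyc.
have cyc' : icycle src tgt (th - walk_class w).
  by apply: icycleD => //; apply: icycleN; exact: icycle_walk hw.
have [w' [h1 h2 h3]] := absorb_cycle (leqnn _) cyc' hw vis.
exists w'; split; [exact: walk_closed h1 | by rewrite h2 addrC subrK |].
rewrite h3; have := l1normD th (- walk_class w); rewrite l1normN.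
by have := l1norm_walk w; lia.
Qed.

End GraphWalks.

(** * Identification of the stable norm *)

Section StableNorm.
Variables (R : realType) (V E : finType) (src tgt : E -> V).
Hypothesis conn : graph_connected src tgt.
Implicit Types (th : {ffun E -> int}).

Lemma l1norm_iscale n th : l1norm (iscale n th) = (n * l1norm th)%N.
Proof.
rewrite /l1norm big_distrr /=; apply: eq_bigr => e _.
by rewrite ffunE abszM mulnC.
Qed.

Lemma icycle_iscale n th : icycle src tgt th -> icycle src tgt (iscale n th).
Proof.
move=> cyc v; under eq_bigr do rewrite ffunE; under [RHS]eq_bigr do rewrite ffunE.
by rewrite -!mulr_suml cyc.
Qed.

Lemma lmin_bounds : exists C : nat, forall th, icycle src tgt th ->
  (l1norm th)%:R <= (lmin src tgt th : R) <= (l1norm th)%:R + C%:R.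
Proof.
have [C HC] := short_closed_walk conn; exists C => th cyc.
have [w [h1 h2 h3]] := HC th cyc.
have lb (x : R) : (exists w, closed_walk src tgt w /\ walk_class w = th /\ x = (size w)%:R) ->
  (l1norm th)%:R <= x :> R.
  by move=> [w' [_ [<- ->]]]; rewrite ler_nat l1norm_walk.
apply/andP; split.
  by apply: lb_le_inf; [exists (size w)%:R, w | move=> x /lb].
apply: (@le_trans _ _ (size w)%:R); last by rewrite -natrD ler_nat.
by apply: ge_inf; [exists (l1norm th)%:R => x /lb | exists w].
Qed.

(** The excess [C] of [lmin_bounds] is the same for all multiples of [th], so it disappears after
    division by [n]. *)
Lemma stnormE th : icycle src tgt th -> stnorm src tgt th = (l1norm th)%:R :> R.
Proof.
move=> cyc; have [C HC] := lmin_bounds.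
apply/cvg_lim => //; apply/cvgrPdist_lt => e e0.
exists (Num.truncn (C%:R / e)).+1 => // n /= Cn.
have n0 : 0 < n%:R :> R by rewrite ltr0n; apply: leq_trans Cn.
have := HC _ (icycle_iscale n cyc); rewrite l1norm_iscale natrM.
set x := lmin _ _ _; set l := (l1norm th)%:R => /andP[x1 x2].
rewrite distrC; have -> : x / n%:R - l = (x - n%:R * l) / n%:R by field; rewrite gt_eqF.
rewrite ger0_norm; last by rewrite divr_ge0 ?subr_ge0 // ltW.
rewrite ltr_pdivrMr //; apply: (@le_lt_trans _ _ C%:R); first by lra.
rewrite mulrC -ltr_pdivrMr //; apply: (lt_le_trans (truncnS_gt _)).
by rewrite ler_nat.
Qed.

Definition l1 (f : E -> R) : R := \sum_e `|f e|.

Lemma l1_intr th : l1 (fun e => (th e)%:~R) = (l1norm th)%:R.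
Proof.
rewrite /l1 /l1norm natr_sum; apply: eq_bigr => e _.
by rewrite -intr_norm -abszE.
Qed.

Lemma l1_dist (f g : E -> R) : `|l1 f - l1 g| <= l1 (fun e => f e - g e).
Proof.
rewrite /l1 -sumrB; apply: le_trans (ler_norm_sum _ _ _) _.
by apply: ler_sum => e _; exact: ler_dist_dist.
Qed.

Lemma stnormR_exists : stnormR_spec src tgt l1.
Proof.
split; first by move=> th cyc; rewrite l1_intr stnormE.
split=> [th t _ t0|th _ eps eps0].
  by rewrite /l1 mulr_sumr; apply: eq_bigr => e _; rewrite normrM ger0_norm.
pose M : R := #|E|%:R + 1.
have M0 : 0 < M by rewrite ltr_wpDl.
exists (eps / M); first exact: divr_gt0.
move=> th' _ H; apply: le_lt_trans (l1_dist _ _) _.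
apply: (@le_lt_trans _ _ (\sum_(e : E) eps / M)).
  by apply: ler_sum => e _; exact: ltW.
rewrite sumr_const -mulr_natr mulrAC ltr_pdivrMr // ltr_pM2l // /M.
by rewrite ltrDl.
Qed.

Variables (b : nat) (gamma : 'I_b -> {ffun E -> int}).
Hypothesis cyc_gamma : forall i, icycle src tgt (gamma i).

Definition real_combination (t : nat -> R) (e : E) : R := \sum_(i < b) t i * (gamma i e)%:~R.

Definition int_combination (c : nat -> int) : {ffun E -> int} :=
  [ffun e => \sum_(i < b) c i * gamma i e].

Lemma icycle_int_combination c : icycle src tgt (int_combination c).
Proof.
move=> v; under eq_bigr do rewrite ffunE; under [RHS]eq_bigr do rewrite ffunE.
rewrite exchange_big [RHS]exchange_big; apply: eq_bigr => i _ /=.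
by rewrite -!mulr_sumr cyc_gamma.
Qed.

Lemma rcycle_real_combination t : rcycle src tgt (real_combination t).
Proof.
move=> v; rewrite /real_combination exchange_big [RHS]exchange_big; apply: eq_bigr => i _ /=.
by rewrite -!mulr_sumr -!rmorph_sum /= cyc_gamma.
Qed.

Lemma real_combination_intr (c : nat -> int) :
  real_combination (fun i => (c i)%:~R) = fun e => (int_combination c e)%:~R.
Proof.
apply/funext => e; rewrite ffunE rmorph_sum /=; apply: eq_bigr => i _.
by rewrite rmorphM.
Qed.

(* Continuity and homogeneity determine the stable norm on real combinations
   through their rational approximations. *)
Lemma stnormR_real_combination t :
  stnormR src tgt (real_combination t) = l1 (real_combination t).
Proof.
have [N1 [N2 N3]] : stnormR_spec src tgt (stnormR src tgt : (E -> R) -> R).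
  by apply: getPex; exists l1; exact: stnormR_exists.
have [_ [_ L3]] := stnormR_exists.
set N := stnormR src tgt in N1 N2 N3 *; set th := real_combination t.
have thr : rcycle src tgt th by exact: rcycle_real_combination.
apply/eqP; rewrite -subr_eq0 -normr_le0; apply/ler_addgt0Pr => e e0; rewrite add0r.
have e20 : 0 < e / 2 by rewrite divr_gt0.
have [d1 d10 H1] := N3 th thr _ e20; have [d2 d20 H2] := L3 th thr _ e20.
(* [M / n] bounds, on every edge, the effect of rounding the coordinates down to multiples of
   [1 / n]; the final 1 makes [M] positive. *)
pose M : R := \sum_e \sum_(i < b) `|(gamma i e)%:~R| + 1.
have S0 : 0 <= \sum_e \sum_(i < b) `|(gamma i e)%:~R| :> R.
  by apply: sumr_ge0 => ? _; apply: sumr_ge0.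
have M0 : 0 < M by rewrite ltr_wpDl.
pose d := Num.min d1 d2; have d0 : 0 < d by rewrite lt_min d10.
pose n := (Num.truncn (M / d)).+1.
have n0 : 0 < n%:R :> R by rewrite ltr0n.
pose c i : int := Num.floor (n%:R * t i).
pose th' := real_combination (fun i => n%:R^-1 * (c i)%:~R).
have close f : `|th' f - th f| < d.
  rewrite /th' /th /real_combination -sumrB; apply: le_lt_trans (ler_norm_sum _ _ _) _.
  apply: (@le_lt_trans _ _ (n%:R^-1 * M)); last first.
    by rewrite mulrC ltr_pdivrMr // mulrC -ltr_pdivrMr //; exact: truncnS_gt.
  apply: (@le_trans _ _ (\sum_(i < b) n%:R^-1 * `|(gamma i f)%:~R|)).
    apply: ler_sum => i _; rewrite -mulrBl normrM ler_wpM2r //.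
    have -> : n%:R^-1 * (c i)%:~R - t i = - (n%:R^-1 * (n%:R * t i - (c i)%:~R)).
      by field; rewrite gt_eqF.
    rewrite normrN normrM ger0_norm ?invr_ge0 ?(ltW n0) // ler_piMr ?invr_ge0 ?(ltW n0) //.
    have /andP[f1 f2] := floor_itv (n%:R * t i).
    rewrite intrD /= in f2; rewrite -/(c i) in f1 f2.
    by rewrite ger0_norm; lra.
  rewrite -mulr_sumr ler_wpM2l ?invr_ge0 ?(ltW n0) // /M (bigD1 f) //= -addrA lerDl.
  by rewrite addr_ge0 // sumr_ge0 // => ? _; apply: sumr_ge0.
have th'r : rcycle src tgt th' by exact: rcycle_real_combination.
have {}H1 : `|N th' - N th| < e / 2.
  by apply: H1 => // f; apply: lt_le_trans (close f) _; rewrite ge_min lexx.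
have {}H2 : `|l1 th' - l1 th| < e / 2.
  by apply: H2 => // f; apply: lt_le_trans (close f) _; rewrite ge_min lexx orbT.
have E' : th' = fun f => n%:R^-1 * (int_combination c f)%:~R.
  rewrite -/(real_combination _); apply/funext => f.
  have := congr1 (fun g => g f) (real_combination_intr c) => /= <-.
  by rewrite /th' /real_combination mulr_sumr; apply: eq_bigr => i _; rewrite mulrA.
have cr : rcycle src tgt (fun f => (int_combination c f)%:~R : R).
  by rewrite -real_combination_intr; exact: rcycle_real_combination.
have ni : 0 <= n%:R^-1 :> R by rewrite invr_ge0 ltW.
have EN : N th' = l1 th'.
  rewrite E' N2 // N1; last exact: icycle_int_combination.
  have [L1 [L2 _]] := stnormR_exists.
  by rewrite L2 // L1 //; exact: icycle_int_combination.
have -> : N th - l1 th = (l1 th' - l1 th) - (N th' - N th) by rewrite EN; ring.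
apply: le_trans (ler_normB _ _) _; lra.
Qed.

End StableNorm.

(** * Quasi-polynomials and their antidifferences *)

Section QuasiPolynomials.

(** The value at 0 is exceptional for the counts: the empty product of series counts 1 at 0 and 0 at
    every positive [n]. It is left free. *)
Definition quasi_poly (f : nat -> rat) : Prop := exists2 m, (0 < m)%N &
  exists Q : nat -> {poly rat}, forall n, (0 < n)%N -> f n = (Q (n %% m)%N).[n%:R].

Lemma quasi_poly_eq f g : (forall n, (0 < n)%N -> f n = g n) -> quasi_poly f -> quasi_poly g.
Proof. by move=> fg [m m0 [Q HQ]]; exists m => //; exists Q => n n0; rewrite -fg ?HQ. Qed.

Lemma quasi_poly_const k : quasi_poly (fun=> k).
Proof. by exists 1%N => //; exists (fun=> k%:P) => n _; rewrite hornerC. Qed.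

Lemma quasi_polyD f g : quasi_poly f -> quasi_poly g -> quasi_poly (fun n => f n + g n).
Proof.
move=> [m m0 [Q HQ]] [m' m'0 [Q' HQ']]; exists (m * m')%N; first by rewrite muln_gt0 m0.
exists (fun r => Q (r %% m)%N + Q' (r %% m')%N) => n n0.
rewrite hornerD HQ // HQ' // modn_dvdm ?dvdn_mulr // modn_dvdm //.
exact: dvdn_mull.
Qed.

(** The top term of [(x + M)^(k+1) - x^(k+1)] is [(k + 1) M x^k], and the lower powers already have
    antidifferences by induction. *)
Lemma poly_antidifference (M : nat) (P : {poly rat}) : (0 < M)%N ->
  exists S : {poly rat}, forall x, S.[x + M%:R] - S.[x] = P.[x].
Proof.
move=> M0.
have [S HS] : exists S : nat -> {poly rat}, forall i, (i < size P)%N ->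
    forall x, (S i).[x + M%:R] - (S i).[x] = x ^+ i.
  elim: (size P) => [|k [S HS]]; first by exists (fun=> 0).
  pose Sk : {poly rat} := (k.+1%:R * M%:R)^-1 *: ('X^(k.+1) -
    \sum_(i < k) (M%:R ^+ (k.+1 - i) *+ 'C(k.+1, i)) *: S i).
  have Mk : k.+1%:R * M%:R != 0 :> rat by rewrite mulf_neq0 // pnatr_eq0 -lt0n.
  exists (fun i => if i == k then Sk else S i) => i.
  rewrite ltnS leq_eqVlt; have [->|ik /= ilk] := eqVneq i k; last exact: HS.
  move=> _ x.
  have E1 : (x + M%:R) ^+ k.+1 - x ^+ k.+1 =
    \sum_(i < k) M%:R ^+ (k.+1 - i) * x ^+ i *+ 'C(k.+1, i) + k.+1%:R * M%:R * x ^+ k.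
    rewrite [x + _]addrC exprDn 2!big_ord_recr /= subnn expr0 mul1r binn mulr1n.
    rewrite subSnn expr1 binSn -[_ *+ k.+1]mulr_natl; ring.
  have E2 : \sum_(i < k) M%:R ^+ (k.+1 - i) * x ^+ i *+ 'C(k.+1, i) =
    \sum_(i < k) ((M%:R ^+ (k.+1 - i) *+ 'C(k.+1, i)) *: S i).[x + M%:R] -
    \sum_(i < k) ((M%:R ^+ (k.+1 - i) *+ 'C(k.+1, i)) *: S i).[x].
    by rewrite -sumrB; apply: eq_bigr => i0 _; rewrite !hornerZ -mulrBr HS // mulrnAl.
  rewrite /Sk !hornerZ -mulrBr !hornerD !hornerN !hornerXn !horner_sum.
  apply: (mulfI Mk); rewrite mulVKf //.
  have -> (a b c d : rat) : a - c - (b - d) = (a - b) - (c - d) by ring.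
  by rewrite E1 -E2 addrC addKr.
exists (\sum_(i < size P) P`_i *: S i) => x.
rewrite !horner_sum -sumrB horner_coef; apply: eq_bigr => i _.
by rewrite !hornerZ -mulrBr HS.
Qed.

(** Over [M = m d] steps the increment of [g] is polynomial on each class modulo [M]. After
    subtraction of a polynomial antidifference, what is left is [M]-periodic. *)
Lemma quasi_poly_antidifference d (f g : nat -> rat) : (0 < d)%N -> quasi_poly f ->
  (forall n, (0 < n)%N -> g (n + d)%N = g n + f n) -> quasi_poly g.
Proof.
move=> d0 [m m0 [Q HQ]] Hg; pose M := (m * d)%N.
have M0 : (0 < M)%N by rewrite muln_gt0 m0.
pose P r := \sum_(j < m) (Q ((r + j * d) %% m)%N \Po ('X + (j * d)%:R%:P)).
have gM n : (0 < n)%N -> g (n + M)%N = g n + (P (n %% M)%N).[n%:R].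
  move=> n0; have step k : g (n + k * d)%N = g n + \sum_(j < k) f (n + j * d)%N.
    elim: k => [|k IH]; first by rewrite mul0n addn0 big_ord0 addr0.
    rewrite mulSnr addnA Hg ?IH ?addn_gt0 ?n0 // big_ord_recr /=.
    by rewrite addrA.
  rewrite step; congr (_ + _); rewrite horner_sum; apply: eq_bigr => j _.
  rewrite HQ ?addn_gt0 ?n0 // horner_comp hornerD hornerX hornerC -natrD.
  by rewrite -[in RHS]modnDml (modn_dvdm n (dvdn_mulr d (dvdnn m))) modnDml.
have [S HS] := choice (fun r => poly_antidifference (P r) M0).
pose h n := g n - (S (n %% M)%N).[n%:R].
have hM n : (0 < n)%N -> h (n + M)%N = h n.
  move=> n0; rewrite /h modnDr gM // -HS natrD; ring.
(* Periodicity of [h] is only known from positive arguments, so the class 0 is represented by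
   [M]. *)
pose rep r := if r == 0%N then M else r.
exists M => //; exists (fun r => S r + (h (rep r))%:P) => n n0.
rewrite hornerD hornerC.
suff -> : h (rep (n %% M)%N) = h n by rewrite /h; ring.
have hk k r : (0 < r)%N -> h (r + k * M)%N = h r.
  move=> r0; elim: k => [|k IH]; first by rewrite mul0n addn0.
  by rewrite mulSnr addnA hM ?addn_gt0 ?r0.
rewrite /rep [in RHS](divn_eq n M); case: eqP => [r0|/eqP r0].
  rewrite r0 addn0; have : (0 < n %/ M)%N.
    by rewrite lt0n; apply: contraTneq n0 => q0; rewrite (divn_eq n M) q0 r0.
  by case: (n %/ M)%N => // k _; rewrite mulSn hk.
by rewrite addnC hk // lt0n.
Qed.

End QuasiPolynomials.

(** * Geometric series as operators on coefficients *)

Section ShiftOperators.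
Variable A : zmodType.
Implicit Types (f g : nat -> A -> rat) (a c : nat * A).

(** Multiplication by a monomial, on coefficients. [B] stands for a boundary still to be cancelled,
    which is why the weight of the monomial is added to it. *)
Definition shift_op a f n (B : A) : rat :=
  if (a.1 <= n)%N then f (n - a.1)%N (B + a.2) else 0.

Fixpoint shifts_fuel k a f n (B : A) : rat :=
  if k is k'.+1 then
    if (a.1 <= n)%N then f (n - a.1)%N (B + a.2) + shifts_fuel k' a f (n - a.1)%N (B + a.2) else 0
  else 0.

(* The sum of all positive powers of [shift_op a]. *)
Definition shifts_op a f n (B : A) : rat := shifts_fuel n.+1 a f n B.

Definition addf f g n (B : A) : rat := f n B + g n B.

Lemma shifts_fuelE k k' a f n B : (0 < a.1)%N -> (n < k)%N -> (n < k')%N ->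
  shifts_fuel k a f n B = shifts_fuel k' a f n B.
Proof.
move=> a0; elim: k k' n B => [//|k IH] [//|k'] n B nk nk' /=.
case: ifP => // an; congr (_ + _).
have h : (n - a.1 < n)%N by rewrite ltn_subrL a0 (leq_trans a0 an).
by apply: IH; [exact: leq_trans h nk | exact: leq_trans h nk'].
Qed.

Lemma shifts_opE a f : (0 < a.1)%N -> shifts_op a f = shift_op a (addf f (shifts_op a f)).
Proof.
move=> a0; apply/funext => n; apply/funext => B.
rewrite /shifts_op /shift_op /addf [LHS]/=; case: ifP => // an; congr (_ + _).
apply: shifts_fuelE => //.
by rewrite ltn_subrL a0 (leq_trans a0 an).
Qed.

(** As [a.1 > 0], the equation [g = u (f + g)] fixes [g] by induction on [n]. It characterises
    [u / (1 - u)] and yields the identities between geometric series below without division by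
    [1 - u]. *)
Lemma shifts_op_unique a f g : (0 < a.1)%N -> g = shift_op a (addf f g) -> g = shifts_op a f.
Proof.
move=> a0 Eg; apply/funext => n; apply/funext => B.
elim/ltn_ind: n B => n IH B.
rewrite [in LHS]Eg [in RHS](shifts_opE f a0) /shift_op /addf; case: ifP => // an.
by rewrite IH // ltn_subrL a0 (leq_trans a0 an).
Qed.

Lemma shift_opD a f g : shift_op a (addf f g) = addf (shift_op a f) (shift_op a g).
Proof.
apply/funext => n; apply/funext => B; rewrite /shift_op /addf.
by case: ifP => //; rewrite addr0.
Qed.

Lemma addfACA f g f' g' : addf (addf f g) (addf f' g') = addf (addf f f') (addf g g').
Proof. by apply/funext => n; apply/funext => B; rewrite /addf addrACA. Qed.

Lemma shifts_opD a f g : (0 < a.1)%N ->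
  shifts_op a (addf f g) = addf (shifts_op a f) (shifts_op a g).
Proof.
move=> a0; apply/esym/shifts_op_unique => //.
by rewrite {1}(shifts_opE f a0) {1}(shifts_opE g a0) -shift_opD addfACA.
Qed.

Lemma shift_op_comp a c f :
  shift_op a (shift_op c f) = shift_op ((a.1 + c.1)%N, a.2 + c.2) f.
Proof.
apply/funext => n; apply/funext => B; rewrite /shift_op /=.
have [an|an] := leqP a.1 n; last by rewrite leqNgt (leq_trans an) ?leq_addr.
by rewrite leq_subRL // subnDA addrA.
Qed.

Lemma shift_opC a c f : shift_op a (shift_op c f) = shift_op c (shift_op a f).
Proof. by rewrite !shift_op_comp addnC addrC. Qed.

Lemma shift_shifts_opC a c f : (0 < c.1)%N ->
  shift_op a (shifts_op c f) = shifts_op c (shift_op a f).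
Proof.
move=> c0; apply: shifts_op_unique => //.
by rewrite {1}(shifts_opE f c0) shift_opC shift_opD.
Qed.

Lemma shifts_opC a c f : (0 < a.1)%N -> (0 < c.1)%N ->
  shifts_op a (shifts_op c f) = shifts_op c (shifts_op a f).
Proof.
move=> a0 c0; apply/esym/shifts_op_unique => //.
rewrite {1}(shifts_opE f a0) -shift_shifts_opC // shifts_opD //.
Qed.

(* Elliott's subdivision: u/(1-u) * v/(1-v) = uv/(1-uv) * (1 + u/(1-u) + v/(1-v)). *)
Lemma shifts_op_split a c f : (0 < a.1)%N -> (0 < c.1)%N ->
  let ac := ((a.1 + c.1)%N, a.2 + c.2) in
  shifts_op a (shifts_op c f) =
  addf (shifts_op ac f) (addf (shifts_op ac (shifts_op a f)) (shifts_op ac (shifts_op c f))).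
Proof.
move=> a0 c0 ac; have ac0 : (0 < ac.1)%N by rewrite addn_gt0 a0.
rewrite -!shifts_opD //; apply: shifts_op_unique => //.
rewrite /ac -shift_op_comp {1}(shifts_opE f c0) -shift_shifts_opC //.
rewrite shifts_opE // -[in RHS]shift_opC; congr (shift_op _ (shift_op _ _)).
rewrite shifts_opD //; apply/funext => n; apply/funext => B; rewrite /addf; ring.
Qed.

Definition shifts_ops (D : seq (nat * A)) f := foldr shifts_op f D.

Definition origin n (B : A) : rat := ((n == 0%N) && (B == 0))%:R.

Lemma shifts_op_support a f (phi : A -> int) (c : int) :
  (forall B B', phi (B + B') = phi B + phi B') -> (0 < a.1)%N -> 0 <= phi a.2 ->
  (forall n B, f n B != 0 -> phi B + c <= 0) ->
  forall n B, shifts_op a f n B != 0 -> phi B + (phi a.2 + c) <= 0.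
Proof.
move=> phiD a0 pa Hf n; elim/ltn_ind: n => n IH B.
rewrite shifts_opE // /shift_op /addf; case: ifP => [an|]; last by rewrite eqxx.
have [f0|/Hf h _] := eqVneq (f (n - a.1)%N (B + a.2)) 0; last by rewrite addrA -phiD.
rewrite f0 add0r => /IH; rewrite ltn_subrL a0 (leq_trans a0 an) => /(_ isT).
by rewrite phiD; lia.
Qed.

(** Every factor [u / (1 - u)] uses its shift at least once, so at a nonzero coefficient [- B] is a
    combination of all the [a.2] with multiplicities at least 1; then apply [phi]. *)
Lemma shifts_ops_support D (phi : A -> int) :
  (forall B B', phi (B + B') = phi B + phi B') -> all (fun c => 0 < c.1)%N D ->
  (forall a, a \in D -> 0 <= phi a.2) ->
  forall n B, shifts_ops D origin n B != 0 -> phi B + \sum_(a <- D) phi a.2 <= 0.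
Proof.
move=> phiD; elim: D => [_ _|a D IH /= /andP[a0 D0] H].
  move=> n B; rewrite /= /origin big_nil; case: andP => [[_ /eqP ->] _|]; last by rewrite eqxx.
  by have := phiD 0 0; rewrite addr0; lia.
move=> n B; rewrite big_cons; apply: shifts_op_support => //.
  by apply: H; rewrite inE eqxx.
by apply: IH => // c cD; apply: H; rewrite inE cD orbT.
Qed.

Lemma shifts_ops_eq0 D (phi : A -> int) a n :
  (forall B B', phi (B + B') = phi B + phi B') -> all (fun c => 0 < c.1)%N D ->
  (forall c, c \in D -> 0 <= phi c.2) -> a \in D -> 0 < phi a.2 ->
  shifts_ops D origin n 0 = 0.
Proof.
move=> phiD D0 H aD pa; apply/eqP; apply: contraT => h.
have := shifts_ops_support phiD D0 H h.
have phi0 : phi 0 = 0 by have := phiD 0 0; rewrite addr0; lia.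
rewrite phi0 add0r (big_rem a) //= => S.
have : 0 <= \sum_(c <- rem a D) phi c.2.
  by rewrite big_seq; apply: sumr_ge0 => c /mem_rem /H.
by move=> R; have := lt_le_trans (ltr_wpDr R pa) S; rewrite ltxx.
Qed.

End ShiftOperators.

(** * Elimination of vertices *)

Section VertexElimination.
Variable V : finType.
Implicit Types (v : V) (a c : V * V * nat) (D : seq (V * V * nat)) (vs : seq V).

Definition arc_bound (s t : V) : {ffun V -> int} := [ffun v => (t == v)%:R - (s == v)%:R].

(* An arc (s, t, d) stands for a path of length d from s to t. *)
Definition arc_weight a : nat * {ffun V -> int} := (a.2, arc_bound a.1.1 a.1.2).

(** Counts the ways to give each arc of [D] a positive multiplicity with total length [n] and zero
    boundary. *)
Definition arc_count D n : rat := shifts_ops (map arc_weight D) (@origin {ffun V -> int}) n 0.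

Definition arc_in v a := (a.1.2 == v) && (a.1.1 != v).
Definition arc_out v a := (a.1.1 == v) && (a.1.2 != v).

Let positive D := all (fun a => 0 < a.2)%N D.

Lemma positive_weights D : positive D -> all (fun p : nat * {ffun V -> int} => 0 < p.1)%N (map arc_weight D).
Proof. by rewrite all_map. Qed.

Lemma arc_count_rem D a : positive D -> a \in D ->
  shifts_ops (map arc_weight D) (@origin {ffun V -> int}) =
  shifts_op (arc_weight a) (shifts_ops (map arc_weight (rem a D)) (@origin {ffun V -> int})).
Proof.
elim: D => [//|c D IH] /= /andP[c0 D0]; rewrite inE.
have [->//|ac /= aD] := eqVneq a c; rewrite IH //= shifts_opC //.
exact: (allP D0).
Qed.

(** A loop leaves the boundary unchanged, so its geometric series is an antidifference whose step is
    its length. *)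
Lemma quasi_poly_loops D : positive D -> all (fun a => a.1.1 == a.1.2) D ->
  quasi_poly (arc_count D).
Proof.
rewrite /arc_count; elim: D => [_ _|a D IH] /=.
  by apply: quasi_poly_eq (quasi_poly_const 0) => -[].
move=> /andP[a0 D0] /andP[la lD]; apply: (quasi_poly_antidifference a0 (IH D0 lD)) => n n0.
rewrite [in LHS]shifts_opE // /shift_op /= leq_addl addnK /addf.
have -> : arc_bound a.1.1 a.1.2 = 0.
  by apply/ffunP => v; rewrite !ffunE (eqP la) subrr.
by rewrite addr0 addrC.
Qed.

(** If the nonloop arcs at [v] all enter, or all leave, multiplicities at least 1 cannot balance
    there; [phi] is the boundary at [v] up to sign. *)
Lemma arc_count_one_sided D v (b : bool) : positive D ->
  ~~ has (if b then arc_out v else arc_in v) D ->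
  has (if b then arc_in v else arc_out v) D -> forall n, arc_count D n = 0.
Proof.
move=> D0 /hasPn no /hasP [a aD ha] n.
pose phi (B : {ffun V -> int}) : int := if b then B v else - B v.
apply: (@shifts_ops_eq0 _ _ phi (arc_weight a)).
- by move=> B B'; rewrite /phi ffunE; case: (b) => //; rewrite opprD.
- exact: positive_weights.
- move=> _ /mapP [c cD ->]; have := no c cD.
  rewrite /phi /arc_weight /= ffunE /arc_in /arc_out.
  by case: (b); case: (c.1.1 == v); case: (c.1.2 == v).
- exact: map_f.
- move: ha; rewrite /phi /arc_weight /= ffunE /arc_in /arc_out.
  by case: (b); case: (a.1.1 == v); case: (a.1.2 == v).
Qed.

Definition nonloop_within vs a := (a.1.1 != a.1.2) ==> (a.1.1 \in vs) && (a.1.2 \in vs).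

(** Outer induction on the vertices allowed as ends of nonloops, inner induction on the number of
    nonloops at [v]. Subdivision replaces an entering [a] and a leaving [c] by their composite [e],
    alone or with just one of them; since [e] has both ends away from [v], the inner number
    drops. *)
Lemma quasi_poly_arc_count_within vs D : positive D -> all (nonloop_within vs) D ->
  quasi_poly (arc_count D).
Proof.
elim: vs D => [|v vs IHvs] D D0 Dvs.
  apply: quasi_poly_loops => //; apply: sub_all Dvs => a.
  by rewrite /nonloop_within; case: eqP.
pose inc a := arc_in v a || arc_out v a.
move: {2}(count inc D).+1 (ltnSn (count inc D)) => k.
elim: k D D0 Dvs => [//|k IHk] D D0 Dvs; rewrite ltnS => Dk.
have [hin|hin] := boolP (has (arc_in v) D); have [hout|hout] := boolP (has (arc_out v) D).
- have /hasP [a aD ia] := hin; have /hasP [c cD oc] := hout.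
  have ca : c != a.
    apply: contraTneq ia => <-; move: oc; rewrite /arc_in /arc_out => /andP[/eqP -> h].
    by rewrite eqxx andbF.
  have cD' : c \in rem a D by move: cD; rewrite (perm_mem (perm_to_rem aD)) inE (negbTE ca).
  have a0 : (0 < a.2)%N by exact: (allP D0).
  have c0 : (0 < c.2)%N by exact: (allP D0).
  pose D' := rem c (rem a D).
  have pD : perm_eq D [:: a, c & D'].
    apply: perm_trans (perm_to_rem aD) _; rewrite perm_cons; exact: perm_to_rem.
  have D'0 : positive D' by move: D0; rewrite /positive (perm_all _ pD) /= => /and3P[].
  have D'vs : all (nonloop_within (v :: vs)) D'.
    by move: Dvs; rewrite (perm_all _ pD) /= => /and3P[].
  have avs := allP Dvs a aD; have cvs := allP Dvs c cD.
  pose e : V * V * nat := (a.1.1, c.1.2, (a.2 + c.2)%N).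
  have evs : nonloop_within (v :: vs) e.
    move: ia oc avs cvs; rewrite /nonloop_within /e /arc_in /arc_out /=.
    case/andP => /eqP -> av /andP[/eqP -> cv]; rewrite av eq_sym cv /=.
    by move=> /andP[-> _] /andP[_ ->]; exact: implybT.
  have we : arc_weight e = (((arc_weight a).1 + (arc_weight c).1)%N,
                            (arc_weight a).2 + (arc_weight c).2).
    congr (_, _); apply/ffunP => x; rewrite !ffunE /=.
    move: ia oc; rewrite /arc_in /arc_out => /andP[/eqP -> _] /andP[/eqP -> _].
    ring.
  have e0 : (0 < e.2)%N by rewrite addn_gt0 a0.
  have ie : inc e = false.
    move: ia oc; rewrite /inc /arc_in /arc_out /e /= => /andP[_ av] /andP[_ cv].
    by rewrite (negbTE av) (negbTE cv).
  have ai : inc a by rewrite /inc ia.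
  have ci : inc c by rewrite /inc oc orbT.
  have cnt : (count inc D = (count inc D').+2)%N by rewrite (seq.permP pD) /= ai ci.
  have Q1 : quasi_poly (arc_count (e :: D')).
    by apply: IHk; rewrite /= ?e0 ?evs //= ie add0n; rewrite cnt in Dk; exact: ltnW.
  have Q2 : quasi_poly (arc_count [:: e, a & D']).
    by apply: IHk; rewrite /= ?e0 ?evs ?a0 ?avs //= ie ai add0n add1n; rewrite cnt in Dk.
  have Q3 : quasi_poly (arc_count [:: e, c & D']).
    by apply: IHk; rewrite /= ?e0 ?evs ?c0 ?cvs //= ie ci add0n add1n; rewrite cnt in Dk.
  apply: quasi_poly_eq (quasi_polyD Q1 (quasi_polyD Q2 Q3)) => n _.
  have remD0 : positive (rem a D).
    by apply/allP => x /mem_rem; exact: (allP D0).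
  rewrite /arc_count (arc_count_rem D0 aD) (arc_count_rem remD0 cD') shifts_op_split //.
  by rewrite /= we.
- apply: quasi_poly_eq (quasi_poly_const 0) => n _.
  by rewrite (@arc_count_one_sided D v true).
- apply: quasi_poly_eq (quasi_poly_const 0) => n _.
  by rewrite (@arc_count_one_sided D v false).
- apply: IHvs => //; apply/allP => a aD.
  have := allP Dvs a aD; have := hasPn hin a aD; have := hasPn hout a aD.
  rewrite /nonloop_within /arc_in /arc_out !inE.
  have [->|n1] := eqVneq a.1.1 v; have [->|n2] := eqVneq a.1.2 v => //=.
Qed.

Lemma quasi_poly_arc_count D : positive D -> quasi_poly (arc_count D).
Proof.
move=> D0; apply: (@quasi_poly_arc_count_within (enum V)) => //.
by apply/allP => a _; rewrite /nonloop_within !mem_enum implybT.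
Qed.

End VertexElimination.

(** * Enumeration of the integral cycles of given norm *)

Section CycleEnumeration.
Variables (V E : finType) (src tgt : E -> V).
Implicit Types (th : {ffun E -> int}) (B : {ffun V -> int}) (x : E * bool) (es : seq E)
  (f : nat -> {ffun V -> int} -> seq {ffun E -> int}).

Definition bd th : {ffun V -> int} := [ffun v => bound src tgt th v].

Lemma bdD th th' : bd (th + th') = bd th + bd th'.
Proof. by apply/ffunP => v; rewrite !ffunE boundD. Qed.

Lemma bdN th : bd (- th) = - bd th.
Proof. by apply/ffunP => v; rewrite !ffunE boundN. Qed.

Lemma bd0 : bd 0 = 0.
Proof. by apply: (addrI (bd 0)); rewrite -bdD !addr0. Qed.

Lemma bd_arc x : bd (arc_class x) = arc_bound (ostart src tgt x) (oend src tgt x).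
Proof. by apply/ffunP => v; rewrite !ffunE bound_arc. Qed.

(** Adds one or more copies of [x] to the chains of [f]. The recursion imitates [shifts_op], so that
    the lengths of the lists satisfy its fixed-point equation. *)
Fixpoint add_arcs x f n B : seq {ffun E -> int} :=
  if n is n'.+1 then
    map (fun th => th + arc_class x)
      (f n' (B + bd (arc_class x)) ++ add_arcs x f n' (B + bd (arc_class x)))
  else [::].

Definition chain_base n B : seq {ffun E -> int} :=
  if (n == 0%N) && (B == 0) then [:: 0] else [::].

(** The coefficient at [e] is zero, positive or negative, which corresponds to the factor
    [1 + u / (1 - u) + v / (1 - v)]. *)
Definition add_edge e f n B := f n B ++ add_arcs (e, true) f n B ++ add_arcs (e, false) f n B.

Definition chains es := foldr add_edge chain_base es.

Definition chain_spec es n B th : bool :=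
  [&& [forall e, (e \notin es) ==> (th e == 0)], l1norm th == n & B + bd th == 0].

Lemma chain_spec_cons e es n B th : e \notin es ->
  chain_spec es n B th = chain_spec (e :: es) n B th && (th e == 0).
Proof.
move=> ees; rewrite /chain_spec.
have -> : [forall e0, (e0 \notin es) ==> (th e0 == 0)] =
   [forall e0, (e0 \notin e :: es) ==> (th e0 == 0)] && (th e == 0).
  apply/forallP/andP => [H|[/forallP H he] e0].
    split; last by have := H e; rewrite ees.
    by apply/forallP => e0; rewrite inE negb_or; apply/implyP => /andP[_]; apply/implyP.
  have := H e0; rewrite inE negb_or; have [->|] //= := eqVneq e0 e.
  by rewrite he implybT.
by case: (th e == 0); rewrite ?andbT ?andbF.
Qed.

(** Once a copy of [x] is removed, the coefficient at its edge is either 0 or still conformal to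
    [x]: these are the two lists concatenated in [add_arcs]. *)
Lemma mem_add_arcs x es f n B th : x.1 \notin es ->
  (forall n B th, (th \in f n B) = chain_spec es n B th) ->
  (th \in add_arcs x f n B) = chain_spec (x.1 :: es) n B th && conformal th x.
Proof.
move=> xes Hf; elim: n B th => [|n IH] B th.
  rewrite in_nil; apply/esym/negbTE/negP => /andP[/and3P[_ + _]].
  by rewrite l1norm_eq0 => /eqP ->; rewrite /conformal ffunE; case: (x.2).
have memD s : (th \in [seq t + arc_class x | t <- s]) = (th - arc_class x \in s).
  by apply/mapP/idP => [[t ts ->]|h]; [rewrite addrK | exists (th - arc_class x); rewrite ?subrK].
rewrite /= memD mem_cat Hf IH (chain_spec_cons _ _ _ xes) -andb_orr.
set th' := th - arc_class x.
have E1 : ((th' x.1 == 0) || conformal th' x) = conformal th x.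
  rewrite /th' /conformal !ffunE eqxx; case: (x.2); move: (th x.1) => k; lia.
rewrite E1; have [cx|] := boolP (conformal th x); last by rewrite !andbF.
rewrite !andbT /chain_spec.
have -> : B + bd (arc_class x) + bd th' = B + bd th.
  by rewrite /th' bdD bdN -addrA; congr (_ + _); rewrite addrC subrK.
have := @l1norm_sub_conformal _ [:: x] th isT; rewrite /= cx => /(_ isT).
have -> : walk_class [:: x] = arc_class x.
  by rewrite walk_class_cons walk_class_nil addr0.
rewrite -/th' addn1 => <-; rewrite eqSS; congr (_ && _).
apply: eq_forallb => e; rewrite inE negb_or; case: eqVneq => //= ex.
by rewrite /th' !ffunE [x.1 == e]eq_sym (negbTE ex) subr0.
Qed.

Lemma mem_chains es n B th : uniq es -> (th \in chains es n B) = chain_spec es n B th.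
Proof.
elim: es n B th => [|e es IH] n B th /=.
  move=> _; rewrite /chain_base /chain_spec.
  have -> : [forall e, (e \notin [::]) ==> (th e == 0)] = (th == 0).
    by apply/forallP/eqP => [H|-> e]; [apply/ffunP => e; have := H e; rewrite ffunE => /eqP
      | rewrite ffunE].
  have [->|th0] := eqVneq th 0.
    have /eqP -> : l1norm (0 : {ffun E -> int}) == 0%N by rewrite l1norm_eq0.
    by rewrite bd0 addr0 eq_sym; case: ifP; rewrite ?inE ?eqxx.
  by case: ifP; rewrite ?inE ?(negbTE th0).
move=> /andP[ees ues]; have Hf n' B' th' := IH n' B' th' ues.
rewrite /add_edge !mem_cat !(@mem_add_arcs _ es) // Hf (chain_spec_cons _ _ _ ees).
rewrite -!andb_orr /conformal /=.
by have -> : [|| th e == 0, 0 < th e | th e < 0]; [case: ltgtP | rewrite andbT].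
Qed.

Lemma uniq_chains es n B : uniq es -> uniq (chains es n B).
Proof.
elim: es n B => [|e es IH] n B /=; first by rewrite /chain_base; case: ifP.
move=> /andP[ees ues]; have Hf n' B' th' := @mem_chains es n' B' th' ues.
have U x n' B' : x.1 = e -> uniq (add_arcs x (chains es) n' B').
  move=> xe; elim: n' B' => //= n' IHn B'; rewrite map_inj_uniq; last exact: addIr.
  rewrite cat_uniq IH // IHn andbT /=; apply/hasPn => th.
  rewrite (@mem_add_arcs _ es) ?xe // => /andP[_ cx].
  rewrite Hf (chain_spec_cons _ _ _ ees) -xe; apply: contraTN cx => /andP[_ /eqP cx].
  by rewrite /conformal cx; case: (x.2).
rewrite /add_edge !cat_uniq IH // !U // andbT /=; apply/andP; split.
  apply/hasPn => th; rewrite mem_cat !(@mem_add_arcs _ es) // -andb_orr => /andP[_ cx].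
  rewrite Hf (chain_spec_cons _ _ _ ees); apply: contraTN cx => /andP[_ /eqP cx].
  by rewrite /conformal /= cx.
apply/hasPn => th; rewrite !(@mem_add_arcs _ es) // => /andP[_ cx].
by rewrite negb_and; apply/orP; right; move: cx; rewrite /conformal /= -leNgt => /ltW.
Qed.

Definition size_rat f n B : rat := (size (f n B))%:R.

Lemma size_add_arcs x f :
  size_rat (add_arcs x f) =
  shifts_op (arc_weight (ostart src tgt x, oend src tgt x, 1%N)) (size_rat f).
Proof.
apply: shifts_op_unique => //; apply/funext => n; apply/funext => B.
rewrite /size_rat /shift_op /addf /arc_weight /= -bd_arc; case: n => //= n.
by rewrite subn1 /= size_map size_cat natrD.
Qed.

Lemma shifts_op_sum (A : zmodType) (I : Type) (r : seq I) (F : I -> nat -> A -> rat) (a : nat * A) :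
  (0 < a.1)%N ->
  shifts_op a (fun n C => \sum_(i <- r) F i n C) =
  (fun n C => \sum_(i <- r) shifts_op a (F i) n C).
Proof.
move=> a0; elim: r => [|i r IH].
  apply/esym/shifts_op_unique => //; apply/funext => n; apply/funext => C.
  by rewrite /shift_op /addf !big_nil addr0 if_same.
have -> : (fun n C => \sum_(j <- i :: r) F j n C) = addf (F i) (fun n C => \sum_(j <- r) F j n C).
  by apply/funext => n; apply/funext => C; rewrite big_cons.
by rewrite shifts_opD // IH; apply/funext => n; apply/funext => C; rewrite big_cons.
Qed.

(** Expansion of the product of the edge factors: in each term an edge is absent or taken in one of
    its two orientations. *)
Lemma chains_decomposition es : exists Ds : seq (seq (V * V * nat)),
  all (all (fun a => 0 < a.2)%N) Ds /\
  size_rat (chains es) =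
  (fun n B => \sum_(D <- Ds) shifts_ops (map (@arc_weight V) D) (@origin {ffun V -> int}) n B).
Proof.
elim: es => [|e es [Ds [Ds0 HDs]]].
  exists [:: [::]]; split=> //; apply/funext => n; apply/funext => B.
  by rewrite big_cons big_nil addr0 /= /size_rat /= /chain_base /origin; case: ifP.
pose a : V * V * nat := (src e, tgt e, 1%N); pose c : V * V * nat := (tgt e, src e, 1%N).
exists (Ds ++ map (cons a) Ds ++ map (cons c) Ds); split.
  by rewrite !all_cat !all_map Ds0 /=.
have -> : size_rat (chains (e :: es)) = addf (size_rat (chains es))
   (addf (size_rat (add_arcs (e, true) (chains es))) (size_rat (add_arcs (e, false) (chains es)))).
  by apply/funext => n; apply/funext => B; rewrite /size_rat /addf /= !size_cat !natrD.
rewrite !size_add_arcs HDs !shifts_op_sum //.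
by apply/funext => n; apply/funext => B; rewrite /addf !big_cat !big_map.
Qed.

Definition cycles_of_norm n := chains (enum E) n 0.

Lemma mem_cycles_of_norm n th :
  th \in cycles_of_norm n <-> l1norm th = n /\ icycle src tgt th.
Proof.
rewrite mem_chains ?enum_uniq // /chain_spec add0r; split.
  move=> /and3P[_ /eqP -> /eqP h]; split=> //; apply/icycleP => v.
  by have := congr1 (fun g : {ffun V -> int} => g v) h; rewrite !ffunE.
move=> [-> /icycleP h]; rewrite eqxx; apply/andP; split.
  by apply/forallP => e; rewrite mem_enum.
by apply/eqP/ffunP => v; rewrite !ffunE.
Qed.

Lemma uniq_cycles_of_norm n : uniq (cycles_of_norm n).
Proof. by apply: uniq_chains; exact: enum_uniq. Qed.

Lemma quasi_poly_cycle_count : quasi_poly (fun n => (size (cycles_of_norm n))%:R).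
Proof.
have [Ds [Ds0 HDs]] := chains_decomposition (enum E).
have -> : (fun n => (size (cycles_of_norm n))%:R) = (fun n => \sum_(D <- Ds) arc_count D n).
  by apply/funext => n; have := congr1 (fun g => g n 0) HDs.
elim: Ds Ds0 {HDs} => [_|D Ds IH /= /andP[D0 Ds0]].
  by apply: quasi_poly_eq (quasi_poly_const 0) => n _; rewrite big_nil.
apply: quasi_poly_eq (quasi_polyD (quasi_poly_arc_count D0) (IH Ds0)) => n _.
by rewrite big_cons.
Qed.

End CycleEnumeration.

(** * Iterated integrals of step functions as lattice sums *)

Section LatticeSums.
Variable R : realType.
Local Notation mu := (@lebesgue_measure R).

(** Measurability of the inner integrals of [iter_lebesgue] is never established; monotonicity is
    read off the definition of the integral as a supremum over simple functions. *)
Lemma ge0_le_integral_nonmeasurable (f g : R -> \bar R) :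
  (forall x, (0 <= f x)%E) -> (forall x, (f x <= g x)%E) ->
  (\int[mu]_x f x <= \int[mu]_x g x)%E.
Proof.
move=> f0 fg; have g0 x : (0 <= g x)%E by exact: le_trans (fg x).
rewrite !ge0_integralTE //; apply: ereal_sup_le => _ [h hf <-].
by exists h => // x; exact: le_trans (fg x).
Qed.

Lemma iter_lebesgue_ge0 n (F : (nat -> R) -> \bar R) :
  (forall t, (0 <= F t)%E) -> (0 <= iter_lebesgue n F)%E.
Proof.
elim: n F => [|n IH] F F0 //=; apply: integral_ge0 => x _.
by apply: IH => t.
Qed.

Lemma le_iter_lebesgue n (F G : (nat -> R) -> \bar R) :
  (forall t, (0 <= F t)%E) -> (forall t, (F t <= G t)%E) ->
  (iter_lebesgue n F <= iter_lebesgue n G)%E.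
Proof.
elim: n F G => [|n IH] F G F0 FG //=; apply: ge0_le_integral_nonmeasurable => x.
  by apply: iter_lebesgue_ge0 => t.
by apply: IH => t.
Qed.

(** Enumerates the integers of [[-M, M]] as [k] runs from 0 to [2 M]. *)
Definition shifted_int (M k : nat) : int := k%:Z - M%:Z.

(** The integrand is constant on each cell [[y / N, (y + 1) / N[], and only the cells with
    [|y| <= M] contribute. *)
Lemma integral_floor (N M : nat) (psi : int -> R) : (0 < N)%N -> (forall y, 0 <= psi y) ->
  (forall y, (M < `|y|)%N -> psi y = 0) ->
  (\int[mu]_x (psi (Num.floor (N%:R * x)))%:E =
   (N%:R^-1 * \sum_(0 <= k < M.*2.+1) psi (shifted_int M k))%:E)%E.
Proof.
move=> N0 psi0 psiM; have n0 : 0 < N%:R :> R by rewrite ltr0n.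
pose I (y : int) : set R := `[y%:~R / N%:R, (y + 1)%:~R / N%:R[%classic.
have inI y x : (x \in I y) = (Num.floor (N%:R * x) == y).
  have iff : (I y x : Prop) <-> y%:~R <= N%:R * x < (y + 1)%:~R.
    by rewrite /I /= in_itv /= ler_pdivrMr // ltr_pdivlMr // [x * _]mulrC.
  apply/idP/eqP => [|E]; rewrite inE; first by move/iff; exact: floor_def.
  by apply/iff; rewrite -E; exact: floor_itv.
transitivity (\int[mu]_x \sum_(0 <= k < M.*2.+1)
    ((psi (shifted_int M k))%:E * (\1_(I (shifted_int M k)) x)%:E))%E.
  apply: eq_integral => x _; set y := Num.floor _.
  have term k : ((psi (shifted_int M k))%:E * (\1_(I (shifted_int M k)) x)%:E)%E =
     (if y == shifted_int M k then psi y else 0)%:E.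
    rewrite indicE inI -/y; case: eqP => [->|_]; first by rewrite mule1.
    by rewrite mule0.
  under eq_bigr do rewrite term.
  rewrite sumEFin; congr (_%:E).
  have [yM|yM] := leqP `|y|%N M; last first.
    rewrite psiM // big1 // => k _; by case: ifP.
  pose k0 := `|(y + M%:Z)%R|%N.
  have k0E : shifted_int M k0 = y by rewrite /shifted_int /k0; lia.
  have k0M : (k0 < M.*2.+1)%N by rewrite /k0; lia.
  rewrite (bigD1_seq k0) ?iota_uniq ?mem_index_iota //= k0E eqxx big1 ?addr0 // => k kk0.
  case: eqP => // E; case/eqP: kk0; rewrite /shifted_int in E k0E.
  by apply/eqP; rewrite -eqz_nat; apply/eqP; rewrite -k0E in E; lia.
rewrite ge0_integral_sum //; last 2 first.
- move=> k; apply: measurable_funeM; apply/measurable_realfun.measurable_EFinP.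
  apply: measurable_realfun.measurable_indic; exact: measurable_itv.
- by move=> k x _; rewrite mule_ge0 // lee_fin.
rewrite mulr_sumr -sumEFin; apply: eq_bigr => k _.
rewrite ge0_integralZl //; last 2 first.
- by apply/measurable_realfun.measurable_EFinP; apply: measurable_realfun.measurable_indic; exact: measurable_itv.
- by rewrite lee_fin.
rewrite integral_indic ?setIT //; last exact: measurable_itv.
rewrite [X in (_ * X)%E = _](_ : _ = (N%:R^-1)%:E); first by rewrite -EFinM mulrC.
rewrite /I /= lebesgue_measure_itv /= lte_fin ltr_pM2r ?invr_gt0 // ltr_int ltrDl ltr01.
by rewrite -EFinB -mulrBl -intrB addrC addKr mul1r.
Qed.

Definition update (n : nat) (y : int) (c : nat -> int) (i : nat) : int :=
  if i == n then y else c i.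

Fixpoint lattice_sum (n M : nat) (phi : (nat -> int) -> R) : R :=
  if n is n'.+1 then
    \sum_(0 <= k < M.*2.+1) lattice_sum n' M (fun c => phi (update n' (shifted_int M k) c))
  else phi (fun=> 0).

Lemma lattice_sum_ge0 n M phi : (forall c, 0 <= phi c) -> 0 <= lattice_sum n M phi.
Proof.
by elim: n phi => [|n IH] phi p0 //=; apply: sumr_ge0 => k _; apply: IH.
Qed.

Lemma lattice_sum_eq0 n M phi : (forall c, phi c = 0) -> lattice_sum n M phi = 0.
Proof.
by elim: n phi => [|n IH] phi p0 //=; rewrite big1 // => k _; apply: IH.
Qed.

Lemma iter_lebesgue_floor n (N M : nat) (phi : (nat -> int) -> R) : (0 < N)%N ->
  (forall c, 0 <= phi c) ->
  (forall c i, (i < n)%N -> (M < `|c i|)%N -> phi c = 0) ->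
  iter_lebesgue n (fun t => (phi (fun i => Num.floor (N%:R * t i)))%:E) =
  ((N%:R ^+ n)^-1 * lattice_sum n M phi)%:E.
Proof.
move=> N0; elim: n phi => [|n IH] phi phi0 phiM /=.
  by rewrite expr0 invr1 mul1r; congr (phi _)%:E; apply/funext => i; rewrite mulr0 floor0.
pose psi y := (N%:R ^+ n)^-1 * lattice_sum n M (fun c => phi (update n y c)).
transitivity (\int[mu]_x (psi (Num.floor (N%:R * x)))%:E)%E.
  apply: eq_integral => x _; rewrite /psi -IH.
  - congr iter_lebesgue; apply/funext => t; congr (phi _)%:E; apply/funext => i.
    by rewrite /update; case: ifP.
  - by move=> c.
  - move=> c i ni ci; apply: (phiM _ i); first exact: ltnW.
    by rewrite /update ltn_eqF.
have Nn : 0 <= (N%:R ^+ n)^-1 :> R by rewrite invr_ge0 exprn_ge0.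
rewrite (@integral_floor N M) //.
- rewrite exprS invfM -mulrA; congr (_ * _)%:E.
  by rewrite /psi -mulr_sumr.
- by move=> y; rewrite /psi mulr_ge0 // lattice_sum_ge0.
- move=> y My; rewrite /psi lattice_sum_eq0 ?mulr0 // => c.
  by apply: (phiM _ n) => //; rewrite /update eqxx.
Qed.

Fixpoint int_boxes (n M : nat) : seq (seq int) :=
  if n is n'.+1 then
    [seq rcons s (shifted_int M k) | k <- index_iota 0 M.*2.+1, s <- int_boxes n' M]
  else [:: [::]].

Lemma mem_int_boxes n M s : (s \in int_boxes n M) =
  (size s == n) && all (fun y => `|y| <= M)%N s.
Proof.
elim: n s => [|n IH] s; first by case: s.
apply/allpairsP/andP => [[[k s'] [kM]]|].
  have {}kM : (k < M.*2.+1)%N by move: kM; rewrite mem_index_iota.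
  move=> /= + ->; rewrite IH => /andP[/eqP ss sM]; rewrite size_rcons ss all_rcons sM andbT.
  by split=> //; rewrite /shifted_int; lia.
case: (lastP s) => [[]//|s' y]; rewrite size_rcons all_rcons eqSS => -[ss /andP[yM sM]].
exists (`|(y + M%:Z)%R|%N, s'); split; first by rewrite mem_index_iota /=; lia.
  by rewrite IH /= ss sM.
by rewrite /shifted_int /=; congr rcons; lia.
Qed.

Lemma uniq_int_boxes n M : uniq (int_boxes n M).
Proof.
elim: n => // n IH; apply: allpairs_uniq => //; first exact: iota_uniq.
move=> [k s] [k' s'] _ _ /= /rcons_inj [-> E]; congr (_, _).
by move: E; rewrite /shifted_int; lia.
Qed.

Lemma lattice_sumE n M phi :
  lattice_sum n M phi = \sum_(s <- int_boxes n M) phi (nth 0 s).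
Proof.
elim: n phi => [|n IH] phi.
  by rewrite /= big_seq1; congr phi; apply/funext => i; rewrite nth_nil.
rewrite big_allpairs_dep [LHS]/=; apply: eq_bigr => k _; rewrite IH.
rewrite !big_seq; apply: eq_bigr => s; rewrite mem_int_boxes => /andP[/eqP ss _].
congr phi; apply/funext => i; rewrite /update nth_rcons ss.
case: ltngtP => // ni; first by rewrite nth_default ?ss // ltnW.
Qed.

End LatticeSums.

(** * Comparison of the volume of the unit ball with lattice points *)

Section BallVolume.
Variables (R : realType) (V E : finType) (src tgt : E -> V).
Hypothesis conn : graph_connected src tgt.
Variables (b : nat) (gamma : 'I_b -> {ffun E -> int}).
Hypothesis basis : Zbasis src tgt gamma.

Local Notation comb := (int_combination gamma).
Local Notation cycles := (cycles_of_norm src tgt).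

Definition ball_cycles s : seq {ffun E -> int} := flatten [seq cycles k | k <- iota 0 s.+1].

Definition ball_count s : nat := size (ball_cycles s).

Lemma mem_ball_cycles s th : th \in ball_cycles s <-> (l1norm th <= s)%N /\ icycle src tgt th.
Proof.
split.
  move/flatten_mapP => [k]; rewrite mem_iota add0n => /andP[_ ks].
  by move/mem_cycles_of_norm => [-> c]; split.
move=> [h c]; apply/flatten_mapP; exists (l1norm th); first by rewrite mem_iota.
exact/mem_cycles_of_norm.
Qed.

Lemma ball_cycles_rec s : ball_cycles s.+1 = ball_cycles s ++ cycles s.+1.
Proof. by rewrite /ball_cycles -[in LHS]addn1 iotaD map_cat flatten_cat /= cats0. Qed.

Lemma uniq_ball_cycles s : uniq (ball_cycles s).
Proof.
elim: s => [|s IH]; first by rewrite /ball_cycles /= cats0 uniq_cycles_of_norm.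
rewrite ball_cycles_rec cat_uniq IH uniq_cycles_of_norm andbT /=.
apply/hasPn => th /mem_cycles_of_norm [h _]; apply/negP => /mem_ball_cycles [].
by rewrite h ltnn.
Qed.

Lemma ball_countS s : ball_count s.+1 = (ball_count s + size (cycles s.+1))%N.
Proof. by rewrite /ball_count ball_cycles_rec size_cat. Qed.

Lemma icycle_comb c : icycle src tgt (comb c).
Proof. by case: basis => h _; exact: icycle_int_combination. Qed.

Lemma comb_inj c c' : comb c = comb c' -> forall i, (i < b)%N -> c i = c' i.
Proof.
move=> E1 i ib; have [_ [_ indep]] := basis.
have := indep (fun j => c j - c' j) _ (Ordinal ib) => /= h.
apply/eqP; rewrite -subr_eq0; apply/eqP; apply: h => e.
have := congr1 (fun f : {ffun E -> int} => f e) E1; rewrite !ffunE => E2.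
by under eq_bigr do rewrite mulrBl; rewrite sumrB E2 subrr.
Qed.

Lemma comb_surj th : icycle src tgt th -> exists2 s : seq int, size s = b & th = comb (nth 0 s).
Proof.
move=> cyc; have [_ [gen _]] := basis; have [c ->] := gen th cyc.
exists [seq c i | i <- enum 'I_b]; first by rewrite size_map size_enum_ord.
apply/ffunP => e; rewrite !ffunE; apply: eq_bigr => i _.
by rewrite (nth_map i) ?size_enum_ord // nth_ord_enum.
Qed.

(** The ball contains finitely many cycles and coordinates are unique, so a bound is accumulated
    along the list of these cycles, without inverting the basis. *)
Lemma coordinates_bound s : exists M : nat, forall c i, (i < b)%N ->
  (l1norm (comb c) <= s)%N -> (`|c i| <= M)%N.
Proof.
suff [M HM] : exists M : nat, forall th, th \in ball_cycles s -> forall c, th = comb c ->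
    forall i, (i < b)%N -> (`|c i| <= M)%N.
  exists M => c i ib cs; apply: (HM (comb c)) => //.
  by apply/mem_ball_cycles; split=> //; exact: icycle_comb.
have : forall th, th \in ball_cycles s -> icycle src tgt th.
  by move=> th /mem_ball_cycles [].
elim: (ball_cycles s) => [_|th r IH H]; first by exists 0%N.
have [M HM] := IH (fun t tr => H t ltac:(by rewrite inE tr orbT)).
have [s' ss Es] := comb_surj (H th (mem_head _ _)).
exists (M + \sum_(j < b) `|nth 0%R s' j|)%N => t; rewrite inE => /predU1P[->|tr] c Ec i ib.
  rewrite -(comb_inj (etrans (esym Es) Ec) ib) (bigD1 (Ordinal ib)) //=.
  by apply: leq_trans (leq_addl _ _); exact: leq_addr.
by apply: leq_trans (HM t tr c Ec i ib) _; exact: leq_addr.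
Qed.

Definition ball_indicator s (c : nat -> int) : R := (l1norm (comb c) <= s)%N%:R.

Lemma lattice_sum_ball s M :
  (forall c i, (i < b)%N -> (l1norm (comb c) <= s)%N -> (`|c i| <= M)%N) ->
  lattice_sum b M (ball_indicator s) = (ball_count s)%:R.
Proof.
move=> HM; rewrite lattice_sumE.
pose P (t : seq int) := (l1norm (comb (nth 0%R t)) <= s)%N.
have -> : \sum_(t <- int_boxes b M) ball_indicator s (nth 0 t) =
   (size [seq comb (nth 0%R t) | t <- int_boxes b M & P t])%:R.
  rewrite size_map size_filter -sum1_count natr_sum [RHS]big_mkcond /=.
  by apply: eq_bigr => t _; rewrite /ball_indicator -/(P t); case: (P t).
congr _%:R; apply: perm_size; apply: uniq_perm; last 2 first.
- exact: uniq_ball_cycles.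
- move=> th; apply/mapP/idP => [[t]|/mem_ball_cycles [ths cyc]].
    rewrite mem_filter => /andP[Pt _] ->; apply/mem_ball_cycles; split=> //.
    exact: icycle_comb.
  have [t tb Et] := comb_surj cyc; exists t => //.
  rewrite mem_filter mem_int_boxes /P -Et ths tb eqxx /=.
  apply/(all_nthP 0) => i; rewrite tb => ib; apply: (HM (nth 0 t)) => //.
  by rewrite -Et.
rewrite map_inj_in_uniq; first by rewrite filter_uniq // uniq_int_boxes.
move=> t t'; rewrite !mem_filter !mem_int_boxes.
move=> /and3P[_ /eqP tb _] /and3P[_ /eqP tb' _] E1.
apply: (@eq_from_nth _ 0); first by rewrite tb tb'.
by move=> i; rewrite tb => /(comb_inj E1).
Qed.

Lemma ball_indicator_integral s (N : nat) : (0 < N)%N ->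
  iter_lebesgue b (fun t => (ball_indicator s (fun i => Num.floor (N%:R * t i)))%:E) =
  ((ball_count s)%:R / N%:R ^+ b)%:E.
Proof.
move=> N0; have [M HM] := coordinates_bound s.
rewrite (@iter_lebesgue_floor R b N M) //.
  by rewrite (lattice_sum_ball HM) mulrC.
move=> c i ib Mc; rewrite /ball_indicator; case: leqP => // cs.
by have := HM c i ib cs; rewrite leqNgt Mc.
Qed.

Definition floor_defect : nat := (\sum_(i < b) l1norm (gamma i))%N.

Lemma floor_comb_dist (N : nat) (t : nat -> R) :
  `|(l1norm (comb (fun i => Num.floor (N%:R * t i))))%:R - N%:R * l1 (real_combination gamma t)|
    <= floor_defect%:R.
Proof.
rewrite -l1_intr -real_combination_intr.
have -> : N%:R * l1 (real_combination gamma t) = l1 (fun e => N%:R * real_combination gamma t e).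
  by rewrite /l1 mulr_sumr; apply: eq_bigr => e _; rewrite normrM ger0_norm.
apply: le_trans (l1_dist _ _) _.
rewrite /l1 /floor_defect natr_sum.
under [leRHS]eq_bigr do rewrite -(l1_intr R).
rewrite /l1 exchange_big /=; apply: ler_sum => e _.
rewrite /real_combination mulr_sumr -sumrB; apply: le_trans (ler_norm_sum _ _ _) _.
apply: ler_sum => i _; rewrite mulrA -mulrBl normrM ler_piMl //.
have := floor_itv (N%:R * t i); rewrite intrD /= => /andP[f1 f2].
by rewrite distrC ger0_norm; lra.
Qed.

Local Notation volume := (stball_volume src tgt gamma : \bar R).

Lemma stball_volumeE : volume =
  iter_lebesgue b (fun t => ((l1 (real_combination gamma t) <= (1 : R))%R%:R : R)%:E).
Proof.
case: basis => cyc _; rewrite /stball_volume; congr iter_lebesgue; apply/funext => t.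
by rewrite -/(real_combination gamma t) stnormR_real_combination //; case: ifP.
Qed.

(** Rounding [N t] moves its norm by at most [floor_defect]. With [N = n + floor_defect], a rounded
    point of norm at most [n] comes from a [t] in the unit ball; [volume_le] is the converse
    inclusion. *)
Lemma volume_ge n : (0 < n + floor_defect)%N ->
  (((ball_count n)%:R / (n + floor_defect)%:R ^+ b)%:E <= volume)%E.
Proof.
move=> n0; rewrite -ball_indicator_integral // stball_volumeE.
apply: le_iter_lebesgue => t; first by rewrite lee_fin.
rewrite lee_fin /ball_indicator ler_nat.
case: (leqP (l1norm _) n) => // h; rewrite lt0b.
have := floor_comb_dist (n + floor_defect) t; rewrite ler_norml => /andP[h1 h2].
have N0 : 0 < (n + floor_defect)%:R :> R by rewrite ltr0n.
rewrite -(ler_pM2l N0) mulr1; move: h; rewrite -(ler_nat R) => h.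
by have := natrD R n floor_defect; lra.
Qed.

Lemma volume_le (N : nat) : (0 < N)%N ->
  (volume <= ((ball_count (N + floor_defect))%:R / N%:R ^+ b)%:E)%E.
Proof.
move=> N0; rewrite -ball_indicator_integral // stball_volumeE.
apply: le_iter_lebesgue => t; first by rewrite lee_fin.
rewrite lee_fin /ball_indicator ler_nat.
case: leP => // h; rewrite lt0b -(ler_nat R).
have := floor_comb_dist N t; rewrite ler_norml => /andP[h1 h2].
have n0 : 0 < N%:R :> R by rewrite ltr0n.
by have := ler_wpM2l (ltW n0) h; rewrite mulr1 natrD; lra.
Qed.

(** Finiteness shows that [fine] loses nothing; the zero cycle alone makes the lower bound, hence
    the volume, positive. *)
Lemma volume_bounds : [/\ volume = (fine volume)%:E, 0 < fine volume,
  forall n, (0 < n)%N -> (ball_count n)%:R <= fine volume * (n + floor_defect)%:R ^+ b &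
  forall N, (0 < N)%N -> fine volume * N%:R ^+ b <= (ball_count (N + floor_defect))%:R].
Proof.
have lo := volume_ge; have hi := volume_le (ltn0Sn 0).
have volE : volume = (fine volume)%:E.
  apply/esym/fineK; rewrite ge0_fin_numE.
    by apply: le_lt_trans hi _; rewrite ltry.
  by apply: le_trans (lo 1%N (leq_addr _ _)); rewrite lee_fin divr_ge0 // exprn_ge0.
have b1 : (0 < ball_count 1)%N.
  have : (0 : {ffun E -> int}) \in ball_cycles 1.
    apply/mem_ball_cycles; split; last by move=> v; rewrite !big1 // => e _; rewrite ffunE.
    by have /eqP -> : l1norm (0 : {ffun E -> int}) == 0%N by rewrite l1norm_eq0.
  by rewrite /ball_count; case: (ball_cycles 1).
have V0 : 0 < fine volume.
  have := lo 1%N (leq_addr _ _); rewrite volE lee_fin; apply: lt_le_trans.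
  by rewrite divr_gt0 // ?exprn_gt0 // ltr0n.
split=> // [n n0|N N0].
- have nd : (0 < n + floor_defect)%N by rewrite addn_gt0 n0.
  by have := lo n nd; rewrite volE lee_fin ler_pdivrMr // exprn_gt0 // ltr0n.
- by have := volume_le N0; rewrite volE lee_fin ler_pdivlMr // exprn_gt0 // ltr0n.
Qed.

End BallVolume.

(** * Expansion of the number of cycles of given norm *)

Section CountExpansion.

Lemma pow_shift_near (R : realType) b (D e : R) : 0 < e ->
  exists X : R, 1 <= X /\ forall x, X <= x -> `|(x + D) ^+ b - x ^+ b| <= e * x ^+ b.
Proof.
move=> e0; have c1 : {for (1 : R), continuous (fun x : R => x ^+ b)} by exact: exprn_continuous.
move: c1 => /cvgrPdist_lt /(_ e e0) /nbhs_ballP [d d0 Hd].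
exists (Num.max 1 (`|D| / d + 1)); split; first by rewrite le_max lexx.
move=> x; rewrite ge_max => /andP[x1 xD]; have x0 : 0 < x by lra.
have -> : x + D = x * (1 + D / x) by field; rewrite gt_eqF.
have -> : (x * (1 + D / x)) ^+ b - x ^+ b = - (1 ^+ b - (1 + D / x) ^+ b) * x ^+ b.
  by rewrite exprMn expr1n; ring.
rewrite normrM normrN [X in _ * X]ger0_norm ?exprn_ge0 ?(ltW x0) //.
rewrite ler_wpM2r ?exprn_ge0 ?(ltW x0) //; apply/ltW/Hd.
rewrite /ball /= opprD addrA subrr sub0r normrN normrM normfV (gtr0_norm x0).
rewrite ltr_pdivrMr // mulrC -ltr_pdivrMr //; lra.
Qed.

Lemma poly_small_size (R : realType) (b : nat) (q : {poly R}) :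
  (forall e : R, 0 < e -> forall X, exists2 x, X <= x & `|q.[x]| <= e * x ^+ b) ->
  (size q <= b)%N.
Proof.
move=> H; rewrite leqNgt; apply/negP => bq.
pose d := (size q).-1; pose c := lead_coef q.
have q0 : q != 0 by rewrite -size_poly_gt0 (leq_ltn_trans _ bq).
have c0 : 0 < `|c| by rewrite normr_gt0 lead_coef_eq0.
have sq : size q = d.+1 by rewrite /d prednK // size_poly_gt0.
have bd : (b <= d)%N by rewrite -ltnS -sq.
pose S := \sum_(i < d) `|q`_i|.
have S0 : 0 <= S by apply: sumr_ge0.
(* If the degree [d] were at least [b], then for [x >= 2 S / |c|] the lower terms would be at most
   [|c| / 2 * x^d] and the value at most [|c| / 4 * x^d], too little together to balance the leading
   term. *)
have c4 : 0 < `|c| / 4 by rewrite divr_gt0.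
have [x xX Hx] := H _ c4 (1 + 2 * S / `|c|).
have Sc : 0 <= 2 * S / `|c| by rewrite divr_ge0 ?mulr_ge0.
have x1 : 1 <= x by lra.
have x0 : 0 < x by lra.
have xb : x ^+ b <= x ^+ d by rewrite ler_weXn2l.
have Sx : 2 * S <= `|c| * x by rewrite [leRHS]mulrC -ler_pdivrMr //; lra.
have E1 : q.[x] = \sum_(i < d) q`_i * x ^+ i + c * x ^+ d.
  by rewrite horner_coef sq big_ord_recr /= /c lead_coefE.
have xd0 : 0 < x ^+ d by rewrite exprn_gt0.
have low : `|\sum_(i < d) q`_i * x ^+ i| * x <= S * x ^+ d.
  rewrite -[X in _ * X <= _](ger0_norm (ltW x0)) -normrM mulr_suml.
  apply: le_trans (ler_norm_sum _ _ _) _; rewrite mulr_suml; apply: ler_sum => i _.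
  rewrite !normrM -mulrA ler_wpM2l // normrX (ger0_norm (ltW x0)) -exprSr.
  by rewrite ler_weXn2l.
have tri : `|c| * x ^+ d <= `|q.[x]| + `|\sum_(i < d) q`_i * x ^+ i|.
  rewrite -(ger0_norm (ltW xd0)) -normrM.
  have -> : c * x ^+ d = q.[x] - \sum_(i < d) q`_i * x ^+ i by rewrite E1; ring.
  exact: ler_normB.
have h1 : `|q.[x]| <= `|c| / 4 * x ^+ d.
  by apply: le_trans Hx _; rewrite ler_wpM2l // ltW.
set s := `|\sum_(i < d) _| in low tri.
have h2 : s * x <= `|c| / 2 * x ^+ d * x.
  apply: (le_trans low).
  have -> : `|c| / 2 * x ^+ d * x = (`|c| / 2 * x) * x ^+ d by ring.
  by rewrite ler_wpM2r ?(ltW xd0) //; lra.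
rewrite ler_pM2r // in h2.
have : 0 < `|c| * x ^+ d by rewrite mulr_gt0.
lra.
Qed.

Lemma coef_comp_XD1 (p : {poly rat}) n l : (size p <= n)%N ->
  (p \Po ('X + 1))`_l = \sum_(i < n) p`_i *+ 'C(i, l).
Proof.
move=> pn; have E : p = \sum_(i < n) p`_i *: 'X^i.
  rewrite -poly_def; apply/polyP => i; rewrite coef_poly; case: ltnP => // ni.
  by rewrite nth_default // (leq_trans pn).
rewrite {1}E raddf_sum /= coef_sum; apply: eq_bigr => i _.
rewrite linearZ /= coefZ comp_Xn_poly -[RHS]mulr_natr; congr (_ * _).
rewrite addrC exprDn coef_sum (eq_bigr (fun j : 'I_i.+1 => (j == l :> nat)%:R *+ 'C(i, j))).
  have [li|il] := ltnP l i.+1.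
    rewrite (bigD1 (Ordinal li)) //= eqxx big1 ?addr0 // => j jl.
    by rewrite -val_eqE /= in jl; rewrite (negbTE jl) mul0rn.
  rewrite bin_small // big1 // => j _.
  by rewrite (ltn_eqF (leq_trans (ltn_ord j) il)) mul0rn.
by move=> j _; rewrite expr1n mul1r coefMn coefXn eq_sym.
Qed.

Lemma subnS_addn p k : (k.+2 <= p)%N -> (p - k.+1 + k = p.-1)%N.
Proof. lia. Qed.

Lemma sum_cyclic_shift (m : nat) (c : nat -> rat) : (0 < m)%N ->
  \sum_(r < m) c (r.+1 %% m)%N = \sum_(r < m) c r.
Proof.
case: m => // m _; rewrite big_ord_recr /= modnn addrC [RHS]big_ord_recl /=; congr (_ + _).
by apply: eq_bigr => r _; rewrite modn_small // ltnS.
Qed.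

Variables (R : realType) (V E : finType) (src tgt : E -> V).
Hypothesis conn : graph_connected src tgt.
Variables (b : nat) (gamma : 'I_b -> {ffun E -> int}).
Hypothesis basis : Zbasis src tgt gamma.
Local Notation volume := (stball_volume src tgt gamma : \bar R).
Local Notation cnt n := (size (cycles_of_norm src tgt n)).
Local Notation L := (ball_count src tgt).

Lemma ball_count_asymptotic (e : R) : 0 < e -> exists N, forall n, (N <= n)%N ->
  `|(L n.-1)%:R - fine volume * n%:R ^+ b| <= e * n%:R ^+ b.
Proof.
move=> e0; have [_ v0 hi lo] := volume_bounds R conn basis.
set v := fine volume in v0 hi lo *; set fd := floor_defect gamma in hi lo.
have ev : 0 < e / v by exact: divr_gt0.
have [X1 [X11 H1]] := pow_shift_near b (fd%:R : R) ev.
have [X2 [X21 H2]] := pow_shift_near b (- fd.+1%:R : R) ev.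
exists ((Num.truncn (Num.max X1 X2)).+1 + fd.+2)%N => n Nn.
have nX : Num.max X1 X2 <= n%:R.
  apply: (le_trans (ltW (truncnS_gt _))); rewrite ler_nat.
  by apply: leq_trans Nn; exact: leq_addr.
move: nX; rewrite ge_max => /andP[/H1 h1 /H2 h2].
have fn : (fd.+2 <= n)%N by apply: leq_trans Nn; exact: leq_addl.
have n1 : (0 < n.-1)%N by case: (n) fn => // -[].
have up : (L n.-1)%:R <= v * (n%:R + fd%:R) ^+ b.
  apply: (le_trans (hi _ n1)); rewrite ler_wpM2l ?(ltW v0) // lerXn2r ?nnegrE ?addr_ge0 //.
  by rewrite natrD lerD2r ler_nat leq_pred.
have N1 : (0 < n - fd.+1)%N by rewrite subn_gt0.
have := lo _ N1; rewrite subnS_addn //.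
rewrite natrB ?(ltnW fn) // => low.
move: h1 h2; rewrite !ler_norml => /andP[_ h1] /andP[h2 _].
have k1 := ler_wpM2l (ltW v0) h1; have k2 := ler_wpM2l (ltW v0) h2.
have E1 : v * (e / v * n%:R ^+ b) = e * n%:R ^+ b by field; rewrite gt_eqF.
rewrite mulrN E1 in k2; rewrite E1 in k1; rewrite !mulrBr in k1 k2.
by apply/andP; split; lra.
Qed.

Lemma cycle_count_expansion : (1 <= b)%N -> exists m (vq : rat) (A : nat -> nat -> rat),
  [/\ (0 < m)%N, ratr vq = fine volume,
   forall n, (0 < n)%N -> (cnt n)%:R = \sum_(l < b) A l (n %% m)%N * n%:R ^+ l :> rat &
   \sum_(r < m) A b.-1 r = m%:R * (b%:R * vq)].
Proof.
move=> b1.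
(* The shift to [n.-1] puts [L n = L n.-1 + cnt n] in the form [g (n + 1) = g n + f n]. *)
have : quasi_poly (fun n => (L n.-1)%:R).
  apply: (@quasi_poly_antidifference 1 (fun n => (cnt n)%:R)) => //.
    exact: quasi_poly_cycle_count.
  by case=> // n _; rewrite addn1 /= ball_countS natrD.
move=> [m m0 [Q HQ]].
have coefQ r : (r < m)%N -> (size (Q r) <= b.+1)%N /\ ratr (Q r)`_b = fine volume.
  move=> rm; pose q : {poly R} := map_poly ratr (Q r) - (fine volume) *: 'X^b.
  have sq : (size q <= b)%N.
    apply: poly_small_size => e e0 X.
    have [N HN] := ball_count_asymptotic e0.
    (* An element of the class of [r] beyond both the threshold [N] and the given [X]. *)
    pose n := (r + m * (N + (Num.truncn X).+1))%N.
    have nN : (N + (Num.truncn X).+1 <= n)%N.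
      by apply: leq_trans (leq_addl _ _); exact: leq_pmull.
    exists n%:R.
      apply: (le_trans (ltW (truncnS_gt _))); rewrite ler_nat.
      by apply: leq_trans nN; exact: leq_addl.
    have := HN n (leq_trans (leq_addr _ _) nN).
    rewrite /q hornerD hornerN hornerZ hornerXn.
    have -> : n%:R = ratr n%:R :> R by rewrite ratr_nat.
    rewrite horner_map /=.
    have n0 : (0 < n)%N by apply: leq_trans nN; rewrite addnS.
    have nm : (n %% m = r)%N by rewrite /n addnC mulnC modnMDl modn_small.
    have := HQ n n0; rewrite nm => <-.
    by rewrite !ratr_nat.
  have cq i : (b <= i)%N -> ratr (Q r)`_i = (i == b)%:R * fine volume :> R.
    move=> bi; have : q`_i = 0 by rewrite nth_default // (leq_trans sq).
    rewrite /q coefB coef_map coefZ coefXn => /eqP; rewrite subr_eq0 => /eqP ->.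
    by rewrite mulrC.
  split; last by rewrite cq // eqxx mul1r.
  apply/leq_sizeP => i bi; apply/eqP; rewrite -(fmorph_eq0 (ratr : {rmorphism rat -> R})) /=.
  by rewrite cq ?(ltnW bi) // gtn_eqF // mul0r.
pose vq := (Q 0%N)`_b.
have vqE : ratr vq = fine volume by have [] := coefQ 0%N m0.
have Qb r : (r < m)%N -> (Q r)`_b = vq.
  move=> rm; apply: (fmorph_inj (ratr : {rmorphism rat -> R})) => /=.
  by rewrite vqE; have [] := coefQ r rm.
pose P r := (Q (r.+1 %% m)%N \Po ('X + 1)) - Q r.
have coefP r l : (r < m)%N ->
  (P r)`_l = \sum_(i < b.+1) (Q (r.+1 %% m)%N)`_i *+ 'C(i, l) - (Q r)`_l.
  by move=> rm; rewrite coefB (@coef_comp_XD1 _ b.+1) //; have [] := coefQ _ (ltn_pmod r.+1 m0).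
have sP r : (r < m)%N -> (size (P r) <= b)%N.
  move=> rm; apply/leq_sizeP => l bl; rewrite coefP // big_ord_recr /= big1 ?add0r; last first.
    by move=> i _; rewrite bin_small ?mulr0n // (leq_trans (ltn_ord i)).
  move: bl; rewrite leq_eqVlt => /predU1P[<-|bl].
    by rewrite binn mulr1n !Qb ?ltn_pmod // subrr.
  rewrite bin_small // mulr0n sub0r nth_default ?oppr0 //.
  by have [s _] := coefQ r rm; exact: leq_trans s bl.
exists m, vq, (fun l r => (P r)`_l); split=> //.
  move=> n n0; have rm := ltn_pmod n m0.
  have -> : (cnt n)%:R = (P (n %% m)%N).[n%:R].
    rewrite /P hornerD hornerN horner_comp hornerD hornerX hornerC -HQ //.
    have -> : ((n %% m).+1 %% m = n.+1 %% m)%N by rewrite -addn1 modnDml addn1.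
    rewrite natr1 -HQ //= -[in L n](prednK n0) ball_countS prednK // natrD.
    by rewrite addrC addKr.
  rewrite (horner_coef_wide _ (sP _ rm)).
  by [].
pose c r := (Q r)`_b.-1.
have Pc r : (r < m)%N -> (P r)`_b.-1 = b%:R * vq + c (r.+1 %% m)%N - c r.
  have bb : (b.-1 < b)%N by rewrite prednK.
  move=> rm; rewrite coefP // big_ord_recr /= (bigD1 (Ordinal bb)) //=.
  rewrite big1 ?addr0; last first.
    move=> i; rewrite -val_eqE /= => ib; rewrite bin_small // ltn_neqAle ib /=.
    by rewrite -ltnS prednK.
  rewrite binn mulr1n Qb ?ltn_pmod // /c.
  have -> : 'C(b, b.-1) = b by rewrite -{1}(prednK b1) binSn prednK.
  by rewrite -mulr_natl; ring.
rewrite (eq_bigr (fun r : 'I_m => b%:R * vq + c (r.+1 %% m)%N - c r)); last first.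
  by move=> r _; rewrite Pc.
rewrite sumrB big_split /= sum_cyclic_shift // addrK sumr_const card_ord.
by rewrite -[LHS]mulr_natl.
Qed.

End CountExpansion.

(** * Limits at a punctured point and residues of shifted zeta functions *)

Section PuncturedLimits.
Variable R : realType.
Implicit Types (f g : R[i] -> R[i]) (z c : R[i]).

Lemma cvg_at_pointP f z (l : R[i]) : f @ z^' --> l <->
  forall e : R, 0 < e -> exists2 d : R, 0 < d &
    forall w, w != z -> cabs (w - z) < d -> cabs (f w - l) < e.
Proof.
by split=> [/ccvgP H e /H /dnbhsCP|H]; [ | apply/ccvgP => e /H h; apply/dnbhsCP].
Qed.

Lemma cvg_at_pointD f g z (l k : R[i]) : f @ z^' --> l -> g @ z^' --> k ->
  (fun w => f w + g w) @ z^' --> l + k.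
Proof.
move=> /cvg_at_pointP fl /cvg_at_pointP gk; apply/cvg_at_pointP => e e0.
have e2 : 0 < e / 2 by rewrite divr_gt0.
have [d d0 Hd] := fl _ e2; have [d' d'0 Hd'] := gk _ e2.
exists (Num.min d d'); first by rewrite lt_min d0.
move=> w wz; rewrite lt_min => /andP[/(Hd w wz) h1 /(Hd' w wz) h2].
have -> : f w + g w - (l + k) = (f w - l) + (g w - k) by ring.
by apply: le_lt_trans (cabsD _ _) _; lra.
Qed.

Lemma cvg_at_pointM f g z (l k : R[i]) : f @ z^' --> l -> g @ z^' --> k ->
  (fun w => f w * g w) @ z^' --> l * k.
Proof.
move=> /cvg_at_pointP fl /cvg_at_pointP gk; apply/cvg_at_pointP => e e0.
pose M := cabs l + cabs k + 1.
have M0 : 0 < M by rewrite ltr_wpDl // addr_ge0 ?cabs_ge0.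
have eM : 0 < Num.min 1 (e / (2 * M)) by rewrite lt_min ltr01 divr_gt0 // mulr_gt0.
have [d d0 Hd] := fl _ eM; have [d' d'0 Hd'] := gk _ eM.
exists (Num.min d d'); first by rewrite lt_min d0.
move=> w wz; rewrite lt_min => /andP[/(Hd w wz) + /(Hd' w wz)].
rewrite !lt_min => /andP[h1 h2] /andP[h3 h4].
rewrite ltr_pdivlMr ?mulr_gt0 // in h2; rewrite ltr_pdivlMr ?mulr_gt0 // in h4.
have -> : f w * g w - l * k = (f w - l) * k + l * (g w - k) + (f w - l) * (g w - k) by ring.
apply: le_lt_trans (cabsD _ _) _; apply: le_lt_trans (lerD (cabsD _ _) (lexx _)) _.
rewrite !cabsM; set A := cabs (f w - l) in h1 h2 *; set B := cabs (g w - k) in h3 h4 *.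
have [A0 B0] : 0 <= A /\ 0 <= B by split; exact: cabs_ge0.
have AB : A * B <= A by rewrite ler_piMr // ltW.
have [l0 k0] : 0 <= cabs l /\ 0 <= cabs k by split; exact: cabs_ge0.
have a1 : A * (cabs k + 1) <= A * M by rewrite ler_wpM2l // /M; lra.
have b1 : B * cabs l <= B * M by rewrite ler_wpM2l // /M; lra.
by rewrite [cabs l * B]mulrC; lra.
Qed.

Lemma cvg_at_point_cst c z : (fun=> c) @ z^' --> c.
Proof.
by apply/cvg_at_pointP => e e0; exists 1 => // w _ _; rewrite subrr cabs0.
Qed.

Lemma cvg_at_point_cdiff f z : cdifferentiable f z -> f @ z^' --> f z.
Proof.
move=> /cdiff_continuous fc; apply/cvg_at_pointP => e /fc [d d0 Hd].
by exists d => // w _ /Hd.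
Qed.

Lemma cvg_at_point_sum (I : Type) (r : seq I) (F : I -> R[i] -> R[i]) (G : I -> R[i]) z :
  (forall i, F i @ z^' --> G i) ->
  (fun w => \sum_(i <- r) F i w) @ z^' --> \sum_(i <- r) G i.
Proof.
move=> FG; elim: r => [|i r IH].
  have -> : (fun w => \sum_(j <- [::]) F j w) = fun=> 0 by apply/funext => w; rewrite big_nil.
  by rewrite big_nil; exact: cvg_at_point_cst.
have -> : (fun w => \sum_(j <- i :: r) F j w) = (fun w => F i w + \sum_(j <- r) F j w).
  by apply/funext => w; rewrite big_cons.
rewrite [\sum_(j <- i :: r) G j]big_cons; exact: (cvg_at_pointD (FG i) IH).
Qed.

Lemma cvg_at_point_shift f z c (l : R[i]) : f @ (z - c)^' --> l ->
  (fun w => f (w - c)) @ z^' --> l.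
Proof.
move=> /cvg_at_pointP H; apply/cvg_at_pointP => e /H [d d0 Hd].
exists d => // w wz wd; apply: Hd.
  by apply: contra wz => /eqP/addIr ->.
by have -> : w - c - (z - c) = w - z by ring.
Qed.

Lemma cdiff_hurwitz_shift (q : R) c z : 0 < q -> z - c != 1 ->
  cdifferentiable (fun w => hurwitz_zeta q (w - c)) z.
Proof.
move=> q0 zc; apply: (@cdiff_comp _ (fun w => w - c)); last exact: cdiff_hurwitz_zeta.
by apply: cdiffD; [exact: cdiff_id | exact: cdiff_cst].
Qed.

(** Off the pole the function is continuous at [z] and the factor [w - z] kills it. The boolean
    merges both cases, so that all terms of a sum of zeta functions are treated alike. *)
Lemma hurwitz_shift_residue (q : R) c z : 0 < q ->
  (fun w => (w - z) * hurwitz_zeta q (w - c)) @ z^' --> ((z - c == 1)%:R : R[i]).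
Proof.
move=> q0; have [zc|zc] := eqVneq (z - c) 1.
  have -> : (fun w => (w - z) * hurwitz_zeta q (w - c)) =
            (fun w => (fun s => (s - 1) * hurwitz_zeta q s) (w - c)).
    apply/funext => w; congr (_ * _); rewrite -zc; ring.
  have := @cvg_at_point_shift (fun s => (s - 1) * hurwitz_zeta q s) z c 1.
  by rewrite zc; apply; exact: hurwitz_zeta_residue.
have d1 : cdifferentiable (fun w => w - z) z.
  by apply: cdiffD; [exact: cdiff_id | exact: cdiff_cst].
have := cvg_at_pointM (cvg_at_point_cdiff d1) (cvg_at_point_cdiff (cdiff_hurwitz_shift q0 zc)).
by rewrite subrr mul0r.
Qed.

End PuncturedLimits.

(** * Dirichlet series over residue classes *)

Section ResidueClassSums.
Variable R : realType.

(** Classes are represented by [1 <= k <= m], so that the Hurwitz parameter [k / m] is positive. The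
    new upper bound is the number of [n <= N] in the class; it grows by one exactly when [N.+1]
    belongs to it. *)
Lemma sum_residue_class (phi : nat -> R[i]) m k N : (0 < k)%N -> (k <= m)%N ->
  \sum_(1 <= n < N.+1) (if n == k %[mod m] then phi n else 0) =
  \sum_(0 <= j < (N + m - k) %/ m) phi (k + m * j)%N.
Proof.
move=> k0 km; have m0 : (0 < m)%N by exact: leq_trans km.
elim: N => [|N IH].
  by rewrite big_geq // add0n divn_small ?big_geq // ltn_subrL k0.
rewrite big_nat_recr //= IH addSn subSn ?(leq_trans km) ?leq_addl // divnS //.
have -> : (m %| (N + m - k).+1)%N = (N.+1 == k %[mod m]).
  rewrite -subSn ?(leq_trans km) ?leq_addl // -addSn.
  by rewrite -eqn_mod_dvd ?modnDr // (leq_trans km) ?leq_addl.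
case: ifP => [h|_]; last by rewrite addr0.
rewrite add1n big_nat_recr //=; congr (_ + phi _).
have : (m %| (N + m - k).+1)%N.
  rewrite -subSn ?(leq_trans km) ?leq_addl // -addSn.
  by rewrite -eqn_mod_dvd ?modnDr // (leq_trans km) ?leq_addl.
move=> /dvdnP [x Ex]; have : ((N + m - k).+1 %/ m = x)%N by rewrite Ex mulnK.
rewrite divnS // {1}Ex dvdn_mull // add1n => Ex'.
move: Ex; rewrite -Ex' mulSn mulnC; move: (m * _)%N => X; lia.
Qed.

Lemma cpow_arith_progression (m k j : nat) (w : R[i]) : (0 < m)%N -> (0 < k)%N ->
  cpow ((k + m * j)%N%:R : R) w = cpow m%:R w * cpow (k%:R / m%:R + j%:R) w.
Proof.
move=> m0 k0; have m0' : 0 < m%:R :> R by rewrite ltr0n.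
have k0' : 0 < k%:R :> R by rewrite ltr0n.
rewrite -cpowMl //; last by rewrite ltr_wpDr // divr_gt0.
have -> // : (k + m * j)%N%:R = m%:R * (k%:R / m%:R + j%:R) :> R.
by rewrite natrD natrM; field; rewrite gt_eqF.
Qed.

Lemma seqlim_subseq (u : nat -> R[i]) L (J : nat -> nat) :
  (forall M, exists N0, forall N, (N0 <= N)%N -> (M <= J N)%N) ->
  seqlim u L -> seqlim (fun N => u (J N)) L.
Proof.
move=> HJ uL e /uL [M HM]; have [N0 HN0] := HJ M.
by exists N0 => N /HN0 /HM.
Qed.

Lemma residue_class_series (m k : nat) (w : R[i]) : (0 < k)%N -> (k <= m)%N ->
  1 < complex.Re w ->
  seqlim (fun N => \sum_(1 <= n < N.+1) (if n == k %[mod m] then cpow n%:R (- w) else 0))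
    (cpow m%:R (- w) * hurwitz_zeta (k%:R / m%:R : R) w).
Proof.
move=> k0 km w1; have m0 : (0 < m)%N by exact: leq_trans km.
have q0 : 0 < k%:R / m%:R :> R by rewrite divr_gt0 // ltr0n.
have -> : (fun N => \sum_(1 <= n < N.+1) (if n == k %[mod m] then cpow n%:R (- w) else 0)) =
  (fun N => cpow m%:R (- w) * hurwitz_partial (k%:R / m%:R : R) w ((N + m - k) %/ m)).
  apply/funext => N; rewrite (sum_residue_class (fun n => cpow n%:R (- w))) //.
  rewrite /hurwitz_partial mulr_sumr; apply: eq_bigr => j _.
  exact: cpow_arith_progression.
apply: seqlimZ; apply: (@seqlim_subseq (hurwitz_partial (k%:R / m%:R) w)).
  move=> M; exists (M * m + k)%N => N HN; rewrite leq_divRL //.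
  by move: HN km; move: (M * m)%N => X; lia.
exact: hurwitz_zeta_series.
Qed.

Lemma sum_over_residues (m n : nat) (p : nat -> R[i]) (x : R[i]) : (0 < m)%N ->
  (forall k, p (k %% m)%N = p k) ->
  \sum_(1 <= k < m.+1) p k * (if n == k %[mod m] then x else 0) = p n * x.
Proof.
(* The representative of [n] between 1 and [m]. *)
move=> m0 pm; pose k0 := if (n %% m)%N == 0%N then m else (n %% m)%N.
have k0m : (k0 %% m = n %% m)%N by rewrite /k0; case: eqP => [->|_]; rewrite ?modnn ?modn_mod.
have k0r : (0 < k0 <= m)%N.
  by rewrite /k0; case: eqP => [_|/eqP]; rewrite ?m0 ?leqnn // lt0n => -> /=; rewrite ltnW // ltn_pmod.
rewrite (bigD1_seq k0) ?iota_uniq ?mem_index_iota ?ltnS //= k0m eqxx.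
rewrite -(pm k0) k0m pm big_seq_cond big1 ?addr0 // => k.
rewrite mem_index_iota ltnS => /andP[/andP[k1 km] kk0].
case: eqP => [E|]; last by rewrite mulr0.
case/eqP: kk0; rewrite /k0; move: E.
have [->|kne] := eqVneq k m; first by rewrite modnn => ->; rewrite eqxx.
have km' : (k < m)%N by rewrite ltn_neqAle kne.
by rewrite (modn_small km') => ->; rewrite gtn_eqF.
Qed.

End ResidueClassSums.

(** * Partial sums of the stable zeta function, grouped by norm *)

Section StableZeta.
Variables (R : realType) (V E : finType) (src tgt : E -> V).
Hypothesis conn : graph_connected src tgt.
Local Notation cycles := (cycles_of_norm src tgt).
Local Notation cnt n := (size (cycles_of_norm src tgt n)).
Local Notation L := (ball_count src tgt).
Implicit Types (z : R[i]) (t : R).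

Definition nonzero_cycles N : seq {ffun E -> int} := flatten [seq cycles k | k <- iota 1 N].

Lemma ball_nonzero_cycles N : ball_cycles src tgt N = cycles 0 ++ nonzero_cycles N.
Proof. by []. Qed.

Lemma uniq_nonzero_cycles N : uniq (nonzero_cycles N).
Proof.
by have := uniq_ball_cycles src tgt N; rewrite ball_nonzero_cycles cat_uniq => /and3P[].
Qed.

Lemma mem_nonzero_cycles N th : th \in nonzero_cycles N <->
  [/\ icycle src tgt th, th != 0 & (l1norm th <= N)%N].
Proof.
split.
  move=> /flatten_mapP [k]; rewrite mem_iota add1n ltnS => /andP[k1 kN].
  move=> /mem_cycles_of_norm [hk c]; split=> //; last by rewrite hk.
  by rewrite -l1norm_eq0 hk -lt0n.
move=> [c th0 hN]; apply/flatten_mapP; exists (l1norm th).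
  by rewrite mem_iota add1n ltnS hN lt0n l1norm_eq0 th0.
exact/mem_cycles_of_norm.
Qed.

Lemma zeta_indexE t : 0 <= t -> zeta_index src tgt t = [set` nonzero_cycles (Num.truncn t)].
Proof.
move=> t0; apply/seteqP; split=> th /=.
  move=> [c [th0 h]]; apply/mem_nonzero_cycles; split=> //.
  by rewrite truncn_ge_nat // -(stnormE R conn c).
move=> /mem_nonzero_cycles [c th0 h]; split=> //; split=> //.
by rewrite stnormE // -truncn_ge_nat.
Qed.

Lemma finite_zeta_index t : 0 <= t -> finite_set (zeta_index src tgt t).
Proof. by move=> t0; rewrite zeta_indexE //; exact: finite_seq. Qed.

Definition dirichlet z N : R[i] := \sum_(1 <= n < N.+1) (cnt n)%:R * cpow n%:R (- z).

Lemma zeta_st_partialE z t : 0 <= t ->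
  zeta_st_partial src tgt z t = dirichlet z (Num.truncn t).
Proof.
move=> t0; rewrite /zeta_st_partial zeta_indexE // -fsbig_seq ?uniq_nonzero_cycles //=.
rewrite big_flatten big_map /dirichlet /index_iota subn1 /=.
apply: eq_bigr => n _; rewrite big_seq (eq_bigr (fun=> cpow n%:R (- z))).
  by rewrite -big_seq big_const_seq count_predT iter_addr addr0 mulr_natl.
by move=> th /mem_cycles_of_norm [h c]; rewrite stnormE // h.
Qed.

(** Norms of cycles are integers, so the partial sums are constant between consecutive integers. *)
Lemma zeta_st_partial_cvg z (l : R[i]) :
  zeta_st_partial src tgt z t @[t --> +oo] --> l <-> seqlim (dirichlet z) l.
Proof.
split=> [/ccvgP H e /H|H].
  move=> [A [Ar HA]].
  exists (Num.truncn `|A|).+1 => n An.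
  have := HA n%:R; rewrite zeta_st_partialE // natrK; apply.
  apply: (le_lt_trans (ler_norm A)); apply: (lt_le_trans (truncnS_gt _)).
  by rewrite ler_nat.
apply/ccvgP => e /H [N HN]; exists N%:R; split; first exact: num_real.
move=> t Nt; have t0 : 0 <= t by apply: le_trans (ltW Nt).
rewrite zeta_st_partialE //; apply: HN.
by rewrite truncn_ge_nat // ltW.
Qed.

End StableZeta.

(** * Divergence to the left of [b] *)

Section StableZetaTheorem.
Variables (R : realType) (V E : finType) (src tgt : E -> V).
Hypothesis conn : graph_connected src tgt.
Variables (b : nat) (gamma : 'I_b -> {ffun E -> int}).
Hypothesis basis : Zbasis src tgt gamma.
Hypothesis b1 : (1 <= b)%N.
Local Notation cnt n := (size (cycles_of_norm src tgt n)).
Local Notation L := (ball_count src tgt).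
Local Notation vol := (fine (stball_volume src tgt gamma) : R).
Local Notation dirichlet := (dirichlet src tgt).

Lemma ball_count_sum s : L s = (\sum_(0 <= k < s.+1) cnt k)%N.
Proof.
elim: s => [|s IH]; last by rewrite ball_countS IH [RHS]big_nat_recr.
by rewrite big_nat1 /ball_count /ball_cycles /= cats0.
Qed.

(** As [(1 + 1/j)^b >= 1 + 1/j], the main terms differ by at least [vol / j] times [x = (j M)^b].
    With [e = vol / (6 j)] the asymptotic errors cost at most [3 e x], half of that. *)
Lemma ball_count_block (j : nat) : (0 < j)%N -> exists N0, forall M, (N0 <= M)%N ->
  vol / 2 / j%:R * (j * M)%N%:R ^+ b <= (L (j.+1 * M).-1)%:R - (L (j * M).-1)%:R.
Proof.
move=> j0; have [_ v0 _ _] := volume_bounds R conn basis.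
have jR : 0 < j%:R :> R by rewrite ltr0n.
pose e := vol / 6 / j%:R; have e0 : 0 < e by rewrite !divr_gt0.
have [N0 HN] := ball_count_asymptotic conn basis e0.
exists N0.+1 => M NM; have N0M := ltnW NM.
have M0 : (0 < M)%N by apply: leq_trans NM.
have h1 := HN (j * M)%N (leq_trans N0M (leq_pmull _ j0)).
have h2 := HN (j.+1 * M)%N (leq_trans N0M (leq_pmull _ (ltn0Sn _))).
move: h1 h2; rewrite !ler_norml => /andP[_ h1] /andP[h2 _].
set x := (j * M)%N%:R ^+ b in h1 *; set y := (j.+1 * M)%N%:R ^+ b in h2.
have x0 : 0 < x by rewrite exprn_gt0 // ltr0n muln_gt0 j0.
have xy : (1 + j%:R^-1) * x <= y.
  rewrite /y; have -> : (j.+1 * M)%N%:R = (1 + j%:R^-1) * (j * M)%N%:R :> R.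
    by rewrite !natrM -natr1; field; rewrite gt_eqF.
  rewrite exprMn ler_wpM2r ?(ltW x0) //.
  have k1 : 1 <= 1 + j%:R^-1 :> R by rewrite lerDl invr_ge0 ltW.
  rewrite -{1}[1 + _]expr1; exact: ler_weXn2l.
have ej : e < vol.
  rewrite /e -mulrA gtr_pMr // -invfM invf_lt1 ?mulr_gt0 //.
  have : 1 <= j%:R :> R by rewrite ler1n.
  lra.
have low : (vol - e) * ((1 + j%:R^-1) * x) <= (L (j.+1 * M).-1)%:R.
  apply: (@le_trans _ _ ((vol - e) * y)); first by rewrite ler_wpM2l // subr_ge0 ltW.
  by rewrite mulrBl; lra.
have up : (L (j * M).-1)%:R <= (vol + e) * x by rewrite mulrDl; lra.
have -> : vol / 2 / j%:R * x = (vol - e) * ((1 + j%:R^-1) * x) - (vol + e) * x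
   + (vol / 6 / j%:R / j%:R - vol / 6 / j%:R) * x.
  by rewrite /e; field; rewrite gt_eqF.
have : (vol / 6 / j%:R / j%:R - vol / 6 / j%:R) * x <= 0.
  rewrite pmulr_lle0 // subr_le0 ler_pdivrMr // ler_peMr ?(ltW e0) // ler1n //.
lra.
Qed.

(* On a short block N < n <= N + N/j the arguments of n^(-z) N^z stay near 0, so the
   block of the Dirichlet series is comparable to N^(-Re z) times the number of cycles. *)
Lemma stable_zeta_diverges (z : R[i]) : complex.Re z < b%:R -> ~ zeta_st_converges src tgt z.
Proof.
move=> zb [_ [l /(zeta_st_partial_cvg conn) lim]].
have [_ v0 _ _] := volume_bounds R conn basis.
set sg := complex.Re z in zb; set tau := complex.Im z.
have [d d0 Hd] : exists2 d : R, 0 < d & forall s : R, `|s| < d -> 1 / 2 <= cos s.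
  have half : 0 < 1 / 2 :> R by rewrite divr_gt0.
  have [d d0 H] := is_derive_eps (is_derive_cos (0 : R)) half.
  exists (Num.min d 1); first by rewrite lt_min d0 ltr01.
  move=> s; rewrite lt_min => /andP[/H + s1].
  rewrite add0r cos0 sin0 oppr0 mul0r subr0 ler_norml => /andP[h1 h2].
  by have := normr_ge0 s; lra.
(* On the block [n / N <= 1 + 1/j], so the argument [tau * ln (n / N)] stays below [|tau| / j < d],
   where the cosine is at least 1/2. *)
pose j := (Num.truncn (`|tau| / d)).+1.
have j0 : (0 < j)%N by [].
have jR : 0 < j%:R :> R by rewrite ltr0n.
have jd : `|tau| / j%:R < d.
  by rewrite ltr_pdivrMr // mulrC -ltr_pdivrMr //; exact: truncnS_gt.
have [N0 HN0] := ball_count_block j0.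
(* In units of [vol / j * N^b * exp (- |sg|)], the Cauchy criterion bounds the block by 1/8, whereas
   its real part is at least 1/4. *)
pose e := vol / 16 / j%:R * expR (- `|sg|).
have e0 : 0 < e by rewrite mulr_gt0 ?expR_gt0 // !divr_gt0.
have [N1 HN1] := lim _ e0.
pose M := (N0 + N1).+1; pose N := (j * M)%N; pose N' := (j.+1 * M)%N.
have MN : (M <= N)%N by exact: leq_pmull.
have NN' : (N <= N')%N by rewrite /N /N' leq_mul2r leqnSn orbT.
have N00 : (0 < N)%N by apply: leq_trans MN.
have NR : 0 < N%:R :> R by rewrite ltr0n.
have N1N : (N1 <= N.-1)%N by rewrite -ltnS prednK // (leq_trans _ MN) // ltnS leq_addl.
have h1 := HN1 _ N1N; have h2 := HN1 N'.-1 ltac:(by apply: leq_trans N1N _; rewrite -!subn1 leq_sub2r).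
have h3 := HN0 M ltac:(by rewrite /M -addnS leq_addr).
have blk (f : nat -> R[i]) : \sum_(1 <= n < N'.-1.+1) f n - \sum_(1 <= n < N.-1.+1) f n =
    \sum_(N <= n < N') f n.
  rewrite !prednK ?(leq_trans N00) //.
  by rewrite (@big_cat_nat _ _ _ N 1 N') //= addrAC subrr add0r.
have D1 : cabs (\sum_(N <= n < N') (cnt n)%:R * cpow n%:R (- z)) < 2 * e.
  rewrite -blk; have := cabs_distD (dirichlet z N'.-1) l (dirichlet z N.-1).
  by rewrite [cabs (l - _)]cabsB; lra.
have xN : expR (sg * ln N%:R) <= N%:R ^+ b.
  have lnN : 0 <= ln (N%:R : R) by rewrite ln_ge0 // ler1n.
  rewrite -{2}(lnK NR) -expRM_natl ler_expR ler_wpM2r //; exact: ltW.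
set W := \sum_(N <= n < N') _ in D1.
have D2 : cabs (W * cpow N%:R z) <= 2 * e * N%:R ^+ b.
  rewrite cabsM cabs_cpow; apply: ler_pM; rewrite ?cabs_ge0 ?expR_ge0 //; exact: ltW.
have D3 : ((L N'.-1)%:R - (L N.-1)%:R) * (expR (- `|sg|) / 2) <= complex.Re (W * cpow N%:R z).
  have -> : (L N'.-1)%:R - (L N.-1)%:R = \sum_(N <= n < N') (cnt n)%:R :> R.
    rewrite !ball_count_sum !prednK ?(leq_trans N00) // !natr_sum.
    by rewrite (@big_cat_nat _ _ _ N 0 N') //= addrAC subrr add0r.
  rewrite /W !mulr_suml Re_sum big_nat [leRHS]big_nat; apply: ler_sum => n /andP[Nn nN'].
  have n0 : 0 < n%:R :> R by rewrite ltr0n (leq_trans N00).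
  pose u : R := ln n%:R - ln N%:R.
  have u0 : 0 <= u by rewrite subr_ge0 ler_ln ?posrE // ler_nat.
  have uj : u <= j%:R^-1.
    have E1 : u = ln (n%:R / N%:R) by rewrite lnM ?posrE ?invr_gt0 // lnV ?posrE.
    have p0 : 0 < n%:R / N%:R :> R by rewrite divr_gt0.
    have := expR_ge1Dx (ln (n%:R / N%:R : R)); rewrite lnK ?posrE // -E1.
    have : n%:R / N%:R <= 1 + j%:R^-1 :> R.
      rewrite ler_pdivrMr // mulrDl mul1r.
      have -> : j%:R^-1 * N%:R = M%:R :> R by rewrite /N natrM mulKf // gt_eqF.
      by rewrite -natrD ler_nat addnC (leq_trans (ltnW nN')) // /N' mulSn.
    lra.
  have u1 : u <= 1.
    by apply: (le_trans uj); rewrite invf_le1 // ler1n.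
  have -> : (cnt n)%:R * cpow n%:R (- z) * cpow N%:R z =
      ((cnt n)%:R : R)%:C%C * cexp (Complex (- (sg * u)) (- (tau * u))).
    rewrite rmorph_nat -mulrA !cpowE -cexpD; congr (_ * cexp _).
    rewrite /u /sg /tau; case: (z) => x y; apply/eqP; rewrite eq_complex /=.
    by apply/andP; split; apply/eqP; ring.
  rewrite mulrC [X in _ <= complex.Re X]mulrC Re_mulreal [leRHS]mulrC [leLHS]mulrC.
  rewrite ler_wpM2l // /cexp /=; apply: ler_pM; rewrite ?expR_ge0 ?invr_ge0 //.
    rewrite ler_expR lerN2; apply: (le_trans (ler_norm _)).
    by rewrite normrM (ger0_norm u0) ler_piMr.
  rewrite -[2^-1]mul1r; apply: Hd; rewrite normrN normrM (ger0_norm u0).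
  by apply: le_lt_trans jd; rewrite ler_wpM2l.
have D4 := le_trans D3 (le_trans (ler_norm _) (le_trans (le_Re_cabs _) D2)).
have E0 : 0 < expR (- `|sg|) by exact: expR_gt0.
have D5 := ler_wpM2r (ltW (divr_gt0 E0 (ltr0Sn _ 1))) h3.
have D6 := le_trans D5 D4.
have P0 : 0 < vol / j%:R * N%:R ^+ b * expR (- `|sg|).
  by rewrite !mulr_gt0 // ?invr_gt0 // exprn_gt0.
have : vol / j%:R * N%:R ^+ b * expR (- `|sg|) * (1 / 4) <=
       vol / j%:R * N%:R ^+ b * expR (- `|sg|) * (1 / 8).
  move: D6; rewrite /e; congr (_ <= _); field; by rewrite gt_eqF.
rewrite ler_pM2l // => ?; lra.
Qed.

End StableZetaTheorem.

(** * Continuation and residues of the stable zeta function *)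

Section StableZetaContinuation.
Variables (R : realType) (V E : finType) (src tgt : E -> V).
Hypothesis conn : graph_connected src tgt.
Variables (b : nat) (vol : R) (m : nat) (vq : rat) (A : nat -> nat -> rat).
Hypothesis b1 : (1 <= b)%N.
Hypothesis m0 : (0 < m)%N.
Hypothesis vqE : ratr vq = vol.
Local Notation cnt n := (size (cycles_of_norm src tgt n)).
Hypothesis cntE : forall n, (0 < n)%N ->
  (cnt n)%:R = \sum_(l < b) A l (n %% m)%N * n%:R ^+ l :> rat.
Hypothesis sumA : \sum_(r < m) A b.-1 r = m%:R * (b%:R * vq).
Implicit Types z w : R[i].

(** The numbers [p_lk]. The mean [b vq] of the top coefficient is taken out because the Riemann zeta
    term carries it; the top coefficients then sum to 0 over a period. *)
Definition zeta_coef (l k : nat) : rat :=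
  A l (k %% m)%N - (if l == b.-1 then b%:R * vq else 0).

Lemma zeta_coef_mod l k : zeta_coef l (k %% m)%N = zeta_coef l k.
Proof. by rewrite /zeta_coef modn_mod. Qed.

Lemma sum_zeta_coef : \sum_(k < m) zeta_coef b.-1 k.+1 = 0.
Proof.
rewrite /zeta_coef eqxx sumrB sum_cyclic_shift // sumA sumr_const card_ord.
by rewrite -[X in _ - X]mulr_natl subrr.
Qed.

Definition stable_zeta z : R[i] :=
  Complex (b%:R * vol) 0 * riemann_zeta (z - b%:R + 1) +
  \sum_(l < b) cpow (m%:R : R) (l%:R - z) *
    (\sum_(k < m) ratr (zeta_coef l k.+1) * hurwitz_zeta (k.+1%:R / m%:R : R) (z - l%:R)).

Lemma ratr_complex (x : rat) : ratr x = (ratr x : R)%:C%C :> R[i].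
Proof. by rewrite (fmorph_rat (real_complex R)). Qed.

Lemma cnt_term n z : (0 < n)%N -> (cnt n)%:R * cpow (n%:R : R) (- z) =
  Complex (b%:R * vol) 0 * cpow (n%:R : R) (- (z - b%:R + 1)) +
  \sum_(l < b) ratr (zeta_coef l n) * cpow (n%:R : R) (- (z - l%:R)).
Proof.
move=> n0; have nR : 0 < n%:R :> R by rewrite ltr0n.
have shift (l : nat) : cpow (n%:R : R) (- (z - l%:R)) = n%:R ^+ l * cpow n%:R (- z).
  by rewrite opprB cpowD cpow_nat // rmorph_nat.
have -> : - (z - b%:R + 1) = - (z - b.-1%:R) by rewrite -[in b%:R](prednK b1) -natr1; ring.
rewrite shift; under eq_bigr do rewrite shift mulrA.
rewrite -mulr_suml mulrA -mulrDl; congr (_ * _).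
have -> : Complex (b%:R * vol) 0 = ratr (b%:R * vq) :> R[i].
  have -> // : ratr (b%:R * vq) = (b%:R * vol)%:C%C :> R[i].
  by rewrite ratr_complex (rmorphM (ratr : {rmorphism rat -> R})) /= ratr_nat vqE.
have -> : (cnt n)%:R = ratr (cnt n)%:R :> R[i] by rewrite ratr_nat.
rewrite cntE // rmorph_sum /=.
have bb : (b.-1 < b)%N by rewrite prednK.
rewrite (bigD1 (Ordinal bb)) //= [X in _ = _ + X](bigD1 (Ordinal bb)) //=.
rewrite addrA /zeta_coef eqxx rmorphB /= rmorphM rmorphXn /= ratr_nat; congr (_ + _).
  by ring.
apply: eq_bigr => l; rewrite -val_eqE /= => /negbTE ->.
by rewrite subr0 rmorphM rmorphXn /= ratr_nat.
Qed.

Lemma dirichlet_cvg z : b%:R < complex.Re z -> seqlim (dirichlet src tgt z) (stable_zeta z).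
Proof.
move=> zb.
have -> : dirichlet src tgt z = (fun N =>
   Complex (b%:R * vol) 0 * hurwitz_partial (1 : R) (z - b%:R + 1) N +
   \sum_(l < b) \sum_(k < m) ratr (zeta_coef l k.+1) *
     \sum_(1 <= n < N.+1) (if n == k.+1 %[mod m] then cpow (n%:R : R) (- (z - l%:R)) else 0)).
  apply/funext => N; rewrite /dirichlet.
  have -> : hurwitz_partial (1 : R) (z - b%:R + 1) N =
     \sum_(1 <= n < N.+1) cpow (n%:R : R) (- (z - b%:R + 1)).
    by rewrite big_add1 /=; apply: eq_bigr => n _; rewrite nat1r.
  have -> : \sum_(l < b) \sum_(k < m) ratr (zeta_coef l k.+1) *
     \sum_(1 <= n < N.+1) (if n == k.+1 %[mod m] then cpow (n%:R : R) (- (z - l%:R)) else 0) =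
    \sum_(1 <= n < N.+1) \sum_(l < b) ratr (zeta_coef l n) * cpow (n%:R : R) (- (z - l%:R)).
    under eq_bigr => l _.
      under eq_bigr => k _ do rewrite mulr_sumr.
      rewrite exchange_big /=.
      over.
    rewrite exchange_big /=; apply: eq_bigr => n _; apply: eq_bigr => l _.
    have := @sum_over_residues R m n (fun k => ratr (zeta_coef l k))
      (cpow (n%:R : R) (- (z - l%:R))) m0 (fun k => congr1 ratr (zeta_coef_mod l k)).
    by rewrite big_add1 /= big_mkord.
  rewrite mulr_sumr -big_split /=; apply: eq_big_nat => n /andP[n0 _].
  exact: cnt_term.
have ReBnat (n : nat) : complex.Re (z - n%:R) = complex.Re z - n%:R by rewrite ReB Re_nat.
apply: seqlimD.
  apply: seqlimZ; apply: (hurwitz_zeta_series (@ltr01 R)).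
  have -> : complex.Re (z - b%:R + 1) = complex.Re (z - b%:R) + 1 by case: (z - b%:R).
  by rewrite ReBnat; lra.
apply: (@seqlim_sum R _ _ (fun (l : 'I_b) N => \sum_(k < m) ratr (zeta_coef l k.+1) *
     \sum_(1 <= n < N.+1) (if n == k.+1 %[mod m] then cpow (n%:R : R) (- (z - l%:R)) else 0))) => l.
rewrite mulr_sumr.
apply: (@seqlim_sum R _ _ (fun (k : 'I_m) N => ratr (zeta_coef l k.+1) *
     \sum_(1 <= n < N.+1) (if n == k.+1 %[mod m] then cpow (n%:R : R) (- (z - l%:R)) else 0))) => k.
rewrite mulrCA; apply: seqlimZ; rewrite -[l%:R - z]opprB.
apply: residue_class_series => //.
rewrite ReBnat; apply: (@lt_le_trans _ _ (complex.Re z - b%:R + 1)); first by lra.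
have : l.+1%:R <= b%:R :> R by rewrite ler_nat.
by rewrite -natr1; lra.
Qed.

Lemma nat_sub_eq1 (j l : nat) : ((j%:R - l%:R : R[i]) == 1) = (j == l.+1).
Proof. by rewrite subr_eq addrC natr1 eqr_nat. Qed.

Lemma riemann_shift z : z - b%:R + 1 = z - b.-1%:R.
Proof. by rewrite -[in b%:R](prednK b1) -natr1; ring. Qed.

Lemma cdiff_stable_zeta z : ~ (exists2 k : nat, (1 <= k <= b)%N & z = k%:R) ->
  cdifferentiable stable_zeta z.
Proof.
move=> np; have notone (l : nat) : (l < b)%N -> z - l%:R != 1.
  move=> lb; rewrite subr_eq; apply/eqP => zE; apply: np; exists l.+1 => //.
  by rewrite zE nat1r.
apply: cdiffD.
  apply: cdiff_mull.
  have -> : (fun w => riemann_zeta (w - b%:R + 1)) =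
            (fun w => hurwitz_zeta (1 : R) (w - b.-1%:R)).
    by apply/funext => w; rewrite riemann_shift.
  by apply: cdiff_hurwitz_shift => //; apply: notone; rewrite prednK.
apply: (@cdiff_sum R _ _ (fun (l : 'I_b) w => cpow (m%:R : R) (l%:R - w) *
    (\sum_(k < m) ratr (zeta_coef l k.+1) * hurwitz_zeta (k.+1%:R / m%:R : R) (w - l%:R)))) => l.
apply: cdiffM.
  apply: (@cdiff_comp _ (fun w => l%:R - w)); last exact: cdiff_cpow.
  by apply: cdiffD; [exact: cdiff_cst | apply: cdiffN; exact: cdiff_id].
apply: (@cdiff_sum R _ _ (fun (k : 'I_m) w => ratr (zeta_coef l k.+1) *
  hurwitz_zeta (k.+1%:R / m%:R : R) (w - l%:R))) => k.
apply: cdiff_mull; apply: cdiff_hurwitz_shift; last exact: notone.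
by rewrite divr_gt0 // ltr0n.
Qed.

Lemma stable_zeta_residue (j : nat) :
  (fun z => (z - j%:R) * stable_zeta z) @ (j%:R : R[i])^' -->
  Complex (b%:R * vol) 0 * (j == b)%:R +
  \sum_(l < b) cpow (m%:R : R) (l%:R - j%:R) *
    (\sum_(k < m) ratr (zeta_coef l k.+1) * (j == l.+1)%:R).
Proof.
have -> : (fun z => (z - j%:R) * stable_zeta z) = (fun z =>
   Complex (b%:R * vol) 0 * ((z - j%:R) * hurwitz_zeta (1 : R) (z - b.-1%:R)) +
   \sum_(l < b) cpow (m%:R : R) (l%:R - z) *
    (\sum_(k < m) ratr (zeta_coef l k.+1) *
       ((z - j%:R) * hurwitz_zeta (k.+1%:R / m%:R : R) (z - l%:R)))).
  apply/funext => z; rewrite /stable_zeta /riemann_zeta riemann_shift mulrDr mulrCA; congr (_ + _).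
  rewrite mulr_sumr; apply: eq_bigr => l _; rewrite mulrCA; congr (_ * _).
  by rewrite mulr_sumr; apply: eq_bigr => k _; rewrite mulrCA.
have res (q : R) (l : nat) : 0 < q ->
  (fun z => (z - j%:R) * hurwitz_zeta q (z - l%:R)) @ (j%:R : R[i])^' --> ((j == l.+1)%:R : R[i]).
  by move=> q0; rewrite -nat_sub_eq1; exact: hurwitz_shift_residue.
apply: cvg_at_pointD.
  have := cvg_at_pointM (@cvg_at_point_cst R (Complex (b%:R * vol) 0) j%:R) (res 1 b.-1 ltr01).
  by rewrite prednK.
apply: (@cvg_at_point_sum R _ _ (fun (l : 'I_b) z => cpow (m%:R : R) (l%:R - z) *
    (\sum_(k < m) ratr (zeta_coef l k.+1) *
       ((z - j%:R) * hurwitz_zeta (k.+1%:R / m%:R : R) (z - l%:R))))) => l.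
have dc : cdifferentiable (fun z => cpow (m%:R : R) (l%:R - z)) j%:R.
  apply: (@cdiff_comp _ (fun w => l%:R - w)); last exact: cdiff_cpow.
  by apply: cdiffD; [exact: cdiff_cst | apply: cdiffN; exact: cdiff_id].
apply: (cvg_at_pointM (cvg_at_point_cdiff dc)).
apply: (@cvg_at_point_sum R _ _ (fun (k : 'I_m) z => ratr (zeta_coef l k.+1) *
       ((z - j%:R) * hurwitz_zeta (k.+1%:R / m%:R : R) (z - l%:R)))) => k.
apply: (cvg_at_pointM (@cvg_at_point_cst R (ratr (zeta_coef l k.+1)) j%:R)).
by apply: res; rewrite divr_gt0 // ltr0n.
Qed.

(** At [b] only the Hurwitz terms with [l = b - 1] have a pole, each of residue 1 and with the same
    factor [m^(l - z)]. Their coefficients sum to 0, so the Riemann term alone gives the residue. *)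
Lemma stable_zeta_residue_top :
  (fun z => (z - b%:R) * stable_zeta z) @ (b%:R : R[i])^' --> Complex (b%:R * vol) 0.
Proof.
have S0 : \sum_(l < b) cpow (m%:R : R) (l%:R - b%:R) *
    (\sum_(k < m) ratr (zeta_coef l k.+1) * (b == l.+1)%:R) = 0 :> R[i].
  apply: big1 => l _; have [->|lb] := eqVneq (val l) b.-1.
    by rewrite -mulr_suml -rmorph_sum /= sum_zeta_coef rmorph0 mul0r mulr0.
  have -> : (b == l.+1) = false by apply: contra_neqF lb => /eqP /(congr1 predn) ->.
  by rewrite big1 ?mulr0 // => k _; rewrite mulr0.
have -> : Complex (b%:R * vol) 0 = Complex (b%:R * vol) 0 * (b == b)%:R +
  \sum_(l < b) cpow (m%:R : R) (l%:R - b%:R) *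
    (\sum_(k < m) ratr (zeta_coef l k.+1) * (b == l.+1)%:R) :> R[i].
  by rewrite S0 eqxx mulr1 addr0.
exact: stable_zeta_residue.
Qed.

End StableZetaContinuation.

(** * Convergence, continuation and zeta formula put together *)

Theorem theorem3p2 (R : realType) (V E : finType) (src tgt : E -> V)
  (b : nat) (gamma : 'I_b -> {ffun E -> int}) :
  graph_connected src tgt ->
  Zbasis src tgt gamma ->
  (1 <= b)%N ->
  let Vol : R := fine (stball_volume src tgt gamma) in
  let poles := fun z : R[i] => exists2 k : nat, (1 <= k <= b)%N & z = k%:R in
  (* 1) convergence / divergence *)
  (forall z : R[i], b%:R < complex.Re z -> zeta_st_converges src tgt z) /\
  (forall z : R[i], complex.Re z < b%:R -> ~ zeta_st_converges src tgt z) /\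
  (* 2) meromorphic continuation with (at most) simple poles at 1..b *)
  exists F : R[i] -> R[i],
    (forall z : R[i], ~ poles z -> cdifferentiable F z) /\
    (forall z : R[i], b%:R < complex.Re z ->
       zeta_st_partial src tgt z t @[t --> +oo] --> F z) /\
    (forall k : nat, (1 <= k <= b)%N ->
       exists r : R[i], (fun z : R[i] => (z - k%:R) * F z) @ (k%:R : R[i])^' --> r) /\
    ((fun z : R[i] => (z - b%:R) * F z) @ (b%:R : R[i])^' --> Complex (b%:R * Vol) 0) /\
    (* 3) expression via Riemann and Hurwitz zeta functions *)
    exists (m : nat) (p : nat -> nat -> rat), (0 < m)%N /\
      forall z : R[i], ~ poles z ->
        F z = Complex (b%:R * Vol) 0 * riemann_zeta (z - b%:R + 1)
            + \sum_(0 <= l < b) cpow (m%:R : R) (l%:R - z) *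
                (\sum_(1 <= k < m.+1)
                   ratr (p l k) * hurwitz_zeta (k%:R / m%:R : R) (z - l%:R)).
Proof.
move=> conn basis b1 Vol poles.
have [m [vq [A [m0 vqE cntE sumA]]]] := cycle_count_expansion R conn basis b1.
have cvgF (z : R[i]) : b%:R < complex.Re z ->
    zeta_st_partial src tgt z t @[t --> +oo] --> stable_zeta b Vol m vq A z.
  by move=> zb; apply/(zeta_st_partial_cvg conn); exact: dirichlet_cvg.
split.
  move=> z zb; split; first by move=> t /ltW; exact: finite_zeta_index.
  by eexists; exact: cvgF.
split; first exact: (stable_zeta_diverges conn basis b1).
exists (stable_zeta b Vol m vq A); split; first by move=> z; exact: cdiff_stable_zeta.
split; first exact: cvgF.
split; first by move=> k _; eexists; exact: stable_zeta_residue.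
split; first exact: stable_zeta_residue_top.
exists m, (zeta_coef b m vq A); split=> // z _.
rewrite /stable_zeta big_mkord; congr (_ + _); apply: eq_bigr => l _; congr (_ * _).
by rewrite big_add1 /= big_mkord.
Qed.
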